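(* Let $g\in L^2(\mathbb{R}^2)$ be real-valued and let $\psi^{(+)}$ be the monogenic extension of a real-valued admissible wavelet $\psi^{(r)}$. For $\boldsymbol{\xi}=(a,\theta,\mathbf{b})$ with $a>0$, $\theta\in[0,2\pi)$, $\mathbf{b}\in\mathbb{R}^2$ and $\boldsymbol{\xi}_0=(a,0,\mathbf{b})$, $$w^{(+)}_\psi(\boldsymbol{\xi};g)=\Big[w^{(r)}_\psi(\boldsymbol{\xi}_0;\widetilde g_{-\theta})\Big]^{(+)}_\theta=w^{(r)}_\psi\big(\boldsymbol{\xi};\widetilde g^{(+)}_{-\theta,\theta}\big),$$ where $[\,\cdot\,]^{(+)}_\theta$ denotes the $\theta$-monogenic signal of the real-valued function $\mathbf{b}\mapsto w^{(r)}_\psi((a,0,\mathbf{b});\widetilde g_{-\theta})$, evaluated at $\mathbf{b}$. That is, the monogenic wavelet transform of $g$ equals both the scale localisation of the $\theta$-monogenic extension of the signal and the $\theta$-monogenic extension of the scale-localised signal.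
   Context: $\mathbb{H}$: quaternions with units $\mathbf{i},\mathbf{j},\mathbf{k}$, $\mathbf{i}^2=\mathbf{j}^2=\mathbf{k}^2=\mathbf{i}\mathbf{j}\mathbf{k}=-1$, conjugation $q\mapsto q^*$. $\mathbf{r}_\theta=\begin{pmatrix}\cos\theta&-\sin\theta\\ \sin\theta&\cos\theta\end{pmatrix}$, $R_\theta h(\mathbf{x})=h(\mathbf{r}_{-\theta}\mathbf{x})$. Fourier transform: $\int_{\mathbb{R}^2}h(\mathbf{x})e^{-2\pi\mathbf{j}\mathbf{f}^T\mathbf{x}}d^2\mathbf{x}$. Riesz transforms $\mathcal{R}_l$, $l=1,2$, are understood as the Fourier multipliers $-\mathbf{j}f_l/|\mathbf{f}|$. $\theta$-monogenic signal of a real-valued $h$: $h^{(+)}_\theta=R_\theta h+\mathbf{i}R_\theta\mathcal{R}_1h+\mathbf{j}R_\theta\mathcal{R}_2h$. For real $g$, $\widetilde g_{-\theta}(\mathbf{x})=g(\mathbf{r}_\theta\mathbf{x})$ and $\widetilde g^{(+)}_{-\theta,\theta}=(\widetilde g_{-\theta})^{(+)}_\theta$ (its real part is $g$). $\psi^{(r)}\in L^2(\mathbb{R}^2)$ is admissible: $\int|\psi^{(r)}|^2=1$ and $0<(2\pi)^2\int|\Psi^{(r)}(\mathbf{f})|^2/|\mathbf{f}|^2d^2\mathbf{f}<\infty$. Monogenic wavelet: $\psi^{(+)}=\psi^{(r)}+\mathbf{i}\mathcal{R}_1\psi^{(r)}+\mathbf{j}\mathcal{R}_2\psi^{(r)}$.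 For any mother function $\psi$, $\psi_{\boldsymbol{\xi}}(\mathbf{x})=\frac1a\psi(\mathbf{r}_{-\theta}(\mathbf{x}-\mathbf{b})/a)$. For real- or quaternion-valued $h\in L^2$: $w^{(+)}_\psi(\boldsymbol{\xi};h)=\int h(\mathbf{x})[\psi^{(+)}_{\boldsymbol{\xi}}(\mathbf{x})]^*d^2\mathbf{x}$, $w^{(r)}_\psi(\boldsymbol{\xi};h)=\int h(\mathbf{x})\psi^{(r)}_{\boldsymbol{\xi}}(\mathbf{x})d^2\mathbf{x}$. *)

(* Defs.v *)
From HB Require Import structures.
From mathcomp Require Import all_boot all_order all_algebra.
From mathcomp Require Import ring.
From mathcomp Require Import all_classical all_reals all_analysis.

Set Implicit Arguments.
Unset Strict Implicit.
Unset Printing Implicit Defensive.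

Import Order.TTheory GRing.Theory Num.Theory.
Import numFieldNormedType.Exports.

Local Open Scope classical_set_scope.
Local Open Scope ring_scope.

(* MathComp-Analysis development.  The plane is R * R with the product of the
   Lebesgue measures; functions in L^1 or L^2 are represented by everywhere
   defined (Borel) measurable functions. *)

(* [Quat a b c d] is a + b i + c j + d k. *)
Record quat (R : Type) := Quat { qre : R; qim1 : R; qim2 : R; qim3 : R }.

Arguments qre {R}.
Arguments qim1 {R}.
Arguments qim2 {R}.
Arguments qim3 {R}.

Definition quat_to (R : Type) (q : quat R) : R * R * R * R :=
  (qre q, qim1 q, qim2 q, qim3 q).
Definition quat_of (R : Type) (t : R * R * R * R) : quat R :=
  let: (a, b, c, d) := t in Quat a b c d.
Lemma quat_toK (R : Type) : cancel (@quat_to R) (@quat_of R).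
Proof. by case. Qed.

HB.instance Definition _ (R : choiceType) :=
  Choice.copy (quat R) (can_type (@quat_toK R)).

Section QuaternionRing.
Variable R : comNzRingType.
Implicit Types p q : quat R.

Definition quat_add p q :=
  Quat (qre p + qre q) (qim1 p + qim1 q) (qim2 p + qim2 q) (qim3 p + qim3 q).
Definition quat_opp p := Quat (- qre p) (- qim1 p) (- qim2 p) (- qim3 p).
Definition quat_zero : quat R := Quat 0 0 0 0.
Definition quat_one : quat R := Quat 1 0 0 0.
Definition quat_mul p q :=
  let: Quat a b c d := p in let: Quat a' b' c' d' := q in
  Quat (a * a' - b * b' - c * c' - d * d')
       (a * b' + b * a' + c * d' - d * c')
       (a * c' - b * d' + c * a' + d * b')
       (a * d' + b * c' - c * b' + d * a').

Lemma quat_addA : associative quat_add.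
Proof. by move=> [????] [????] [????]; rewrite /quat_add /= !addrA. Qed.
Lemma quat_addC : commutative quat_add.
Proof.
move=> [a b c d] [a' b' c' d']; rewrite /quat_add /=.
by congr Quat; rewrite addrC.
Qed.
Lemma quat_add0 : left_id quat_zero quat_add.
Proof. by move=> [????]; rewrite /quat_add /= !add0r. Qed.
Lemma quat_addN : left_inverse quat_zero quat_opp quat_add.
Proof. by move=> [????]; rewrite /quat_add /= !addNr. Qed.

HB.instance Definition _ := GRing.isZmodule.Build (quat R)
  quat_addA quat_addC quat_add0 quat_addN.

Lemma quat_mulA : associative quat_mul.
Proof. by move=> [????] [????] [????]; rewrite /quat_mul; congr Quat; ring. Qed.
Lemma quat_mul1 : left_id quat_one quat_mul.
Proof. by move=> [????]; rewrite /quat_mul /=; congr Quat; ring. Qed.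
Lemma quat_mulr1 : right_id quat_one quat_mul.
Proof. by move=> [????]; rewrite /quat_mul /=; congr Quat; ring. Qed.
Lemma quat_mulDl : left_distributive quat_mul quat_add.
Proof.
move=> [????] [????] [????]; rewrite /quat_mul /quat_add /=.
by congr Quat; ring.
Qed.
Lemma quat_mulDr : right_distributive quat_mul quat_add.
Proof.
move=> [????] [????] [????]; rewrite /quat_mul /quat_add /=.
by congr Quat; ring.
Qed.
Lemma quat_one_neq0 : quat_one != quat_zero.
Proof. by apply/eqP => -[] /eqP; rewrite oner_eq0. Qed.

HB.instance Definition _ := GRing.Zmodule_isNzRing.Build (quat R)
  quat_mulA quat_mul1 quat_mulr1 quat_mulDl quat_mulDr quat_one_neq0.

Definition qreal (a : R) : quat R := Quat a 0 0 0.
Definition qi : quat R := Quat 0 1 0 0.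
Definition qj : quat R := Quat 0 0 1 0.
Definition qk : quat R := Quat 0 0 0 1.

Definition qconj q : quat R := Quat (qre q) (- qim1 q) (- qim2 q) (- qim3 q).

Definition qnormsq q : R :=
  qre q ^+ 2 + qim1 q ^+ 2 + qim2 q ^+ 2 + qim3 q ^+ 2.

Lemma qiMqi : qi * qi = -1.
Proof.
rewrite -[LHS]/(quat_mul qi qi) -[RHS]/(quat_opp quat_one) /quat_opp /=.
by congr Quat; ring.
Qed.
Lemma qjMqj : qj * qj = -1.
Proof.
rewrite -[LHS]/(quat_mul qj qj) -[RHS]/(quat_opp quat_one) /quat_opp /=.
by congr Quat; ring.
Qed.
Lemma qkMqk : qk * qk = -1.
Proof.
rewrite -[LHS]/(quat_mul qk qk) -[RHS]/(quat_opp quat_one) /quat_opp /=.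
by congr Quat; ring.
Qed.
Lemma qiMqjMqk : qi * qj * qk = -1.
Proof.
rewrite -[LHS]/(quat_mul (quat_mul qi qj) qk) -[RHS]/(quat_opp quat_one).
by rewrite /quat_opp /=; congr Quat; ring.
Qed.

End QuaternionRing.

Arguments qreal {R}.
Arguments qi {R}.
Arguments qj {R}.
Arguments qk {R}.

Section Plane.
Variable R : realType.
Implicit Types (x f b : R * R) (h g : R * R -> R) (u : R * R -> quat R).

Definition mu2 : {measure set (measurableTypeR R * measurableTypeR R) -> \bar R} :=
  (@lebesgue_measure R \x @lebesgue_measure R)%E.

Definition dot2 f x : R := f.1 * x.1 + f.2 * x.2.
Definition enorm x : R := Num.sqrt (x.1 ^+ 2 + x.2 ^+ 2).

Definition rotv (theta : R) x : R * R :=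
  (cos theta * x.1 - sin theta * x.2, sin theta * x.1 + cos theta * x.2).

Definition rotate (theta : R) h : R * R -> R := fun x => h (rotv (- theta) x).

Definition L2 h : Prop := h \in Lfun mu2 2%:E.

Definition L1q u : Prop :=
  [/\ qre \o u \in Lfun mu2 1, qim1 \o u \in Lfun mu2 1,
      qim2 \o u \in Lfun mu2 1 & qim3 \o u \in Lfun mu2 1].
Definition L2q u : Prop :=
  [/\ L2 (qre \o u), L2 (qim1 \o u), L2 (qim2 \o u) & L2 (qim3 \o u)].

Definition qintegral (D : set (R * R)) u : quat R :=
  Quat (\int[mu2]_(x in D) qre (u x)) (\int[mu2]_(x in D) qim1 (u x))
       (\int[mu2]_(x in D) qim2 (u x)) (\int[mu2]_(x in D) qim3 (u x)).

(* e^{j t} *)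
Definition qexpj (t : R) : quat R := Quat (cos t) 0 (sin t) 0.

Definition fourier_on (D : set (R * R)) u f : quat R :=
  qintegral D (fun x => u x * qexpj (- (2 * pi * dot2 f x))).

Definition inv_fourier U x : quat R :=
  qintegral setT (fun f => U f * qexpj (2 * pi * dot2 f x)).

(* [U] is the Fourier transform of [u] in the L^2 sense: the L^2 limit of the
   Fourier integrals of [u] over the discs of radius n. *)
Definition fourierL2 u U : Prop :=
  [/\ L2q u, L2q U &
    (fun n : nat => \int[mu2]_f
       (qnormsq (U f - fourier_on [set x | enorm x <= n%:R] u f))%:E)%E
      @ \oo --> 0%E].

(* [u] is, at every point, the absolutely convergent inverse Fourier integral
   of the integrable function [U].  A correlation of two L^2 functions has
   this property but need not be in L^2. *)
Definition fourierW u U : Prop := L1q U /\ forall x, u x = inv_fourier U x.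

(* Indices are shifted: 0 and 1 in 'I_2 stand for the coordinates f_1 and f_2,
   hence for the first and the second Riesz transform. *)
Definition fcoord (l : 'I_2) f : R := if l == ord0 then f.1 else f.2.

(* The division makes the value 0 at the origin, a null set. *)
Definition riesz_symbol (l : 'I_2) f : quat R :=
  - qj * qreal (fcoord l f / enorm f).

Definition riesz_rel (F : (R * R -> quat R) -> (R * R -> quat R) -> Prop)
    (l : 'I_2) h : set (R * R -> R) :=
  [set k : R * R -> R | exists U, F (qreal \o h) U /\
             F (qreal \o k) (fun f => U f * riesz_symbol l f)].

(* Riesz transform as a Fourier multiplier.  It is pointwise determined when
   [h] is the inverse Fourier integral of an integrable function; otherwise
   it is a representative of the Riesz transform on L^2, determined up to a
   null set. *)
Definition riesz (l : 'I_2) h : R * R -> R :=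
  xget (xget (fun=> 0) (riesz_rel fourierL2 l h)) (riesz_rel fourierW l h).

Definition monogenic_theta (theta : R) h x : quat R :=
  qreal (rotate theta h x)
  + qi * qreal (rotate theta (riesz 0 h) x)
  + qj * qreal (rotate theta (riesz 1 h) x).

Definition tilde (theta : R) g : R * R -> R := fun x => g (rotv theta x).

Definition monogenic_wavelet psi x : quat R :=
  qreal (psi x) + qi * qreal (riesz 0 psi x) + qj * qreal (riesz 1 psi x).

Definition admissible (psi : R * R -> R) : Prop :=
  [/\ L2 psi, (\int[mu2]_x ((`|psi x| ^+ 2)%:E) = 1)%E &
    exists Psi, fourierL2 (qreal \o psi) Psi /\
      (0 < ((2 * pi) ^+ 2)%:E
             * \int[mu2]_f (qnormsq (Psi f) / enorm f ^+ 2)%:E < +oo)%E].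

(* Index (a, theta, b) of a wavelet. *)
Record windex := Windex { wscale : R; wangle : R; wshift : R * R }.

Definition wavelet_arg (xi : windex) x : R * R :=
  rotv (- wangle xi) ((x.1 - (wshift xi).1) / wscale xi,
                     (x.2 - (wshift xi).2) / wscale xi).

Definition wavelet_at psi (xi : windex) x : R :=
  (wscale xi)^-1 * psi (wavelet_arg xi x).
Definition qwavelet_at psi (xi : windex) x : quat R :=
  qreal (wscale xi)^-1 * psi (wavelet_arg xi x).

Definition wt_plus psi (xi : windex) u : quat R :=
  qintegral setT
    (fun x => u x * qconj (qwavelet_at (monogenic_wavelet psi) xi x)).

Definition wt_real psi (xi : windex) h : R :=
  \int[mu2]_x (h x * wavelet_at psi xi x).
Definition qwt_real psi (xi : windex) u : quat R :=
  qintegral setT (fun x => u x * qreal (wavelet_at psi xi x)).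

End Plane.

(* Main.v *)
(* Everything is reduced to the real Hartley transform, whose kernel
   cas t = cos t + sin t replaces the Fourier exponential: the Fourier transform
   of a real function u with Hartley transform h is (even part of h) - j (odd
   part of h), and the Riesz multiplier -j f_l/|f| turns h into
   f |-> (f_l/|f|) h(-f).  The Hartley transform is its own inverse on L^2.
   This follows from Abel-Poisson summation: inserting the weight
   exp(-e(|x_1|+|x_2|)) turns int (Hu)(Hv) into the average of u(y)v(z) against
   the product Poisson kernel, which yields Bessel's inequality by the Schur
   test and, for v the indicator of a rectangle and e -> 0, the identity
   int (Hu)(Hv) = int uv; functions are then recovered from their integrals over
   rectangles.

   By Parseval, c |-> int g(x) psi((x-c)/a)/a dx is the absolutely convergent
   Hartley integral of a spectrum built from Hg and Hpsi, and since f_l/|f| is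
   odd and homogeneous of degree 0, applying the Riesz multiplier to this
   spectrum amounts to applying it to Hg, or to Hpsi with the opposite sign.
   The angle theta only enters through the rotation invariance of the Lebesgue
   measure. *)
From HB Require Import structures.
Require Import Defs.
From mathcomp Require Import all_boot all_order all_algebra.
From mathcomp Require Import ring lra.
From mathcomp Require Import all_classical all_reals all_analysis.
From mathcomp Require Import measurable_realfun.

Set Implicit Arguments.
Unset Strict Implicit.
Unset Printing Implicit Defensive.

Import Order.TTheory GRing.Theory Num.Theory.
Import numFieldNormedType.Exports.

Local Open Scope classical_set_scope.
Local Open Scope ring_scope.

(** * Integrable real functions *)

(** The obstacle is that [riesz] chooses between two notions of multiplier. The function of [b]
    whose [theta]-monogenic signal is taken is a correlation of two L^2 functions. It need not be in
    L^2, yet its Riesz transform is evaluated at a point, so it has to be determined everywhere,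
    through an integrable spectrum. For [psi] and the rotated signal either branch of the choice may
    occur, so both branches are shown to have the same L^2 Hartley transform. This rests on
    injectivity on L^1, and on the fact that an integrable function whose Hartley transform is
    square-integrable is itself square-integrable. Correlations only see functions up to null sets,
    so the remaining ambiguity disappears under the integral.

    The weight is a product of one-dimensional exponentials because every integral then has an
    elementary primitive: an exponential times trigonometric functions on one side, the arctangent
    on the other. *)

Section RealIntegrable.
Context d (T : measurableType d) (R : realType).
Variable mu : {measure set T -> \bar R}.
Implicit Types f g h : T -> R.

Definition intble f := mu.-integrable setT (EFin \o f).

Lemma intble_mfun f : intble f -> measurable_fun setT f.
Proof. by move=> /measurable_int /measurable_EFinP. Qed.

Lemma intble_le f g : measurable_fun setT f -> intble g ->
  (forall x, `|f x| <= g x) -> intble f.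
Proof.
move=> mf ig fg; apply: (le_integrable measurableT _ _ ig).
  exact/measurable_EFinP.
move=> x _ /=; rewrite lee_fin; apply: (le_trans (fg x)); exact: ler_norm.
Qed.

Lemma eq_intble f g : f =1 g -> intble f -> intble g.
Proof. by move=> /funext ->. Qed.

Lemma intbleD f g : intble f -> intble g -> intble (fun x => f x + g x).
Proof. by move=> f1 g1; apply: (integrableD measurableT f1 g1). Qed.

Lemma intbleB f g : intble f -> intble g -> intble (fun x => f x - g x).
Proof. by move=> f1 g1; apply: (integrableB measurableT f1 g1). Qed.

Lemma intbleZ (k : R) f : intble f -> intble (fun x => k * f x).
Proof. by move=> f1; apply: (integrableZl measurableT k f1). Qed.

Lemma intbleN f : intble f -> intble (fun x => - f x).
Proof. by move=> f1; apply: eq_intble (intbleZ (-1) f1) => x; rewrite mulN1r. Qed.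

Lemma intble_norm f : intble f -> intble (fun x => `|f x|).
Proof. by move=> f1; exact: (integrable_norm f1). Qed.

Lemma intble0 : intble (fun=> 0).
Proof. exact: integrable0. Qed.

Lemma intbleM_bounded f g (M : R) : intble f -> measurable_fun setT g ->
  (forall x, `|g x| <= M) -> intble (fun x => f x * g x).
Proof.
move=> f1 mg gM; apply: (intble_le _ (intbleZ M (intble_norm f1))).
  by apply: measurable_funM => //; exact: intble_mfun.
by move=> x; rewrite normrM mulrC; apply: ler_wpM2r.
Qed.

Lemma eq_rint f g : f =1 g -> \int[mu]_x f x = \int[mu]_x g x.
Proof. by move=> fg; apply: eq_Rintegral => x _; exact: fg. Qed.

Lemma rintD f g : intble f -> intble g ->
  \int[mu]_x (f x + g x) = \int[mu]_x f x + \int[mu]_x g x.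
Proof. by move=> ? ?; apply: RintegralD. Qed.

Lemma rintB f g : intble f -> intble g ->
  \int[mu]_x (f x - g x) = \int[mu]_x f x - \int[mu]_x g x.
Proof. by move=> ? ?; apply: RintegralB. Qed.

Lemma rintZ (k : R) f : intble f -> \int[mu]_x (k * f x) = k * \int[mu]_x f x.
Proof. by move=> ?; apply: RintegralZl. Qed.

Lemma rintZr (k : R) f : intble f -> \int[mu]_x (f x * k) = \int[mu]_x f x * k.
Proof. by move=> ?; apply: RintegralZr. Qed.

Lemma rintN f : intble f -> \int[mu]_x (- f x) = - \int[mu]_x f x.
Proof.
by move=> f1; rewrite -mulN1r -rintZ//; apply: eq_rint => x; rewrite mulN1r.
Qed.

Lemma rint0 : \int[mu]_x (0 : R) = 0.
Proof. by rewrite Rintegral_cst// mul0r. Qed.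

Lemma le_rint f g : intble f -> intble g -> (forall x, f x <= g x) ->
  \int[mu]_x f x <= \int[mu]_x g x.
Proof. by move=> ? ? fg; apply: le_Rintegral => // x _; exact: fg. Qed.

Lemma rint_ge0 f : (forall x, 0 <= f x) -> 0 <= \int[mu]_x f x.
Proof. by move=> f0; apply: Rintegral_ge0. Qed.

Lemma le_norm_rint f g : intble f -> intble g -> (forall x, `|f x| <= g x) ->
  `|\int[mu]_x f x| <= \int[mu]_x g x.
Proof.
move=> f1 g1 fg; apply: le_trans (le_normr_Rintegral measurableT f1) _.
by apply: le_rint => //; exact: intble_norm.
Qed.

Lemma rint_EFin f : intble f -> (\int[mu]_x (f x)%:E = (\int[mu]_x f x)%:E)%E.
Proof. by move=> f1; rewrite /Rintegral fineK//; exact: integrable_fin_num. Qed.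

Lemma ge0_intbleP f : measurable_fun setT f -> (forall x, 0 <= f x) ->
  (\int[mu]_x (f x)%:E < +oo)%E -> intble f.
Proof.
move=> mf f0 foo; apply/integrableP; split; first exact/measurable_EFinP.
apply: le_lt_trans foo; rewrite le_eqVlt; apply/orP; left; apply/eqP.
by apply: eq_integral => x _ /=; rewrite ger0_norm.
Qed.

Lemma rint_ae f g : measurable_fun setT f -> measurable_fun setT g ->
  (\forall x \ae mu, f x = g x) -> \int[mu]_x f x = \int[mu]_x g x.
Proof.
move=> mf mg fg; rewrite /Rintegral; congr fine; apply: ae_eq_integral => //.
- exact/measurable_EFinP.
- exact/measurable_EFinP.
- by apply: filterS fg => x + _ => ->.
Qed.

Lemma intble_ae f g : measurable_fun setT g ->
  (\forall x \ae mu, f x = g x) -> intble f -> intble g.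
Proof.
move=> mg fg f1; apply/integrableP; split; first exact/measurable_EFinP.
have /integrableP[_] := f1; apply: le_lt_trans.
rewrite le_eqVlt; apply/orP; left; apply/eqP; apply: ae_eq_integral => //.
- by apply: measurableT_comp => //; exact/measurable_EFinP.
- apply: measurableT_comp => //; apply/measurable_EFinP; exact: intble_mfun.
- by apply: filterS fg => x /= -> _.
Qed.

Lemma aeS (P Q : T -> Prop) : (forall x, P x -> Q x) ->
  (\forall x \ae mu, P x) -> \forall x \ae mu, Q x.
Proof. by move=> PQ; exact: filterS. Qed.

Lemma aeS2 (P Q S : T -> Prop) : (forall x, P x -> Q x -> S x) ->
  (\forall x \ae mu, P x) -> (\forall x \ae mu, Q x) -> \forall x \ae mu, S x.
Proof. by move=> PQS; exact: filterS2. Qed.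

Lemma ge0_rint_eq0_ae f : intble f -> (forall x, 0 <= f x) ->
  \int[mu]_x f x = 0 -> \forall x \ae mu, f x = 0.
Proof.
move=> f1 f0 fi0.
have mf : measurable_fun setT (EFin \o f).
  by apply/measurable_EFinP; exact: intble_mfun.
have : (\int[mu]_x `|(EFin \o f) x| = 0)%E.
  rewrite -[RHS]/(0%:E) -fi0 -(rint_EFin f1); apply: eq_integral => x _ /=.
  by rewrite ger0_norm.
move/(ae_eq_integral_abs mu measurableT mf).
by apply: filterS => x /(_ I) [].
Qed.

Lemma rint_dominated_cvg (F : nat -> T -> R) f g :
  (forall n, measurable_fun setT (F n)) -> measurable_fun setT f ->
  (\forall x \ae mu, F n x @[n --> \oo] --> f x) -> intble g ->
  (forall n x, `|F n x| <= g x) ->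
  \int[mu]_x F n x @[n --> \oo] --> \int[mu]_x f x.
Proof.
move=> mF mf Ff g1 Fg.
have [| | | |f1 _ cv] := @dominated_convergence _ _ _ mu setT measurableT
    (fun n => EFin \o F n) (EFin \o f) (EFin \o g) _ _ _ g1 _.
- by move=> n; apply/measurable_EFinP.
- exact/measurable_EFinP.
- by apply: filterS Ff => x Fx _ /=; apply/cvg_EFin => //; near=> n.
- by apply: aeW => x n _ /=; rewrite lee_fin.
apply: fine_cvg; rewrite fineK; last exact: integrable_fin_num f1.
exact: cv.
Unshelve. all: by end_near. Qed.

End RealIntegrable.

(** * Square-integrable functions *)

Section SquareIntegrable.
Context d (T : measurableType d) (R : realType).
Variable mu : {measure set T -> \bar R}.
Implicit Types f g h : T -> R.

Definition sqintble f :=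
  measurable_fun setT f /\ intble mu (fun x => f x ^+ 2).

Definition sqnorm f := \int[mu]_x (f x ^+ 2).

Definition cvg2 (F : nat -> T -> R) f :=
  sqnorm (fun x => F n x - f x) @[n --> \oo] --> (0 : R).

Lemma sqnorm_ge0 f : 0 <= sqnorm f.
Proof. by apply: rint_ge0 => x; exact: sqr_ge0. Qed.

Lemma sqintbleM f g : sqintble f -> sqintble g -> intble mu (fun x => f x * g x).
Proof.
move=> [mf f2] [mg g2]; apply: (intble_le _ (intbleD f2 g2)).
  exact: measurable_funM.
move=> x; rewrite normrM -[f x ^+ 2]real_normK ?num_real//.
rewrite -[g x ^+ 2]real_normK ?num_real//.
have := sqr_ge0 (`|f x| - `|g x|); have := normr_ge0 (f x).
by have := normr_ge0 (g x); nra.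
Qed.

Lemma sqintbleZ (k : R) f : sqintble f -> sqintble (fun x => k * f x).
Proof.
move=> [mf f2]; split; first exact: measurable_funM.
by apply: eq_intble (intbleZ (k ^+ 2) f2) => x; rewrite exprMn.
Qed.

Lemma sqintbleD f g : sqintble f -> sqintble g -> sqintble (fun x => f x + g x).
Proof.
move=> sf sg; split; first by apply: measurable_funD; [case: sf|case: sg].
apply: eq_intble (intbleD (intbleD sf.2 sg.2) (intbleZ 2 (sqintbleM sf sg))) => x.
by ring.
Qed.

Lemma sqintbleN f : sqintble f -> sqintble (fun x => - f x).
Proof.
move=> [mf f2]; split; first exact: measurableT_comp.
by apply: eq_intble f2 => x; rewrite sqrrN.
Qed.

Lemma sqintbleB f g : sqintble f -> sqintble g -> sqintble (fun x => f x - g x).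
Proof. by move=> sf sg; apply: sqintbleD => //; exact: sqintbleN. Qed.

Lemma sqintble_le f g : measurable_fun setT f -> sqintble g ->
  (forall x, `|f x| <= `|g x|) -> sqintble f.
Proof.
move=> mf [_ g2] fg; split => //; apply: (intble_le _ g2).
  exact: measurable_funX.
move=> x; rewrite normrX -[leRHS]real_normK ?num_real//.
by rewrite lerXn2r ?nnegrE.
Qed.

Lemma sqintbleM_bounded f g (M : R) : sqintble f -> measurable_fun setT g ->
  (forall x, `|g x| <= M) -> sqintble (fun x => f x * g x).
Proof.
move=> sf mg gM; have mf := sf.1.
apply: (sqintble_le _ (sqintbleZ M sf)); first exact: measurable_funM.
move=> x; rewrite !normrM mulrC ler_wpM2r//.
by apply: le_trans (gM x) _; exact: ler_norm.
Qed.

Lemma sqintble_ae f g : measurable_fun setT g ->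
  (\forall x \ae mu, f x = g x) -> sqintble f -> sqintble g.
Proof.
move=> mg fg [mf f2]; split => //; apply: intble_ae f2.
  exact: measurable_funX.
by apply: filterS fg => x ->.
Qed.

Lemma bounded_sqintble f (M : R) : intble mu f -> (forall x, `|f x| <= M) ->
  sqintble f.
Proof.
move=> f1 fM; have mf := intble_mfun f1; split => //.
by apply: eq_intble (intbleM_bounded f1 mf fM) => x; rewrite expr2.
Qed.

Lemma sqnormD f g : sqintble f -> sqintble g ->
  sqnorm (fun x => f x + g x) = sqnorm f + 2 * \int[mu]_x (f x * g x) + sqnorm g.
Proof.
move=> sf sg; rewrite /sqnorm -rintZ; last exact: sqintbleM.
have fg := intbleZ 2 (sqintbleM sf sg).
rewrite -rintD; [|exact: sf.2|exact: fg].
rewrite -rintD; [|exact: intbleD sf.2 fg|exact: sg.2].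
by apply: eq_rint => x; ring.
Qed.

Lemma sqnormZ (k : R) f : sqintble f ->
  sqnorm (fun x => k * f x) = k ^+ 2 * sqnorm f.
Proof.
move=> sf; rewrite /sqnorm -rintZ; last exact: sf.2.
by apply: eq_rint => x; rewrite exprMn.
Qed.

Lemma cauchy_schwarz f g : sqintble f -> sqintble g ->
  `|\int[mu]_x (f x * g x)| <= Num.sqrt (sqnorm f) * Num.sqrt (sqnorm g).
Proof.
move=> sf sg; rewrite -sqrtrM ?sqnorm_ge0// -sqrtr_sqr ler_wsqrtr//.
set A := sqnorm f; set B := \int[mu]_x _; set C := sqnorm g.
have A0 : 0 <= A by exact: sqnorm_ge0.
have C0 : 0 <= C by exact: sqnorm_ge0.
(* Discriminant argument: the squared norm of [t * f + g] is a nonnegative polynomial in [t]. *)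
have H (t : R) : 0 <= t ^+ 2 * A + 2 * (t * B) + C.
  have := sqnorm_ge0 (fun x => t * f x + g x).
  rewrite sqnormD//; last exact: sqintbleZ.
  rewrite sqnormZ// -/A -/C (_ : \int[mu]_x _ = t * B)//.
  rewrite -rintZ; last exact: sqintbleM.
  by apply: eq_rint => x; rewrite mulrA.
have [A0'|An0] := eqVneq A 0.
  suff : B = 0 by move=> ->; rewrite expr0n /= mulr_ge0.
  apply/eqP/negPn/negP => Bn0.
  (* With [A = 0] the polynomial is affine, and at this point its value is -1. *)
  have := H (- (C + 1) / (2 * B)).
  have -> : - (C + 1) / (2 * B) * B = - (C + 1) / 2 by field.
  by rewrite A0' mulr0; lra.
(* The minimiser of the quadratic. *)
have := H (- B / A).
have -> : (- B / A) ^+ 2 * A + 2 * (- B / A * B) + C = (A * C - B ^+ 2) / A.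
  by field.
by rewrite pmulr_lge0 ?invr_gt0 ?lt_def ?An0// subr_ge0.
Qed.

Lemma cvg2_rintM (F G : nat -> T -> R) f g :
  (forall n, sqintble (F n)) -> sqintble f ->
  (forall n, sqintble (G n)) -> sqintble g -> cvg2 F f -> cvg2 G g ->
  \int[mu]_x (F n x * G n x) @[n --> \oo] --> \int[mu]_x (f x * g x).
Proof.
move=> sF sf sG sg Ff Gg.
apply/subr_cvg0.
set a := fun n => Num.sqrt (sqnorm (fun x => F n x - f x)).
set b := fun n => Num.sqrt (sqnorm (fun x => G n x - g x)).
have ca : a n @[n --> \oo] --> (0 : R).
  by rewrite -[X in _ --> X](@sqrtr0 R); apply: (continuous_cvg _ _ Ff); exact: sqrt_continuous.
have cb : b n @[n --> \oo] --> (0 : R).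
  by rewrite -[X in _ --> X](@sqrtr0 R); apply: (continuous_cvg _ _ Gg); exact: sqrt_continuous.
apply/norm_cvg0P; apply: (@squeeze_cvgr _ _ _ _ (fun=> 0) (fun n =>
  a n * b n + a n * Num.sqrt (sqnorm g) + Num.sqrt (sqnorm f) * b n)).
- apply: nearW => n; rewrite normr_ge0/=.
  have sFf := sqintbleB (sF n) sf; have sGg := sqintbleB (sG n) sg.
  (* Bilinear expansion around [f] and [g]; Cauchy-Schwarz bounds each of the three terms. *)
  have -> : \int[mu]_x (F n x * G n x) - \int[mu]_x (f x * g x) =
    \int[mu]_x ((F n x - f x) * (G n x - g x)) +
    \int[mu]_x ((F n x - f x) * g x) + \int[mu]_x (f x * (G n x - g x)).
    rewrite -rintD; [|exact: sqintbleM..].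
    rewrite -rintD; [|by apply: intbleD; exact: sqintbleM|exact: sqintbleM].
    rewrite -rintB; [|exact: sqintbleM..].
    by apply: eq_rint => x; ring.
  apply: le_trans (ler_normD _ _) _; apply: lerD; last exact: cauchy_schwarz.
  by apply: le_trans (ler_normD _ _) _; apply: lerD; exact: cauchy_schwarz.
- exact: cvg_cst.
- rewrite -[X in _ --> X](_ : 0 * 0 + 0 * Num.sqrt (sqnorm g)
    + Num.sqrt (sqnorm f) * 0 = 0); last by rewrite !mul0r mulr0 !addr0.
  apply: cvgD; last exact: cvgMr.
  by apply: cvgD; [exact: cvgM|exact: cvgMl].
Qed.

Lemma cvg2_cst f : cvg2 (fun=> f) f.
Proof.
rewrite /cvg2 (_ : (fun=> _) = cst 0); first exact: cvg_cst.
apply/funext => n; rewrite /= /sqnorm -[RHS](rint0 mu).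
by apply: eq_rint => x; rewrite subrr expr0n.
Qed.

Lemma cvg2_rintMr (F : nat -> T -> R) f g :
  (forall n, sqintble (F n)) -> sqintble f -> sqintble g -> cvg2 F f ->
  \int[mu]_x (F n x * g x) @[n --> \oo] --> \int[mu]_x (f x * g x).
Proof. by move=> sF sf sg Ff; apply: cvg2_rintM => //; exact: cvg2_cst. Qed.

Lemma cvg2_sqnorm (F : nat -> T -> R) f :
  (forall n, sqintble (F n)) -> sqintble f -> cvg2 F f ->
  sqnorm (F n) @[n --> \oo] --> sqnorm f.
Proof. by move=> sF sf Ff; exact: (cvg2_rintM sF sf sF sf Ff Ff). Qed.

Lemma sqnormD_le f g : sqintble f -> sqintble g ->
  sqnorm (fun x => f x + g x) <= 2 * sqnorm f + 2 * sqnorm g.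
Proof.
move=> sf sg; rewrite /sqnorm -!rintZ; [|exact: sg.2|exact: sf.2].
rewrite -rintD; [|exact: intbleZ sf.2|exact: intbleZ sg.2].
apply: le_rint; [exact: (sqintbleD sf sg).2| |move=> x].
  by apply: intbleD; [exact: intbleZ sf.2|exact: intbleZ sg.2].
by have := sqr_ge0 (f x - g x); nra.
Qed.

Lemma sqnormB_sym f g : sqnorm (fun x => f x - g x) = sqnorm (fun x => g x - f x).
Proof. by apply: eq_rint => x; rewrite -sqrrN opprB. Qed.

Lemma cvg2_dist (F G : nat -> T -> R) f g :
  (forall n, sqintble (F n)) -> sqintble f ->
  (forall n, sqintble (G n)) -> sqintble g -> cvg2 F f -> cvg2 G g ->
  sqnorm (fun x => F n x - G n x) @[n --> \oo] --> sqnorm (fun x => f x - g x).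
Proof.
move=> sF sf sG sg Ff Gg; apply: cvg2_sqnorm.
- by move=> n; exact: sqintbleB.
- exact: sqintbleB.
- apply: (@squeeze_cvgr _ _ _ _ (fun=> 0) (fun n =>
    2 * sqnorm (fun x => F n x - f x) + 2 * sqnorm (fun x => g x - G n x))).
  + apply: nearW => n; rewrite sqnorm_ge0/=.
    rewrite [leLHS](_ : _ = sqnorm (fun x => (F n x - f x) + (g x - G n x))).
      by apply: sqnormD_le; exact: sqintbleB.
    by apply: eq_rint => x; ring.
  + exact: cvg_cst.
  + rewrite -[X in _ --> X](_ : 2 * 0 + 2 * 0 = 0); last by rewrite mulr0 addr0.
    apply: cvgD; apply: cvgMr; first exact: Ff.
    by under eq_fun do rewrite sqnormB_sym; exact: Gg.
Qed.

Lemma sqnorm_eq0_ae f g : sqintble f -> sqintble g ->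
  sqnorm (fun x => f x - g x) = 0 -> \forall x \ae mu, f x = g x.
Proof.
move=> sf sg fg0; have := ge0_rint_eq0_ae (sqintbleB sf sg).2 _ fg0.
move=> /(_ (fun x => sqr_ge0 _)); apply: filterS => x /eqP.
by rewrite sqrf_eq0 subr_eq0 => /eqP.
Qed.

Lemma cvg2_ae (F : nat -> T -> R) f g : (forall n, measurable_fun setT (F n)) ->
  measurable_fun setT f -> measurable_fun setT g ->
  (\forall x \ae mu, f x = g x) -> cvg2 F f -> cvg2 F g.
Proof.
move=> mF mf mg fg; rewrite /cvg2.
under eq_fun.
  move=> n; rewrite /sqnorm (@rint_ae _ _ _ mu _ (fun x => (F n x - g x) ^+ 2)); last 3 first.
  - by apply: measurable_funX; exact: measurable_funB.
  - by apply: measurable_funX; exact: measurable_funB.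
  - by apply: filterS fg => x ->.
  over.
by [].
Qed.

End SquareIntegrable.

(** * Completeness of L^2 *)

Section RieszFischer.
Context d (T : measurableType d) (R : realType).
Variable mu : {measure set T -> \bar R}.

Lemma sqintble_EFin (f : T -> R) : sqintble mu f ->
  (\int[mu]_x (f x ^+ 2)%:E = (sqnorm mu f)%:E)%E.
Proof. by move=> sf; rewrite rint_EFin//; exact: sf.2. Qed.

(** Where no dominating function is at hand, Fatou still passes an upper bound to the limit. This
    serves completeness and, later, the removal of the weight in Bessel's inequality. *)
Lemma fatou_le_ae (g : nat -> T -> R) (f : T -> R) (e : R) :
  (forall k, measurable_fun setT (g k)) -> measurable_fun setT f ->
  (forall k x, 0 <= g k x) ->
  (\forall x \ae mu, g k x @[k --> \oo] --> f x) ->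
  (\forall k \near \oo, (\int[mu]_x (g k x)%:E <= e%:E)%E) ->
  (\int[mu]_x (f x)%:E <= e%:E)%E.
Proof.
move=> mg mf g0 gf ge.
have mg' k : measurable_fun setT (EFin \o g k) by apply/measurable_EFinP.
have g0' k x : setT x -> (0 <= (EFin \o g k) x)%E by rewrite lee_fin.
apply: le_trans (le_trans (fatou mu measurableT mg' g0') _).
- rewrite le_eqVlt; apply/orP; left; apply/eqP; apply: ae_eq_integral => //.
  + exact/measurable_EFinP.
  + rewrite /limn_einf; apply: measurableT_comp => //.
    apply: measurable_fun_limn_esup => k.
    by apply: measurableT_comp => //.
  + apply: filterS gf => x gx _; apply/esym.
    apply: (cvg_limn_einf_sup _).1; apply/cvg_EFin; last exact: gx.
    exact: nearW.
- rewrite limn_einf_lim; apply: lime_le; first exact: is_cvg_einfs.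
  near=> k; apply: (@le_trans _ _ (\int[mu]_x (g k x)%:E)%E).
    by apply: ereal_inf_lbound; exists k => /=.
  by near: k.
Unshelve. all: by end_near. Qed.

(* If the squared L^2 distances decrease fast enough, the weighted sum
   [\sum_k 4^k (F (k+1) - F k)^2] is finite almost everywhere, which makes
   the telescoping series absolutely convergent. *)
Lemma fast_cauchy_cvg_ae (F : nat -> T -> R) : (forall n, sqintble mu (F n)) ->
  (forall k, sqnorm mu (fun x => F k.+1 x - F k x) <=
     (4 ^+ k * 2 ^+ k.+1)^-1) ->
  exists f : T -> R, measurable_fun setT f /\
    \forall x \ae mu, F n x @[n --> \oo] --> f x.
Proof.
move=> sF dF.
pose h k x := (4 ^+ k * (F k.+1 x - F k x) ^+ 2)%:E.
have h0 k x : (0 <= h k x)%E by rewrite lee_fin mulr_ge0 ?sqr_ge0 ?exprn_ge0.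
have mh k : measurable_fun setT (h k).
  apply/measurable_EFinP; apply: measurable_funM => //; apply: measurable_funX.
  by apply: measurable_funB; [exact: (sF _).1|exact: (sF _).1].
pose S x := (\sum_(k <oo) h k x)%E.
have mS : measurable_fun setT S.
  rewrite /S; apply: (@ge0_emeasurable_sum _ _ _ setT h xpredT).
    by move=> k x _ _; exact: h0.
  by move=> k _; exact: mh.
have S0 x : (0 <= S x)%E by apply: nneseries_ge0 => k _ _; exact: h0.
have Soo : (\int[mu]_x S x < +oo)%E.
  rewrite /S integral_nneseries//.
  (* The weight [4 ^+ k] cancels in the assumed bound and leaves a geometric series with sum 1. *)
  apply: (@le_lt_trans _ _ (\sum_(k <oo) (1 / (2 ^ (k + 1))%:R)%:E)%E).
    apply: lee_nneseries => [k _ _|k _]; first exact: integral_ge0.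
    rewrite rint_EFin; last exact: intbleZ (sqintbleB (sF _) (sF _)).2.
    rewrite lee_fin rintZ; last exact: (sqintbleB (sF _) (sF _)).2.
    rewrite div1r -ler_pdivlMl ?exprn_gt0//.
    by rewrite (le_trans (dF k))// invfM natrX addn1.
  by have /cvg_lim -> // := @cvg_geometric_eseries_half R 1 0; rewrite ltry.
have iS : mu.-integrable setT S.
  apply/integrableP; split => //; apply: le_lt_trans Soo.
  rewrite le_eqVlt; apply/orP; left; apply/eqP; apply: eq_integral => x _.
  by rewrite gee0_abs.
pose A := [set x | (S x < +oo)%E].
have mA : measurable A.
  by rewrite -[A]setTI; exact: emeasurable_fun_infty_o.
have cvA x : A x -> cvgn (F ^~ x).
  rewrite /A /= => Ax.
  have Sfin : S x \is a fin_num by rewrite ge0_fin_numE.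
  (* A single term of the series is at most [S x]; dividing by [4 ^+ k] and taking roots gives a
     geometric bound. *)
  have dk k : `|F k.+1 x - F k x| <= Num.sqrt (fine (S x)) * 2^-1 ^+ k.
    have : (h k x <= S x)%E.
      apply: le_trans (nneseries_lim_ge k.+1 (fun n _ _ => h0 n x)).
      by rewrite big_nat_recr//= leeDr// sume_ge0.
    rewrite -(fineK Sfin) lee_fin.
    have : 0 <= fine (S x) by exact: fine_ge0.
    move: (fine (S x)) => c c0 hk.
    rewrite -(@ler_pXn2r _ 2)// ?nnegrE ?mulr_ge0 ?sqrtr_ge0 ?exprn_ge0 ?invr_ge0//.
    rewrite exprMn sqr_sqrtr// -normrX ger0_norm ?sqr_ge0//.
    rewrite -exprM mulnC exprM exprVn exprVn.
    by rewrite ler_pdivlMr ?exprn_gt0// mulrC (_ : 2 ^+ 2 = 4)//; ring.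
  have : cvgn (series (fun k => F k.+1 x - F k x)).
    apply: normed_cvg.
    apply: (@series_le_cvg _ _ (geometric (Num.sqrt (fine (S x))) 2^-1)) => //.
    - by move=> k /=; exact: normr_ge0.
    - by move=> k; rewrite /= mulr_ge0 ?sqrtr_ge0 ?exprn_ge0 ?invr_ge0.
    - by apply: is_cvg_geometric_series; rewrite ger0_norm ?invr_ge0// invf_lt1 ?ltr1n.
  have -> : series (fun k => F k.+1 x - F k x) = (fun n => F n x - F 0 x).
    by apply/funext => n; rewrite /series/= telescope_sumr.
  move=> /cvg_ex[l Fl]; apply/cvg_ex; exists (l + F 0%N x).
  have -> : F ^~ x = (fun n => F n x - F 0%N x + F 0%N x).
    by apply/funext => n; rewrite subrK.
  by apply: cvgD => //; exact: cvg_cst.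
(* Cutting off outside [A] makes the sequence converge at every point, so that its limit is
   measurable. *)
pose G n x := F n x * \1_A x.
have cG x : cvgn (G ^~ x).
  rewrite /G indicE; have [xA|xA] := boolP (x \in A).
    by under eq_fun do rewrite mulr1; apply: cvA; rewrite inE in xA.
  by under eq_fun do rewrite mulr0; exact: is_cvg_cst.
exists (fun x => limn (G ^~ x)); split.
  apply: (@measurable_fun_cvg _ _ _ setT G); last by move=> x _; exact: cG.
  move=> n; apply: measurable_funM; first exact: (sF _).1.
  exact: measurable_indic.
have := integrable_ae measurableT iS; apply: filterS => x /(_ I) Sx.
have Ax : x \in A by rewrite inE /A/= ltey_eq Sx.
have := cG x; rewrite /G; under eq_fun do rewrite indicE Ax mulr1.
by [].
Qed.

Lemma cvg2_complete (F : nat -> T -> R) : (forall n, sqintble mu (F n)) ->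
  (forall e, 0 < e -> exists N, forall m n, (N <= m)%N -> (N <= n)%N ->
     sqnorm mu (fun x => F m x - F n x) <= e) ->
  exists f, sqintble mu f /\ cvg2 mu F f.
Proof.
move=> sF cF.
have e0 k : 0 < (4 ^+ k * 2 ^+ k.+1)^-1 :> R.
  by rewrite invr_gt0 mulr_gt0 ?exprn_gt0.
pose N k := sval (cid (cF _ (e0 k))).
have NP k := svalP (cid (cF _ (e0 k))).
(* Partial sums are nondecreasing and stay above the thresholds [N k]; the extra [k] in [t] below
   forces the indices to infinity. *)
pose s k := (\sum_(i < k.+1) N i)%N.
have Ns k : (N k <= s k)%N by rewrite /s big_ord_recr/= leq_addl.
have s1 k : (s k <= s k.+1)%N by rewrite /s [leqRHS]big_ord_recr/= leq_addr.
pose t k := (s k + k)%N.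
have [|k|f [mf Ff]] := @fast_cauchy_cvg_ae (fun k => F (t k)).
- by move=> n; exact: sF.
- apply: NP; last exact: leq_trans (Ns k) (leq_addr _ _).
  by rewrite /t -/(N k); apply: leq_trans (Ns k) (leq_trans (s1 k) (leq_addr _ _)).
(* The almost everywhere limit of the subsequence is the L^2 limit of the whole sequence: Fatou is
   applied to [F n - F (t k)] for fixed [n] as [k] grows. *)
have dist e : 0 < e -> exists N0, forall n, (N0 <= n)%N ->
    (\int[mu]_x ((F n x - f x) ^+ 2)%:E <= e%:E)%E.
  move=> egt0; have [N0 HN0] := cF e egt0; exists N0 => n N0n.
  apply: (@fatou_le_ae (fun k x => (F n x - F (t k) x) ^+ 2)).
  - by move=> k; exact: intble_mfun (sqintbleB (sF _) (sF _)).2.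
  - apply: measurable_funX.
    by apply: measurable_funB => //; exact: (sF n).1.
  - by move=> k x; exact: sqr_ge0.
  - apply: filterS Ff => x Fx.
    under eq_fun do rewrite expr2.
    by rewrite expr2; apply: cvgM; apply: cvgB => //; exact: cvg_cst.
  - exists N0 => // k /= N0k; rewrite sqintble_EFin; last exact: sqintbleB.
    rewrite lee_fin; apply: HN0 => //.
    exact: leq_trans N0k (leq_addl _ _).
have sFf n : (\int[mu]_x ((F n x - f x) ^+ 2)%:E < +oo)%E ->
    sqintble mu (fun x => F n x - f x).
  move=> Foo; have m : measurable_fun setT (fun x => F n x - f x).
    by apply: measurable_funB => //; exact: (sF n).1.
  split=> //; apply: ge0_intbleP => //; first exact: measurable_funX.
  by move=> x; exact: sqr_ge0.
have sf : sqintble mu f.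
  have [n0 Hn0] := dist 1 ltr01.
  have s0 := sFf n0 (le_lt_trans (Hn0 _ (leqnn _)) (ltry _)).
  have := sqintbleB (sF n0) s0; rewrite (_ : (fun x => _) = f)//.
  by apply/funext => x; rewrite opprB addrCA subrr addr0.
exists f; split => //; apply/cvgrPdist_le => e egt0.
have [n0 Hn0] := dist e egt0; exists n0 => // n /= n0n.
rewrite sub0r normrN ger0_norm ?sqnorm_ge0// -lee_fin -sqintble_EFin; last exact: sqintbleB.
exact: Hn0.
Qed.

End RieszFischer.

(** * Changes of variables *)

Section ScalesMeasure.
Context d (T : measurableType d) (R : realType).
Variable mu : {measure set T -> \bar R}.

(** Preimages are measured, so [c] is the inverse of the absolute Jacobian determinant: the
    pushforward of [mu] by [phi] is [c] times [mu]. *)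
Definition scales_measure (phi : T -> T) (c : R) := [/\ 0 < c,
  measurable_fun setT phi &
  forall A, measurable A -> mu (phi @^-1` A) = (c%:E * mu A)%E].

Lemma scales_measure_comp phi psi a b : scales_measure phi a ->
  scales_measure psi b -> scales_measure (psi \o phi) (a * b).
Proof.
move=> [a0 mphi phiE] [b0 mpsi psiE]; split; first exact: mulr_gt0.
  exact: measurableT_comp.
move=> A mA; rewrite comp_preimage phiE; last by rewrite -[X in measurable X]setTI; exact: mpsi.
by rewrite psiE// muleA EFinM.
Qed.

Section ChangeOfVariables.
Variables (phi : T -> T) (c : R).
Hypothesis phic : scales_measure phi c.

Lemma ge0_integral_scales (f : T -> \bar R) : measurable_fun setT f ->
  (forall x, 0 <= f x)%E -> (\int[mu]_x f (phi x) = c%:E * \int[mu]_x f x)%E.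
Proof.
have [c0 mphi phiE] := phic; move=> mf f0.
have := @ge0_integral_mscale _ _ _ mu setT measurableT
  (NngNum (ltW c0)) f mf (fun x _ => f0 x); move=> <-.
have := @ge0_integral_pushforward _ _ _ _ _ phi mphi mu setT f measurableT mf
  (fun x _ => f0 x).
rewrite preimage_setT => <-.
by apply: eq_measure_integral => // A mA _; rewrite /= /mscale -phiE.
Qed.

Lemma intble_scales (f : T -> R) : intble mu f -> intble mu (f \o phi).
Proof.
have [c0 mphi phiE] := phic; move=> f1; have /integrableP[mf foo] := f1.
apply/integrableP; split.
  exact: (measurableT_comp mf mphi).
rewrite (ge0_integral_scales (f := fun x => `|(f x)%:E|%E))//.
  by apply: lte_mul_pinfty => //; rewrite lee_fin ltW.
exact: measurableT_comp.
Qed.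

Lemma rint_scales (f : T -> R) : intble mu f ->
  \int[mu]_x f (phi x) = c * \int[mu]_x f x.
Proof.
have [c0 mphi phiE] := phic; move=> f1.
have ge0 (g : T -> R) : intble mu g -> (forall x, 0 <= g x) ->
    \int[mu]_x g (phi x) = c * \int[mu]_x g x.
  move=> g1 g0; rewrite /Rintegral -[c in RHS]/(fine c%:E) -fineM//.
    congr fine; apply: (ge0_integral_scales (f := fun x => (g x)%:E)).
      by apply/measurable_EFinP; exact: (intble_mfun g1).
    by move=> x; rewrite lee_fin.
  exact: integrable_fin_num.
have f1n := intble_norm f1; have f1d := intbleD f1n f1.
(* A difference of two nonnegative integrable functions, to which [ge0] applies. *)
have fE : f = (fun x => (`|f x| + f x) - `|f x|).
  by apply/funext => x; rewrite addrAC subrr add0r.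
rewrite [in LHS]fE [in RHS]fE rintB; [|exact: intble_scales f1d|exact: intble_scales f1n].
rewrite rintB// mulrBr; congr (_ - _); apply: ge0 => // x.
by have := ler_norm (- f x); rewrite normrN; lra.
Qed.

Lemma sqintble_scales (f : T -> R) : sqintble mu f -> sqintble mu (f \o phi).
Proof.
have [c0 mphi phiE] := phic; move=> [mf f2]; split.
  exact: measurableT_comp.
exact: (intble_scales f2).
Qed.

Lemma sqnorm_scales (f : T -> R) : sqintble mu f ->
  sqnorm mu (f \o phi) = c * sqnorm mu f.
Proof. by move=> [_ f2]; exact: (rint_scales f2). Qed.

Lemma ae_scales (P : set T) : (\forall x \ae mu, P x) ->
  \forall x \ae mu, P (phi x).
Proof.
have [c0 mphi phiE] := phic; move=> [N [mN N0 PN]].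
exists (phi @^-1` N); split.
- by rewrite -[X in measurable X]setTI; exact: mphi.
- by rewrite phiE// [X in (_ * X)%E]N0 mule0.
- by move=> x /= Px; apply: PN.
Qed.

End ChangeOfVariables.
End ScalesMeasure.

(** * Changes of variables on product spaces *)

Section ScalesProduct.
Local Open Scope ereal_scope.
Context d1 d2 (T1 : measurableType d1) (T2 : measurableType d2) (R : realType).
Variable m1 : {sigma_finite_measure set T1 -> \bar R}.
Variable m2 : {sigma_finite_measure set T2 -> \bar R}.

(** Divided by [c], the pushforward agrees with the product measure on rectangles, and a product
    measure is determined by its rectangles. *)
Lemma product_measure_scaled (phi : T1 * T2 -> T1 * T2) (c : R) :
  (0 < c)%R -> measurable_fun setT phi ->
  (forall A B, measurable A -> measurable B ->
     (m1 \x m2) (phi @^-1` (A `*` B)) = c%:E * (m1 A * m2 B)) ->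
  scales_measure (m1 \x m2) phi c.
Proof.
move=> c0 mphi H; split => // X mX.
have ci0 : (0 <= c^-1)%R by rewrite invr_ge0 ltW.
unshelve epose proof (@product_measure_unique _ _ _ _ _ m1 m2
  (mscale (NngNum ci0) (pushforward (m1 \x m2) phi : {measure set _ -> \bar R})) _ X mX) as E.
- exact: mphi.
- move=> A B mA mB.
  transitivity (c^-1%:E * (m1 \x m2) (phi @^-1` (A `*` B))); first by [].
  rewrite H// muleA -EFinM.
  by rewrite mulVf ?gt_eqF// mul1e.
transitivity (c%:E * (c^-1%:E * (m1 \x m2) (phi @^-1` X))).
  by rewrite muleA -EFinM divff ?gt_eqF// mul1e.
by congr (_ * _); exact: esym E.
Qed.

Lemma scales_measure_prod phi1 phi2 (c1 c2 : R) :
  scales_measure m1 phi1 c1 -> scales_measure m2 phi2 c2 ->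
  scales_measure (m1 \x m2) (fun x => (phi1 x.1, phi2 x.2)) (c1 * c2)%R.
Proof.
move=> [c10 mphi1 E1] [c20 mphi2 E2]; apply: product_measure_scaled.
- exact: mulr_gt0.
- by apply: measurable_fun_pair; exact: measurableT_comp.
- move=> A B mA mB.
  rewrite (_ : _ @^-1` _ = (phi1 @^-1` A) `*` (phi2 @^-1` B))//.
  rewrite product_measure1E//; last 2 first.
  + by rewrite -[X in measurable X]setTI; exact: mphi1.
  + by rewrite -[X in measurable X]setTI; exact: mphi2.
  by rewrite E1// E2// EFinM; rewrite muleACA.
Qed.

(** The product measure integrates the measures of the sections, and a shear moves each section by a
    measure-preserving map. *)
Lemma scales_measure_shear2 (s : T1 -> T2 -> T2) :
  measurable_fun setT (fun x : T1 * T2 => s x.1 x.2) ->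
  (forall t, scales_measure m2 (s t) 1) ->
  scales_measure (m1 \x m2) (fun x => (x.1, s x.1 x.2)) 1.
Proof.
move=> ms sE; split => //.
  by apply: measurable_fun_pair => //.
move=> A mA; rewrite mul1e /product_measure1; apply: eq_integral => x _ /=.
have [_ _ /(_ (xsection A x))] := sE x; rewrite mul1e => <-; last exact: measurable_xsection.
congr (m2 _); rewrite /xsection; apply/seteqP; split => y /=; by rewrite !inE.
Qed.

End ScalesProduct.

Lemma scales_measure_swap d (T : measurableType d) (R : realType)
    (m : {sigma_finite_measure set T -> \bar R}) :
  scales_measure (m \x m)%E (fun x : T * T => (x.2, x.1)) 1.
Proof.
apply: product_measure_scaled => //.
  by apply: measurable_fun_pair.
move=> A B mA mB; rewrite mul1e (_ : _ @^-1` _ = B `*` A).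
  by rewrite product_measure1E// muleC.
by apply/seteqP; split => x /= [? ?].
Qed.

(** Lebesgue measure is determined by half-open intervals, so the pushforward multiplied by the
    absolute value of [a] is compared with it there. *)
Lemma scales_measure_affine (R : realType) (a b : R) : a != 0 ->
  scales_measure (@lebesgue_measure R) (fun t => a * t + b) `|a|^-1.
Proof.
move=> a0.
have m : measurable_fun setT (fun t : R => a * t + b).
  by apply: measurable_funD => //; exact: measurable_funM.
split => //; first by rewrite invr_gt0 normr_gt0.
have aa0 : 0 <= `|a| by [].
move=> A mA.
unshelve epose proof (@lebesgue_measure_unique R
  (mscale (NngNum aa0) (pushforward (@lebesgue_measure R)
    (fun t : measurableTypeR R => (a * t + b : measurableTypeR R)) : {measure set _ -> \bar R})) _ A mA) as E.
- exact: m.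
- move=> X [[x y] _ <-] /=.
  transitivity (`|a|%:E * @lebesgue_measure R ((fun t : R => a * t + b)%R @^-1` `]x, y]))%E;
    last by [].
  rewrite lebesgue_measure_itv/= lte_fin.
  have [a_gt0|a_lt0|] := ltgtP 0 a; last by move=> a00; rewrite -a00 eqxx in a0.
  + rewrite (_ : _ @^-1` _ = `](x - b) / a, (y - b) / a]%classic).
      rewrite lebesgue_measure_itv/= lte_fin ltr_pM2r ?invr_gt0// ltrD2r.
      case: ifPn => _; last by rewrite mule0.
      by rewrite -!EFinB -EFinM gtr0_norm//; congr EFin; field.
    apply/seteqP; split => t /=; rewrite !in_itv/= ltr_pdivrMr// ler_pdivlMr//;
      by rewrite ltrBlDr lerBrDr (mulrC t).
  (* A negative slope reverses the interval and moves the closed end to the left. *)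
  + rewrite (_ : _ @^-1` _ = `[(y - b) / a, (x - b) / a[%classic).
      rewrite lebesgue_measure_itv/= lte_fin ltr_nM2r ?invr_lt0// ltrD2r.
      case: ifPn => _; last by rewrite mule0.
      by rewrite -!EFinB -EFinM ltr0_norm//; congr EFin; field.
    apply/seteqP; split => t /=; rewrite !in_itv/= ltr_ndivlMr// ler_ndivrMr//;
      by rewrite ltrBlDr lerBrDr (mulrC t) andbC.
transitivity (`|a|^-1%:E * (`|a|%:E * @lebesgue_measure R ((fun t : R => a * t + b)%R @^-1` A)))%E.
  by rewrite muleA -EFinM mulVf ?normr_eq0// mul1e.
by congr (_ * _)%E; exact: esym E.
Qed.

(** * Fubini's theorem for kernels, and Lebesgue measure on the plane *)

Section FubiniKernel.
Context d1 d2 (T1 : measurableType d1) (T2 : measurableType d2) (R : realType).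
Variable m1 : {sigma_finite_measure set T1 -> \bar R}.
Variable m2 : {sigma_finite_measure set T2 -> \bar R}.

Lemma measurable_rint_section (f : T1 * T2 -> R) : measurable_fun setT f ->
  measurable_fun setT (fun x => \int[m2]_y f (x, y)).
Proof.
move=> mf; have mf' : measurable_fun setT (EFin \o f) by apply/measurable_EFinP.
apply: measurableT_comp; first exact: (fine_measurable measurableT).
rewrite (_ : (fun x => _) = (fun x => (\int[m2]_y (EFin \o f)^\+ (x, y))
   - (\int[m2]_y (EFin \o f)^\- (x, y)))%E).
  apply: emeasurable_funB.
    apply: (measurable_fun_fubini_tonelli_F (m2 := m2) (EFin \o f)^\+%E) => //.
    exact: measurable_funepos.
  apply: (measurable_fun_fubini_tonelli_F (m2 := m2) (EFin \o f)^\-%E) => //.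
  exact: measurable_funeneg.
by apply/funext => x; rewrite [LHS]integralE; congr (_ - _)%E; apply: eq_integral => y _; rewrite unlock.
Qed.

Lemma intble_prod (u : T1 -> R) (v : T2 -> R) : intble m1 u -> intble m2 v ->
  intble (m1 \x m2)%E (fun z => u z.1 * v z.2).
Proof.
move=> u1 v1; have mu := intble_mfun u1; have mv := intble_mfun v1.
have m : measurable_fun setT (fun z : T1 * T2 => u z.1 * v z.2).
  by apply: measurable_funM; exact: measurableT_comp.
apply/integrable12ltyP; first exact/measurable_EFinP.
under eq_integral => x _.
  under eq_integral => y _ do rewrite /= normrM.
  rewrite (rint_EFin (f := fun y => `|u x| * `|v y|)); last first.
    exact: (intbleZ _ (intble_norm v1)).
  rewrite rintZ; last exact: (intble_norm v1).
  over.
rewrite (rint_EFin (f := fun x => `|u x| * _)) ?ltry//.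
by apply: eq_intble (intbleZ (\int[m2]_x `|v x|) (intble_norm u1)) => x; rewrite mulrC.
Qed.

Lemma rint_prod (u : T1 -> R) (v : T2 -> R) : intble m1 u -> intble m2 v ->
  \int[(m1 \x m2)%E]_z (u z.1 * v z.2) = \int[m1]_x u x * \int[m2]_y v y.
Proof.
move=> u1 v1; have uv1 := intble_prod u1 v1.
rewrite /Rintegral -(integral12_prod_meas1 uv1) /fubini_F/=.
under eq_integral => x _.
  rewrite (rint_EFin (f := fun y => u x * v y)); last exact: intbleZ.
  rewrite rintZ//; over.
rewrite (rint_EFin (f := fun x => u x * _)) /= ?rintZr//.
by apply: eq_intble (intbleZ (\int[m2]_x v x) u1) => x; rewrite mulrC.
Qed.

Variables (K : T1 -> T2 -> R) (M : R).
Hypothesis mK : measurable_fun setT (fun z => K z.1 z.2).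
Hypothesis KM : forall x y, `|K x y| <= M.

Lemma measurable_kernel1 x : measurable_fun setT (K x).
Proof.
apply: (measurableT_comp mK (g := fun y => (x, y))).
by apply: measurable_fun_pair.
Qed.

Lemma measurable_kernel2 y : measurable_fun setT (K ^~ y).
Proof.
apply: (measurableT_comp mK (g := fun x => (x, y))).
by apply: measurable_fun_pair.
Qed.

Lemma intble_kernel1 v x : intble m2 v -> intble m2 (fun y => v y * K x y).
Proof.
by move=> v1; apply: (intbleM_bounded v1 (measurable_kernel1 x)); exact: KM.
Qed.

Lemma intble_kernel2 u y : intble m1 u -> intble m1 (fun x => u x * K x y).
Proof.
move=> u1; apply: (intbleM_bounded u1 (measurable_kernel2 y)).
by move=> x; exact: KM.
Qed.

Lemma measurable_rint_kernel v : intble m2 v ->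
  measurable_fun setT (fun x => \int[m2]_y (v y * K x y)).
Proof.
move=> v1; apply: (measurable_rint_section (f := fun z => v z.2 * K z.1 z.2)).
apply: measurable_funM => //; apply: measurableT_comp => //.
exact: intble_mfun v1.
Qed.

Lemma norm_rint_kernel v x : intble m2 v ->
  `|\int[m2]_y (v y * K x y)| <= M * \int[m2]_y `|v y|.
Proof.
move=> v1; have v1n := intble_norm v1; rewrite -rintZ//; apply: le_norm_rint.
- exact: intble_kernel1.
- exact: intbleZ.
- by move=> y; rewrite normrM mulrC ler_wpM2r.
Qed.

Lemma intble_kernel u v : intble m1 u -> intble m2 v ->
  intble (m1 \x m2)%E (fun z => u z.1 * v z.2 * K z.1 z.2).
Proof.
by move=> u1 v1; apply: (intbleM_bounded (intble_prod u1 v1) mK) => z; exact: KM.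
Qed.

Lemma rint_kernel u v : intble m1 u -> intble m2 v ->
  \int[m1]_x (u x * \int[m2]_y (v y * K x y)) =
  \int[(m1 \x m2)%E]_z (u z.1 * v z.2 * K z.1 z.2).
Proof.
move=> u1 v1.
rewrite [RHS]/Rintegral -(integral12_prod_meas1 (intble_kernel u1 v1)) /fubini_F/=.
congr fine; apply: eq_integral => x _.
rewrite -rintZ; last exact: intble_kernel1.
rewrite -rint_EFin; last by apply: intbleZ; exact: intble_kernel1.
by apply: eq_integral => y _; rewrite mulrA.
Qed.

(** Boundedness of [K] is enough to make [u x * v y * K x y] integrable on the product, so Fubini
    covers oscillating kernels such as [hkern]. *)
Lemma rint_kernel_swap u v : intble m1 u -> intble m2 v ->
  \int[m1]_x (u x * \int[m2]_y (v y * K x y)) =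
  \int[m2]_y (v y * \int[m1]_x (u x * K x y)).
Proof.
move=> u1 v1; rewrite rint_kernel//.
rewrite [LHS]/Rintegral -(integral21_prod_meas1 (intble_kernel u1 v1)) /fubini_G/=.
congr fine; apply: eq_integral => y _.
rewrite -rintZ; last exact: intble_kernel2.
rewrite -rint_EFin; last by apply: intbleZ; exact: intble_kernel2.
by apply: eq_integral => x _; rewrite mulrCA mulrA.
Qed.

End FubiniKernel.

(** * Schur's test for kernels with unit marginals *)

Section SchurTest.
Context d (T : measurableType d) (R : realType).
Variable m : {sigma_finite_measure set T -> \bar R}.
Variables (K : T -> T -> R) (M : R).
Hypothesis mK : measurable_fun setT (fun z => K z.1 z.2).
Hypothesis K0 : forall x y, 0 <= K x y.
Hypothesis KM : forall x y, `|K x y| <= M.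
Hypothesis K1 : forall x, (\int[m]_y (K x y)%:E = 1)%E.
Hypothesis K2 : forall y, (\int[m]_x (K x y)%:E = 1)%E.

(** Pointwise [u x * u y] is at most half of [u x ^+ 2 + u y ^+ 2]. Since [K] has integral one in
    each variable, both squares integrate against it to [sqnorm m u]. *)
Lemma schur_test u : intble m u -> sqintble m u ->
  \int[m]_x (u x * \int[m]_y (u y * K x y)) <= sqnorm m u.
Proof.
move=> u1 su; have mu : measurable_fun setT (fun x => u x ^+ 2).
  by apply: measurable_funX; exact: su.1.
pose F (z : T * T) := u z.1 ^+ 2 * K z.1 z.2.
pose G (z : T * T) := u z.2 ^+ 2 * K z.1 z.2.
have F0 z : 0 <= F z by rewrite mulr_ge0 ?sqr_ge0.
have G0 z : 0 <= G z by rewrite mulr_ge0 ?sqr_ge0.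
have mF : measurable_fun setT F.
  by apply: measurable_funM => //; exact: (measurableT_comp mu measurable_fst).
have mG : measurable_fun setT G.
  by apply: measurable_funM => //; exact: (measurableT_comp mu measurable_snd).
have EF : (\int[(m \x m)%E]_z (F z)%:E = (sqnorm m u)%:E)%E.
  rewrite (fubini_tonelli1 (m1 := m) (m2 := m) (EFin \o F))//; last exact/measurable_EFinP.
  rewrite -sqintble_EFin//; apply: eq_integral => x _; rewrite /fubini_F/=.
  transitivity ((u x ^+ 2)%:E * \int[m]_y (K x y)%:E)%E; last by rewrite K1 mule1.
  rewrite -ge0_integralZl ?lee_fin ?sqr_ge0//; last by move=> y _; rewrite lee_fin.
  by apply/measurable_EFinP; exact: (measurable_kernel1 mK).
have EG : (\int[(m \x m)%E]_z (G z)%:E = (sqnorm m u)%:E)%E.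
  rewrite (fubini_tonelli2 (m1 := m) (m2 := m) (EFin \o G))//; last exact/measurable_EFinP.
  rewrite -sqintble_EFin//; apply: eq_integral => y _; rewrite /fubini_G/=.
  transitivity ((u y ^+ 2)%:E * \int[m]_x (K x y)%:E)%E; last by rewrite K2 mule1.
  rewrite -ge0_integralZl ?lee_fin ?sqr_ge0//; last by move=> x _; rewrite lee_fin.
  by apply/measurable_EFinP; exact: (measurable_kernel2 mK).
have F1 : intble (m \x m)%E F by apply: ge0_intbleP => //; rewrite EF ltry.
have G1 : intble (m \x m)%E G by apply: ge0_intbleP => //; rewrite EG ltry.
rewrite (rint_kernel mK KM)//.
have -> : sqnorm m u = \int[(m \x m)%E]_z (2^-1 * (F z + G z)).
  rewrite rintZ; last exact: intbleD.
  by rewrite rintD// /Rintegral EF EG/=; field.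
apply: le_rint.
- exact: intble_kernel.
- by apply: intbleZ; exact: intbleD.
- move=> z; rewrite /F /G -mulrDl mulrA ler_wpM2r//.
  by have := sqr_ge0 (u z.1 - u z.2); nra.
Qed.

End SchurTest.

(** * Lebesgue measure on the plane and its symmetries *)

Section PlaneMeasure.
Variable R : realType.

Lemma sigma_finite_mu2 : sigma_finite setT (mu2 R).
Proof.
pose F n : set (R * R) := `[- n%:R, n%:R] `*` `[- n%:R, n%:R].
exists F => [|n].
  apply/seteqP; split => // x _.
  exists (Num.truncn (`|x.1| + `|x.2|)).+1 => //.
  have := truncnS_gt (`|x.1| + `|x.2|); set n := _.+1 => xn.
  split; rewrite /= in_itv/= -ler_norml; apply: le_trans (ltW xn).
    by rewrite lerDl.
  by rewrite lerDr.
split; first exact: measurableX.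
pose I : set R := `[- n%:R, n%:R]%classic.
rewrite [X in (X < _)%E](_ : _ = (@lebesgue_measure R I * @lebesgue_measure R I)%E); last first.
  exact: product_measure1E.
rewrite lebesgue_measure_itv/=; case: ifPn => _; last by rewrite mule0 ltry.
by rewrite -EFinB -EFinM ltry.
Qed.

(* [mu2] is declared as a bare measure; [smu2] is the same measure together with
   the sigma-finiteness that Fubini's theorem asks for. *)
Definition leb2 : set (measurableTypeR R * measurableTypeR R)%type -> \bar R :=
  (@lebesgue_measure R \x @lebesgue_measure R)%E.
HB.instance Definition _ := Measure.on leb2.
HB.instance Definition _ :=
  Measure_isSigmaFinite.Build _ _ _ leb2 sigma_finite_mu2.
Definition smu2 : {sigma_finite_measure set
    (measurableTypeR R * measurableTypeR R)%type -> \bar R} := leb2.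

Lemma L2P (h : R * R -> R) : L2 h <-> sqintble (mu2 R) h.
Proof.
rewrite /L2; split => [h2|[mh h2]].
  split; last exact: Lfun2_integrable_sqr.
  by move: h2; rewrite inE => /andP[+ _]; rewrite inE.
rewrite inE; apply/andP; split; rewrite inE//= /finite_norm.
rewrite (@lty_poweRy _ _ 2)//.
rewrite poweR_Lnorm//.
have /integrableP[_] := h2; apply: le_lt_trans.
rewrite le_eqVlt; apply/orP; left; apply/eqP; apply: eq_integral => x _ /=.
by rewrite powR_mulrn// -normrX ger0_norm ?sqr_ge0.
Qed.

Lemma L1P (h : R * R -> R) : h \in Lfun (mu2 R) 1 <-> intble (mu2 R) h.
Proof. exact: Lfun1_integrable. Qed.

Definition dilate (a : R) (c x : R * R) : R * R :=
  ((x.1 - c.1) / a, (x.2 - c.2) / a).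

Definition neg2 (x : R * R) : R * R := (- x.1, - x.2).

Lemma scales_dilate a c : 0 < a -> scales_measure (mu2 R) (dilate a c) (a ^+ 2).
Proof.
move=> a0; have an0 : a^-1 != 0 by rewrite invr_eq0 gt_eqF.
have := scales_measure_prod (scales_measure_affine (- c.1 / a) an0)
  (scales_measure_affine (- c.2 / a) an0).
rewrite gtr0_norm ?invr_gt0// invrK -expr2.
rewrite (_ : (fun x : R * R => _) = dilate a c)//.
by apply/funext => x; rewrite /dilate !(mulrC a^-1) -!mulrDl.
Qed.

Lemma scales_neg2 : scales_measure (mu2 R) neg2 1.
Proof.
have n10 : -1 != 0 :> R by rewrite oppr_eq0 oner_eq0.
have := scales_measure_prod (scales_measure_affine 0 n10) (scales_measure_affine 0 n10).
rewrite normrN1 invr1 mulr1 (_ : (fun x : R * R => _) = neg2)//.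
by apply/funext => x; rewrite /neg2 !mulN1r !addr0.
Qed.

Lemma scales_shear2 t :
  scales_measure (mu2 R) (fun x => (x.1, x.2 + t * x.1)) 1.
Proof.
apply: (@scales_measure_shear2 _ _ _ _ R (@lebesgue_measure R)
  (@lebesgue_measure R) (fun x y => y + t * x)).
  by apply: measurable_funD => //; apply: measurable_funM.
move=> x; have := scales_measure_affine (t * x) (oner_neq0 R).
by rewrite normr1 invr1; under eq_fun do rewrite mul1r.
Qed.

Lemma scales_shear1 t :
  scales_measure (mu2 R) (fun x => (x.1 + t * x.2, x.2)) 1.
Proof.
have sw : scales_measure (mu2 R) (fun x => (x.2, x.1)) 1 := scales_measure_swap _.
have := scales_measure_comp sw (scales_measure_comp (scales_shear2 t) sw).
by rewrite !mulr1.
Qed.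

(* A rotation by an angle in (-pi, pi) is a product of three shears. *)
Lemma scales_rotv_half t : `|t| < pi -> scales_measure (mu2 R) (rotv t) 1.
Proof.
move=> tpi; set c := cos (t / 2); set s := sin (t / 2).
have c0 : c != 0.
  by rewrite gt_eqF// cos_gt0_pihalf// -ltr_norml normrM [`|2^-1|]ger0_norm ?invr_ge0// ltr_pM2r.
have cs : c ^+ 2 + s ^+ 2 = 1 by exact: cos2Dsin2.
have tE : t = t / 2 + t / 2 by rewrite -splitr.
have sE : sin t = 2 * s * c.
  by rewrite [in LHS]tE sinD -/s -/c; ring.
have cE : cos t = c ^+ 2 - s ^+ 2 by rewrite [in LHS]tE cosD -/s -/c; ring.
(* The outer shears have factor [- tan (t / 2)] and the middle one [sin t]; the tangent is finite
   because [t / 2] stays inside the open interval from [- pi / 2] to [pi / 2]. *)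
have := scales_measure_comp (scales_shear1 (- s / c))
  (scales_measure_comp (scales_shear2 (sin t)) (scales_shear1 (- s / c))).
rewrite !mulr1 (_ : _ \o _ = rotv t)//.
apply/funext => -[x y]; rewrite /rotv /= sE cE.
have s2 : s ^+ 2 = 1 - c ^+ 2 by rewrite -cs addrC addKr.
congr pair.
  transitivity ((1 - 2 * s ^+ 2) * x - (2 * s - 2 * s ^+ 3) / c * y); first by field.
  rewrite s2; congr (_ * _ - _ * _); first by ring.
  rewrite exprSr s2; field.
  by [].
transitivity (2 * s * c * x + (1 - 2 * s ^+ 2) * y); first by field.
by rewrite s2; congr (_ + _ * _); ring.
Qed.

Lemma rotvD s t x : rotv s (rotv t x) = rotv (s + t) x :> R * R.
Proof. by rewrite /rotv cosD sinD /=; congr pair; ring. Qed.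

Lemma rotvK t : cancel (rotv t) (rotv (- t) : R * R -> R * R).
Proof. by move=> [x y]; rewrite rotvD addNr /rotv cos0 sin0 /=; congr pair; ring. Qed.

Lemma rotvNK t : cancel (rotv (- t)) (rotv t : R * R -> R * R).
Proof. by move=> x; have := rotvK (- t) x; rewrite opprK. Qed.

(** Two rotations by half the angle; this reaches every [theta] in [[0, 2 * pi[] and its
    opposite. *)
Lemma scales_rotv t : `|t| < 2 * pi -> scales_measure (mu2 R) (rotv t) 1.
Proof.
move=> tpi; have h : `|t / 2| < pi.
  by rewrite normrM [`|2^-1|]ger0_norm ?invr_ge0// ltr_pdivrMr// mulrC.
have := scales_measure_comp (scales_rotv_half h) (scales_rotv_half h).
rewrite mulr1 (_ : _ \o _ = rotv t)//.
by apply/funext => x /=; rewrite rotvD -splitr.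
Qed.

End PlaneMeasure.

(** * The weight and the Hartley kernel *)

Section LaplaceKernel.
Variable R : realType.
Local Notation mu := (@lebesgue_measure R).
Implicit Types e t x : R.

Lemma is_derive_mulfun (f g : R -> R) x df dg : is_derive x 1 f df ->
  is_derive x 1 g dg -> is_derive x 1 (fun y => f y * g y) (f x * dg + g x * df).
Proof. by move=> f' g'; apply: is_derive_eq (is_deriveM f' g') _. Qed.

Lemma is_derive_subfun (f g : R -> R) x df dg : is_derive x 1 f df ->
  is_derive x 1 g dg -> is_derive x 1 (fun y => f y - g y) (df - dg).
Proof. by move=> f' g'; apply: is_derive_eq (is_deriveB f' g') _. Qed.

Lemma is_derive_scale a x : is_derive x 1 (fun y => a * y) a.
Proof.
apply: is_derive_eq (is_derive_mulfun (is_derive_cst a x 1) (is_derive_id x 1)) _.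
by rewrite mulr1 mulr0 addr0.
Qed.

Lemma is_derive_comp1 (f g : R -> R) x df dg : is_derive (g x) 1 f df ->
  is_derive x 1 g dg -> is_derive x 1 (fun y => f (g y)) (df * dg).
Proof. by move=> f' g'; apply: is_derive_eq (is_derive1_comp f' g') _; rewrite mulrC. Qed.

Lemma expR_mulN_cvg0 e : 0 < e -> expR (- (e * x)) @[x --> +oo%R] --> (0 : R).
Proof.
move=> e0; have h : e * x @[x --> +oo%R] --> +oo%R by exact: gt0_cvgMry.
exact: (cvg_comp _ _ h (@cvgr_expR R)).
Qed.

(** The summand 1 makes the integrand nonnegative, as the fundamental theorem on a half-line is
    applied in its nonnegative form. It is subtracted again in [rint_expabs_cos]. *)
Lemma integral0y_expR_cos e t : 0 < e ->
  (\int[mu]_(x in `[0%R, +oo[) (expR (- (e * x)) * (1 + cos (t * x)))%:E =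
   (e^-1 + e / (e ^+ 2 + t ^+ 2))%:E)%E.
Proof.
move=> e0; set D := e ^+ 2 + t ^+ 2.
have D0 : D != 0 by rewrite gt_eqF// ltr_pwDl ?sqr_ge0// exprn_gt0.
have en0 : e != 0 by rewrite gt_eqF.
pose F x := expR (- (e * x)) * ((t * sin (t * x) - e * cos (t * x)) / D - e^-1).
have dF x : is_derive x 1 F (expR (- (e * x)) * (1 + cos (t * x))).
  have dE : is_derive x 1 (fun y => expR (- (e * y))) (expR (- (e * x)) * - e).
    by apply: is_derive_comp1; apply: is_deriveN; exact: is_derive_scale.
  have dS : is_derive x 1 (fun y => t * sin (t * y)) (t * (cos (t * x) * t)).
    apply: is_derive_eq (is_derive_mulfun (is_derive_cst t x 1)
      (is_derive_comp1 (is_derive_sin _) (is_derive_scale t x))) _.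
    by rewrite mulr0 addr0.
  have dC : is_derive x 1 (fun y => e * cos (t * y)) (e * (- sin (t * x) * t)).
    apply: is_derive_eq (is_derive_mulfun (is_derive_cst e x 1)
      (is_derive_comp1 (is_derive_cos _) (is_derive_scale t x))) _.
    by rewrite mulr0 addr0.
  apply: is_derive_eq (is_derive_mulfun dE (is_derive_subfun
    (is_derive_mulfun (is_derive_subfun dS dC) (is_derive_cst D^-1 x 1))
    (is_derive_cst e^-1 x 1))) _.
  by rewrite /D /cst; field; rewrite -/D en0 D0.
have cF : continuous F.
  by move=> x; apply/differentiable_continuous/derivable1_diffP; case: (dF x).
rewrite (@ge0_continuous_FTC2y _ _ F 0 0).
- rewrite /F !mulr0 oppr0 expR0 sin0 cos0 -EFinB; congr EFin; rewrite /D; field.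
  by rewrite -/D D0 en0.
- by move=> x _; rewrite mulr_ge0 ?expR_ge0// -lerBlDl sub0r cos_geN1.
- apply: continuous_subspaceT => x; apply: cvgM; last first.
    apply: cvgD; first exact: cvg_cst.
    apply: continuous_comp; last exact: continuous_cos.
    by apply: cvgMr; exact: cvg_id.
  apply: continuous_comp; last exact: continuous_expR.
  by apply: cvgN; apply: cvgMr; exact: cvg_id.
- pose C := (`|t| + e) / D + e^-1.
  have Dgt0 : 0 < D by rewrite /D ltr_pwDl ?sqr_ge0// exprn_gt0.
  apply/norm_cvg0P; apply: (@squeeze_cvgr _ _ _ _ (fun=> 0)
      (fun x => expR (- (e * x)) * C)).
  + apply: nearW => x; rewrite normr_ge0/= normrM ger0_norm ?expR_ge0//.
    rewrite ler_wpM2l ?expR_ge0//; apply: le_trans (ler_normB _ _) _.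
    rewrite [`|e^-1|]gtr0_norm ?invr_gt0// lerD2r normrM normfV [`|D|]gtr0_norm//.
    rewrite ler_pM2r ?invr_gt0//; apply: le_trans (ler_normB _ _) _.
    rewrite !normrM [`|e|]gtr0_norm//; apply: lerD; apply: ler_piMr => //.
    - by rewrite ler_norml sin_geN1 sin_le1.
    - exact: ltW.
    - by rewrite ler_norml cos_geN1 cos_le1.
  + exact: cvg_cst.
  + rewrite -[X in _ --> X](mul0r C); apply: cvgMl; exact: expR_mulN_cvg0.
- by move=> x _; case: (dF x).
- by apply: cvg_at_right_filter; exact: cF.
- by move=> x _; rewrite derive1E; case: (dF x).
Qed.

Definition expabs e x := expR (- (e * `|x|)).

Lemma expabs_ge0 e x : 0 <= expabs e x. Proof. exact: expR_ge0. Qed.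

Lemma expabs_le1 e x : 0 < e -> expabs e x <= 1.
Proof. by move=> e0; rewrite -expR0 ler_expR oppr_le0 mulr_ge0// ltW. Qed.

Lemma continuous_expabs e : continuous (expabs e).
Proof.
move=> x; apply: continuous_comp; last exact: continuous_expR.
by apply: cvgN; apply: cvgMr; exact: norm_continuous.
Qed.

Lemma measurable_expabs e : measurable_fun setT (expabs e).
Proof. by apply: continuous_measurable_fun; exact: continuous_expabs. Qed.

Lemma integral_expabs_cos1 e t : 0 < e ->
  (\int[mu]_x (expabs e x * (1 + cos (t * x)))%:E =
   (2 * (e^-1 + e / (e ^+ 2 + t ^+ 2)))%:E)%E.
Proof.
move=> e0; rewrite (ge0_symfun_integralT (f := fun x => expabs e x * (1 + cos (t * x)))).
- rewrite EFinM -integral0y_expR_cos// set_itvcy; congr (_ * _)%E.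
  apply: eq_integral => x; rewrite inE/= => x0.
  by rewrite /expabs ger0_norm.
- by move=> x; rewrite mulr_ge0 ?expabs_ge0// -lerBlDl sub0r cos_geN1.
- move=> x; apply: cvgM; first exact: continuous_expabs.
  apply: cvgD; first exact: cvg_cst.
  apply: continuous_comp; last exact: continuous_cos.
  by apply: cvgMr; exact: cvg_id.
- by move=> x; rewrite /= /expabs normrN mulrN cosN.
Qed.

Lemma measurable_cos_scale t : measurable_fun setT (fun x => cos (t * x)).
Proof.
apply: continuous_measurable_fun => x.
apply: continuous_comp; last exact: continuous_cos.
by apply: cvgMr; exact: cvg_id.
Qed.

Lemma measurable_sin_scale t : measurable_fun setT (fun x => sin (t * x)).
Proof.
apply: continuous_measurable_fun => x.
apply: continuous_comp; last exact: continuous_sin.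
by apply: cvgMr; exact: cvg_id.
Qed.

Lemma intble_expabs_cos1 e t : 0 < e ->
  intble mu (fun x => expabs e x * (1 + cos (t * x))).
Proof.
move=> e0; apply: ge0_intbleP.
- apply: measurable_funM; first exact: measurable_expabs.
  by apply: measurable_funD => //; exact: measurable_cos_scale.
- by move=> x; rewrite mulr_ge0 ?expabs_ge0// -lerBlDl sub0r cos_geN1.
- by rewrite integral_expabs_cos1// ltry.
Qed.

Lemma intble_expabs e : 0 < e -> intble mu (expabs e).
Proof.
move=> e0; apply: eq_intble (intbleZ 2^-1 (intble_expabs_cos1 0 e0)) => x.
by rewrite mul0r cos0; field.
Qed.

Lemma intble_expabs_cos e t : 0 < e ->
  intble mu (fun x => expabs e x * cos (t * x)).
Proof.
move=> e0; apply: (intbleM_bounded (intble_expabs e0) (measurable_cos_scale t) (M := 1)).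
by move=> x; rewrite ler_norml cos_geN1 cos_le1.
Qed.

Lemma intble_expabs_sin e t : 0 < e ->
  intble mu (fun x => expabs e x * sin (t * x)).
Proof.
move=> e0; apply: (intbleM_bounded (intble_expabs e0) (measurable_sin_scale t) (M := 1)).
by move=> x; rewrite ler_norml sin_geN1 sin_le1.
Qed.

Lemma rint_expabs_cos e t : 0 < e ->
  \int[mu]_x (expabs e x * cos (t * x)) = 2 * e / (e ^+ 2 + t ^+ 2).
Proof.
move=> e0; have en0 : e != 0 by rewrite gt_eqF.
have H s : \int[mu]_x (expabs e x * (1 + cos (s * x))) =
    2 * (e^-1 + e / (e ^+ 2 + s ^+ 2)) by rewrite /Rintegral integral_expabs_cos1.
(* The case of frequency 0, where [1 + cos] equals 2. *)
have E : \int[mu]_x expabs e x = 2 / e.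
  transitivity (2^-1 * \int[mu]_x (expabs e x * (1 + cos (0 * x)))).
    rewrite -rintZ; last exact: intble_expabs_cos1.
    by apply: eq_rint => x; rewrite mul0r cos0; field.
  by rewrite H expr0n addr0; field.
have := H t; under eq_rint do rewrite mulrDr mulr1.
rewrite rintD; [|exact: intble_expabs|exact: intble_expabs_cos].
rewrite E mulrDr => /addrI ->; by rewrite mulrA.
Qed.

Lemma rint_expabs_sin e t : 0 < e -> \int[mu]_x (expabs e x * sin (t * x)) = 0.
Proof.
move=> e0; have n10 : -1 != 0 :> R by rewrite oppr_eq0 oner_eq0.
have := rint_scales (scales_measure_affine 0 n10) (intble_expabs_sin t e0).
rewrite normrN1 invr1 mul1r.
under eq_rint do rewrite addr0 mulN1r /expabs normrN -/(expabs e _) mulrN sinN mulrN.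
rewrite rintN; last exact: intble_expabs_sin.
by move=> /eqP; rewrite eqNr => /eqP.
Qed.

(** The Fourier transform of [expabs e] at frequency [t], which is a Cauchy density: it has total
    mass 1 and concentrates at 0 as [e] tends to 0. *)
Definition poisson e t := 2 * e / (e ^+ 2 + (2 * pi * t) ^+ 2).

Lemma poisson_ge0 e t : 0 < e -> 0 <= poisson e t.
Proof.
by move=> e0; rewrite divr_ge0 ?mulr_ge0 ?addr_ge0 ?sqr_ge0// ltW.
Qed.

End LaplaceKernel.

(** * The Hartley kernel integrated against the product weight *)

Section HartleyKernel.
Variable R : realType.
Implicit Types (e : R) (x f g : R * R).

Definition cas (t : R) := cos t + sin t.

Definition hkern x f := cas (2 * pi * dot2 f x).

Definition wexp e x := expabs e x.1 * expabs e x.2.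

Definition poisson2 e x := poisson e x.1 * poisson e x.2.

Lemma hkernC x f : hkern x f = hkern f x.
Proof. by rewrite /hkern /dot2 (mulrC f.1) (mulrC f.2). Qed.

Lemma hkern_le2 x f : `|hkern x f| <= 2.
Proof.
rewrite (le_trans (ler_normD _ _))// lerD// ler_norml ?cos_geN1 ?cos_le1//.
by rewrite sin_geN1 sin_le1.
Qed.

Lemma measurable_dot2 : measurable_fun setT
  (fun z : (R * R) * (R * R) => dot2 z.2 z.1).
Proof.
have m1 : measurable_fun setT (fun z : (R * R) * (R * R) => z.1.1).
  exact: (measurableT_comp measurable_fst measurable_fst).
have m2 : measurable_fun setT (fun z : (R * R) * (R * R) => z.1.2).
  exact: (measurableT_comp measurable_snd measurable_fst).
have m3 : measurable_fun setT (fun z : (R * R) * (R * R) => z.2.1).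
  exact: (measurableT_comp measurable_fst measurable_snd).
have m4 : measurable_fun setT (fun z : (R * R) * (R * R) => z.2.2).
  exact: (measurableT_comp measurable_snd measurable_snd).
by apply: measurable_funD; exact: measurable_funM.
Qed.

Lemma measurable_cas : measurable_fun setT cas.
Proof.
apply: measurable_funD; apply: continuous_measurable_fun.
  exact: continuous_cos.
exact: continuous_sin.
Qed.

Lemma measurable_hkern : measurable_fun setT
  (fun z : (R * R) * (R * R) => hkern z.1 z.2).
Proof.
apply: (measurableT_comp measurable_cas).
by apply: measurable_funM => //; exact: measurable_dot2.
Qed.

Lemma intble_wexp e : 0 < e -> intble (mu2 R) (wexp e).
Proof. by move=> e0; exact: (intble_prod (intble_expabs e0) (intble_expabs e0)). Qed.

Lemma wexp_ge0 e x : 0 <= wexp e x.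
Proof. by rewrite mulr_ge0 ?expabs_ge0. Qed.

Lemma wexp_le1 e x : 0 < e -> wexp e x <= 1.
Proof. by move=> e0; rewrite mulr_ile1 ?expabs_ge0 ?expabs_le1. Qed.

(** From [cas A * cas B = cos (A - B) + sin (A + B)]: the weight is even in each coordinate, so
    every term with a sine factor integrates to 0 and only the product of two cosines of the
    difference survives. *)
Lemma rint_wexp_hkern e f g : 0 < e ->
  \int[mu2 R]_x (wexp e x * (hkern x f * hkern x g)) =
  poisson2 e (f.1 - g.1, f.2 - g.2).
Proof.
move=> e0.
pose C t (s : R) := expabs e s * cos (t * s).
pose S t (s : R) := expabs e s * sin (t * s).
have C1 t : intble (@lebesgue_measure R) (C t) by exact: intble_expabs_cos.
have S1 t : intble (@lebesgue_measure R) (S t) by exact: intble_expabs_sin.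
set a := 2 * pi * (f.1 - g.1); set b := 2 * pi * (f.2 - g.2).
set c := 2 * pi * (f.1 + g.1); set d := 2 * pi * (f.2 + g.2).
transitivity (\int[mu2 R]_x ((C a x.1 * C b x.2 - S a x.1 * S b x.2) +
    (S c x.1 * C d x.2 + C c x.1 * S d x.2))).
  apply: eq_rint => x; rewrite /wexp /C /S.
  have -> : hkern x f * hkern x g = cos (a * x.1 + b * x.2) + sin (c * x.1 + d * x.2).
    set A := 2 * pi * dot2 f x; set B := 2 * pi * dot2 g x.
    have -> : a * x.1 + b * x.2 = A - B by rewrite /a /b /A /B /dot2; ring.
    have -> : c * x.1 + d * x.2 = A + B by rewrite /c /d /A /B /dot2; ring.
    by rewrite /hkern -/A -/B /cas cosB sinD; ring.
  by rewrite cosD sinD; ring.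
rewrite rintD; last 2 first.
- by apply: intbleB; apply: intble_prod.
- by apply: intbleD; apply: intble_prod.
rewrite rintB; [|exact: intble_prod..].
rewrite rintD; [|exact: intble_prod..].
rewrite (rint_prod (C1 a) (C1 b)) (rint_prod (S1 a) (S1 b)).
rewrite (rint_prod (S1 c) (C1 d)) (rint_prod (C1 c) (S1 d)).
by rewrite !rint_expabs_sin// !rint_expabs_cos// !mul0r mulr0 subr0 !addr0.
Qed.

End HartleyKernel.

(** * The Poisson kernel *)

Section PoissonKernel.
Variable R : realType.
Local Notation mu := (@lebesgue_measure R).
Implicit Types e s t al be : R.

Lemma is_derive_atan_poisson e t s : 0 < e ->
  is_derive s 1 (fun s => - (pi^-1 * atan (2 * pi / e * (t - s)))) (poisson e (t - s)).
Proof.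
move=> e0; have en0 : e != 0 by rewrite gt_eqF.
have pi0 : pi != 0 :> R by rewrite gt_eqF// pi_gt0.
set c := 2 * pi / e.
have d1 : is_derive s 1 (fun s => c * (t - s)) (- c).
  apply: is_derive_eq (is_derive_mulfun (is_derive_cst c s 1)
    (is_derive_subfun (is_derive_cst t s 1) (is_derive_id s 1))) _.
  by rewrite /cst; ring.
have d2 := is_derive_comp1 (is_derive1_atan _) d1.
have d3 := is_derive_mulfun (is_derive_cst (pi^-1 : R) s 1) d2.
apply: is_derive_eq (is_deriveN d3) _.
rewrite /cst /poisson /c mulr0 addr0.
have D0 : e ^+ 2 + (2 * pi * (t - s)) ^+ 2 != 0.
  by rewrite gt_eqF// ltr_pwDl ?sqr_ge0// exprn_gt0.
clear d1 d2 d3 c; move: (pi : R) pi0 D0 => p p0 D0.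
by field; rewrite D0 en0 p0.
Qed.

Lemma continuous_poisson_sub e t : 0 < e -> continuous (fun s => poisson e (t - s)).
Proof.
move=> e0 s; apply: cvgM; first exact: cvg_cst.
apply: cvgV.
  by rewrite gt_eqF// ltr_pwDl ?sqr_ge0// exprn_gt0.
apply: cvgD; first exact: cvg_cst.
under eq_fun do rewrite expr2.
rewrite expr2.
have h : (fun s => 2 * pi * (t - s)) x @[x --> s] --> 2 * pi * (t - s).
  by apply: cvgMr; apply: cvgB; [exact: cvg_cst|exact: cvg_id].
exact: (cvgM h h).
Qed.

Lemma measurable_poisson_sub e t : 0 < e ->
  measurable_fun setT (fun s => poisson e (t - s)).
Proof. by move=> e0; apply: continuous_measurable_fun; exact: continuous_poisson_sub. Qed.

Lemma poisson_le e t : 0 < e -> poisson e t <= 2 / e.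
Proof.
move=> e0; rewrite /poisson ler_pdivrMr ?ltr_pwDl ?sqr_ge0 ?exprn_gt0//.
have -> : 2 / e * (e ^+ 2 + (2 * pi * t) ^+ 2) = 2 * e + 2 / e * (2 * pi * t) ^+ 2.
  by field; rewrite gt_eqF.
by rewrite lerDl mulr_ge0 ?sqr_ge0// divr_ge0// ltW.
Qed.

(** The Poisson average at [t] of the indicator of []al, be]], in closed form. *)
Definition qpoisson e al be t :=
  pi^-1 * (atan (2 * pi / e * (t - al)) - atan (2 * pi / e * (t - be))).

Lemma integral_poisson_itv e al be t : 0 < e -> al < be ->
  (\int[mu]_(s in `]al, be]) (poisson e (t - s))%:E = (qpoisson e al be t)%:E)%E.
Proof.
move=> e0 ab.
rewrite integral_itv_obnd_cbnd; last first.
  by apply: measurable_funTS; apply/measurable_EFinP; exact: measurable_poisson_sub.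
have dF s := is_derive_atan_poisson t s e0.
set F := (fun s => - (pi^-1 * atan (2 * pi / e * (t - s)))) in dF.
have cF : continuous F.
  by move=> x; apply/differentiable_continuous/derivable1_diffP; case: (dF x).
rewrite (@continuous_FTC2 _ _ F)//.
- rewrite -EFinB /F /qpoisson; congr EFin; ring.
- by apply: continuous_subspaceT => x; exact: continuous_poisson_sub.
- split.
  + by move=> x _; case: (dF x).
  + by apply: cvg_at_right_filter; exact: cF.
  + by apply: cvg_at_left_filter; exact: cF.
- by move=> x _; rewrite derive1E; case: (dF x).
Qed.

Lemma integral_poisson e t : 0 < e ->
  (\int[mu]_s (poisson e (t - s))%:E = 1)%E.
Proof.
move=> e0.
have pi0 : pi != 0 :> R by rewrite gt_eqF// pi_gt0.
have c0 : 0 < 2 * pi / e by rewrite divr_gt0// mulr_gt0// pi_gt0.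
have poissonN s : poisson e (- s) = poisson e s by rewrite /poisson mulrN sqrrN.
have n10 : -1 != 0 :> R by rewrite oppr_eq0 oner_eq0.
have mp : measurable_fun setT (poisson e).
  have := measurable_poisson_sub 0 e0; apply: eq_measurable_fun => s _.
  by rewrite sub0r poissonN.
have cp : continuous (poisson e).
  have -> : poisson e = (fun s => poisson e (0 - s)).
    by apply/funext => s; rewrite sub0r poissonN.
  exact: continuous_poisson_sub.
have := ge0_integral_scales (scales_measure_affine t n10)
  (f := fun s => (poisson e s)%:E).
rewrite normrN1 invr1 mul1e => E.
transitivity (\int[mu]_s (poisson e s)%:E)%E.
  rewrite -E; last 2 first.
  - exact/measurable_EFinP.
  - by move=> s; rewrite lee_fin poisson_ge0.
  by apply: eq_integral => s _; rewrite mulN1r addrC.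
rewrite ge0_symfun_integralT//; last 2 first.
- by move=> s; exact: poisson_ge0.
- by move=> s; rewrite /= poissonN.
rewrite -set_itvcy.
pose F s := pi^-1 * atan (2 * pi / e * s).
have dF s : is_derive s 1 F (poisson e s).
  have := is_derive_atan_poisson 0 s e0; rewrite sub0r poissonN.
  rewrite (_ : (fun _ => _) = F)//; apply/funext => u.
  by rewrite /F sub0r mulrN atanN mulrN opprK.
have cF : continuous F.
  by move=> x; apply/differentiable_continuous/derivable1_diffP; case: (dF x).
rewrite (@ge0_continuous_FTC2y _ _ F 0 2^-1).
- by rewrite /F mulr0 atan0 mulr0 sube0 -EFinM divff.
- by move=> x _; exact: poisson_ge0.
- exact: continuous_subspaceT.
- have -> : 2^-1 = pi^-1 * (pi / 2) :> R by rewrite mulrA mulVf ?mul1r.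
  have h : 2 * pi / e * s @[s --> +oo%R] --> +oo%R by exact: gt0_cvgMry.
  by apply: cvgMr; exact: (cvg_comp _ _ h (@cvgy_atan R)).
- by move=> x _; case: (dF x).
- by apply: cvg_at_right_filter; exact: cF.
- by move=> x _; rewrite derive1E; case: (dF x).
Qed.

Lemma qpoisson_bounds e al be t : 0 < e -> al < be -> 0 <= qpoisson e al be t <= 1.
Proof.
move=> e0 ab; rewrite -!lee_fin -integral_poisson_itv//.
rewrite integral_ge0/=; last by move=> s _; rewrite lee_fin poisson_ge0.
rewrite -(integral_poisson t e0); apply: ge0_subset_integral => //.
  by apply/measurable_EFinP; exact: measurable_poisson_sub.
by move=> s _; rewrite lee_fin poisson_ge0.
Qed.

Lemma rint_indic_poisson e al be t : 0 < e -> al < be ->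
  intble mu (fun s => \1_`]al, be] s * poisson e (t - s)) /\
  \int[mu]_s (\1_`]al, be] s * poisson e (t - s)) = qpoisson e al be t.
Proof.
move=> e0 ab.
have E : (\int[mu]_s (\1_`]al, be] s * poisson e (t - s))%:E = (qpoisson e al be t)%:E)%E.
  rewrite -integral_poisson_itv// [RHS]integral_mkcond; apply: eq_integral => s _.
  by rewrite patchE indicE; case: ifPn => _; rewrite ?mul1r ?mul0r.
split; last by rewrite /Rintegral E.
apply: ge0_intbleP.
- apply: measurable_funM; first exact: measurable_indic.
  exact: measurable_poisson_sub.
- by move=> s; rewrite mulr_ge0 ?poisson_ge0// indicE.
- by rewrite E ltry.
Qed.

(** Each arctangent tends to [pi / 2] with the sign of its argument. At an end point one of them
    vanishes and the limit is one half, hence the two exclusions. *)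
Lemma qpoisson_cvg al be t : al < be -> t != al -> t != be ->
  qpoisson n.+1%:R^-1 al be t @[n --> \oo] --> (\1_`]al, be] t : R).
Proof.
have pi0 : pi != 0 :> R by rewrite gt_eqF// pi_gt0.
move=> ab tal tbe.
have lim0 (u : R) : 0 < u -> atan (2 * pi / n.+1%:R^-1 * u) @[n --> \oo] --> pi / 2.
  move=> u0.
  have h : n.+1%:R * (2 * pi * u) @[n --> \oo] --> +oo%R.
    have p0 : 0 < 2 * pi * u by rewrite mulr_gt0// mulr_gt0// pi_gt0.
    have hn : (n.+1%:R : R) @[n --> \oo] --> +oo%R.
      by have := @cvgr_idn R; rewrite -(cvg_shiftS (fun n => n%:R : R)).
    have hM : x * (2 * pi * u) @[x --> +oo%R] --> +oo%R by exact: gt0_cvgMly.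
    exact: (cvg_comp _ _ hn hM).
  rewrite (_ : (fun n => _) = (fun n => atan (n.+1%:R * (2 * pi * u)))).
    exact: (cvg_comp _ _ h (@cvgy_atan R)).
  by apply/funext => n; rewrite invrK; congr atan; ring.
have lim (u : R) : u != 0 ->
    atan (2 * pi / n.+1%:R^-1 * u) @[n --> \oo] --> (if 0 < u then pi / 2 else - (pi / 2)).
  move=> un0; have [u0|] := ltP 0 u; first exact: lim0.
  rewrite le_eqVlt (negbTE un0)/= => u0.
  rewrite (_ : (fun n => _) = (fun n => - atan (2 * pi / n.+1%:R^-1 * - u))).
    by apply: cvgN; apply: lim0; rewrite oppr_gt0.
  by apply/funext => n; rewrite mulrN atanN opprK.
have -> : (\1_`]al, be] t : R) = pi^-1 * ((if 0 < t - al then pi / 2 else - (pi / 2))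
   - (if 0 < t - be then pi / 2 else - (pi / 2))).
  rewrite !subr_gt0 indicE.
  have [tle|tgt] := ltP al t; have [ble|bgt] := ltP be t.
  - by rewrite memNset ?subrr ?mulr0//= in_itv/= tle/= leNgt ble.
  - by rewrite mem_set/= ?in_itv/= ?tle// opprK -splitr mulVf.
  - by have := lt_le_trans ble (le_trans tgt (ltW ab)); rewrite ltxx.
  - by rewrite memNset ?subrr ?mulr0//= in_itv/= ltNge tgt.
by apply: cvgMr; apply: cvgB; apply: lim; rewrite subr_eq0.
Qed.

End PoissonKernel.

(** * The Hartley transform on L^1 *)

Section HartleyL1.
Variable R : realType.
Local Notation m := (mu2 R).
Implicit Types (u v h : R * R -> R) (x y z f : R * R) (e : R).

Definition hartley h x := \int[m]_f (h f * hkern x f).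

Lemma intble_hkern h x : intble m h -> intble m (fun f => h f * hkern x f).
Proof. exact: (intble_kernel1 (m2 := @smu2 R) (@measurable_hkern R) (@hkern_le2 R)). Qed.

Lemma measurable_hartley h : intble m h -> measurable_fun setT (hartley h).
Proof. exact: (measurable_rint_kernel (m2 := @smu2 R) (@measurable_hkern R)). Qed.

Lemma norm_hartley h x : intble m h -> `|hartley h x| <= 2 * \int[m]_f `|h f|.
Proof. exact: (norm_rint_kernel (m2 := @smu2 R) (@measurable_hkern R) (@hkern_le2 R)). Qed.

Lemma hartley_adj u v : intble m u -> intble m v ->
  \int[m]_x (u x * hartley v x) = \int[m]_x (v x * hartley u x).
Proof.
move=> u1 v1.
have := rint_kernel_swap (m1 := @smu2 R) (m2 := @smu2 R) (@measurable_hkern R)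
  (@hkern_le2 R) u1 v1.
move=> ->; apply: eq_rint => y; congr (_ * _).
by apply: eq_rint => x; rewrite hkernC.
Qed.

Lemma measurable_wexp e : 0 < e -> measurable_fun setT (@wexp R e).
Proof. by move=> /intble_wexp /intble_mfun. Qed.

Lemma norm_wexp_le1 e x : 0 < e -> `|wexp e x| <= 1.
Proof. by move=> e0; rewrite ger0_norm ?wexp_ge0// wexp_le1. Qed.

Lemma measurable_hkern1 x : measurable_fun setT (hkern x).
Proof. exact: measurable_kernel1 (@measurable_hkern R) x. Qed.

(** Symmetry of the kernel moves the two transforms, one after the other, onto the integrable
    weight. What remains is the weighted integral of two kernels, a Poisson kernel. *)
Lemma hartley_wexp u v e : intble m u -> intble m v -> 0 < e ->
  \int[m]_x (wexp e x * (hartley u x * hartley v x)) =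
  \int[m]_y (u y * \int[m]_z (v z * poisson2 e (y.1 - z.1, y.2 - z.2))).
Proof.
move=> u1 v1 e0.
have wv1 : intble m (fun x => wexp e x * hartley v x).
  apply: (intbleM_bounded (intble_wexp e0) (measurable_hartley v1)) => x.
  exact: norm_hartley.
transitivity (\int[m]_x ((wexp e x * hartley v x) * hartley u x)).
  by apply: eq_rint => x; ring.
rewrite hartley_adj//; apply: eq_rint => y; congr (_ * _).
have w1 : intble m (fun x => wexp e x * hkern y x).
  apply: (intbleM_bounded (intble_wexp e0) (measurable_hkern1 y)) => x.
  exact: hkern_le2.
transitivity (\int[m]_x ((wexp e x * hkern y x) * hartley v x)).
  by apply: eq_rint => x; ring.
rewrite hartley_adj//; apply: eq_rint => z; congr (_ * _).
rewrite -rint_wexp_hkern//; apply: eq_rint => x.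
by rewrite (hkernC y) (hkernC z) mulrA.
Qed.

(** Half-open sides make the family stable under intersection, as a uniqueness argument for measures
    requires. *)
Definition rect (al be x : R * R) : R := \1_`]al.1, be.1] x.1 * \1_`]al.2, be.2] x.2.

Lemma rect_bounds al be x : 0 <= rect al be x <= 1.
Proof.
have ind01 (A : set R) t : 0 <= (\1_A t : R) <= 1.
  by rewrite indicE; case: (t \in A); rewrite /= ?lexx ?ler01.
have /andP[a0 a1] := ind01 `]al.1, be.1]%classic x.1.
have /andP[b0 b1] := ind01 `]al.2, be.2]%classic x.2.
by rewrite mulr_ge0//= mulr_ile1.
Qed.

Lemma intble_rect al be : intble m (rect al be).
Proof.
by apply: (intble_prod (m1 := @lebesgue_measure R) (m2 := @lebesgue_measure R));
  apply: integrable_indic_itv.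
Qed.

Lemma measurable_rect al be : measurable_fun setT (rect al be).
Proof. exact: intble_mfun (intble_rect al be). Qed.

Lemma norm_rect al be x : `|rect al be x| <= 1.
Proof. by have /andP[? ?] := rect_bounds al be x; rewrite ger0_norm. Qed.

Lemma rint_rect_poisson al be e y : al.1 < be.1 -> al.2 < be.2 -> 0 < e ->
  \int[m]_z (rect al be z * poisson2 e (y.1 - z.1, y.2 - z.2)) =
  qpoisson e al.1 be.1 y.1 * qpoisson e al.2 be.2 y.2.
Proof.
move=> ab1 ab2 e0.
have [i1 <-] := rint_indic_poisson y.1 e0 ab1.
have [i2 <-] := rint_indic_poisson y.2 e0 ab2.
rewrite -(rint_prod i1 i2); apply: eq_rint => z.
by rewrite /rect /poisson2/=; ring.
Qed.

Lemma mu2_vline (a : R) : m [set x | x.1 = a] = 0.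
Proof.
have -> : [set x : R * R | x.1 = a] = [set a] `*` setT.
  by apply/seteqP; split => x /=; [move=> ->|case].
transitivity (@lebesgue_measure R [set a] * @lebesgue_measure R setT)%E.
  exact: product_measure1E.
by rewrite lebesgue_measure_set1 mul0e.
Qed.

Lemma mu2_hline (a : R) : m [set x | x.2 = a] = 0.
Proof.
have -> : [set x : R * R | x.2 = a] = setT `*` [set a].
  by apply/seteqP; split => x /=; [move=> ->|case].
transitivity (@lebesgue_measure R setT * @lebesgue_measure R [set a])%E.
  exact: product_measure1E.
by rewrite lebesgue_measure_set1 mule0.
Qed.

Lemma ae_neq1 (a : R) : \forall x \ae m, x.1 != a.
Proof.
exists [set x | x.1 = a]; split; last by move=> x /= /negP/negPn/eqP.
  have -> : [set x : R * R | x.1 = a] = [set a] `*` setT.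
    by apply/seteqP; split => x /=; [move=> ->|case].
  exact: measurableX.
exact: mu2_vline.
Qed.

Lemma ae_neq2 (a : R) : \forall x \ae m, x.2 != a.
Proof.
exists [set x | x.2 = a]; split; last by move=> x /= /negP/negPn/eqP.
  have -> : [set x : R * R | x.2 = a] = setT `*` [set a].
    by apply/seteqP; split => x /=; [move=> ->|case].
  exact: measurableX.
exact: mu2_hline.
Qed.

Let eps n : R := n.+1%:R^-1.
Let eps_gt0 n : 0 < eps n. Proof. by rewrite invr_gt0. Qed.

Lemma measurable_qpoisson e a b : measurable_fun setT (@qpoisson R e a b).
Proof.
have ma (c d : R) : measurable_fun setT (fun t : R => atan (c * (t - d))).
  apply: continuous_measurable_fun => t.
  apply: (@continuous_comp _ _ _ (fun t => c * (t - d)) (@atan R)).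
    by apply: cvgMr; apply: cvgB; [exact: cvg_id|exact: cvg_cst].
  exact: continuous_atan.
by apply: measurable_funM => //; apply: measurable_funB.
Qed.

(** The Poisson averages of the rectangle lie between 0 and 1, so the absolute value of [u]
    dominates. They converge off the four lines that carry the sides, a null set. *)
Lemma hartley_wexp_rect_cvg u al be : intble m u -> al.1 < be.1 -> al.2 < be.2 ->
  \int[m]_x (wexp (eps n) x * (hartley u x * hartley (rect al be) x)) @[n --> \oo]
  --> \int[m]_x (u x * rect al be x).
Proof.
move=> u1 ab1 ab2.
under eq_fun.
  move=> n; rewrite hartley_wexp//; last exact: intble_rect.
  under eq_rint do rewrite rint_rect_poisson//.
  over.
have mq n : measurable_fun setT (fun y : R * R =>
    qpoisson (eps n) al.1 be.1 y.1 * qpoisson (eps n) al.2 be.2 y.2).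
  by apply: measurable_funM; apply: measurableT_comp => //; exact: measurable_qpoisson.
have mu := intble_mfun u1.
pose F n y := u y * (qpoisson (eps n) al.1 be.1 y.1 * qpoisson (eps n) al.2 be.2 y.2).
apply: (@rint_dominated_cvg _ _ _ m F (fun y => u y * rect al be y) (fun y => `|u y|)).
- by move=> n; apply: measurable_funM; [exact: mu|exact: mq].
- by apply: measurable_funM; [exact: mu|exact: measurable_rect].
- near=> x.
  have c1 : qpoisson (eps n) al.1 be.1 x.1 @[n --> \oo] --> (\1_`]al.1, be.1] x.1 : R).
    by apply: qpoisson_cvg => //; near: x; exact: ae_neq1.
  have c2 : qpoisson (eps n) al.2 be.2 x.2 @[n --> \oo] --> (\1_`]al.2, be.2] x.2 : R).
    by apply: qpoisson_cvg => //; near: x; exact: ae_neq2.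
  by apply: cvgMr; exact: (cvgM c1 c2).
- exact: intble_norm.
- move=> n x; rewrite normrM ler_piMr//.
  have /andP[a0 a1] := qpoisson_bounds x.1 (eps_gt0 n) ab1.
  have /andP[b0 b1] := qpoisson_bounds x.2 (eps_gt0 n) ab2.
  by rewrite ger0_norm; [exact: mulr_ile1|exact: mulr_ge0].
Unshelve. all: by end_near. Qed.

End HartleyL1.

(** * Integrals over rectangles *)

Section DensityMeasure.
Context d (T : measurableType d) (R : realType).
Variable mu : {measure set T -> \bar R}.
Variable f : T -> \bar R.
Hypotheses (mf : measurable_fun setT f) (f0 : forall x, (0 <= f x)%E).

(* The body records [mf] and [f0] so that the measure instance can refer to
   them. *)
Definition density_measure : set T -> \bar R :=
  let _ := (mf, f0) in fun A => (\int[mu]_(x in A) f x)%E.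

Let density0 : density_measure set0 = 0%E.
Proof. exact: integral_set0. Qed.

Let density_ge0 A : (0 <= density_measure A)%E.
Proof. exact: integral_ge0. Qed.

Let density_additive : semi_sigma_additive density_measure.
Proof. exact: semi_sigma_additive_nng_induced. Qed.

HB.instance Definition _ := isMeasure.Build _ _ _ density_measure
  density0 density_ge0 density_additive.

End DensityMeasure.

Section Rectangles.
Variable R : realType.
Local Notation m := (mu2 R).

Definition ocrect : set (set (R * R)) := [set A `*` B | A in @ocitv R & B in @ocitv R].

(** The product is the intersection of two strips. A strip over a half-open interval is a countable
    union of bounded rectangles, and the sets whose strip is generated form a sigma-algebra. *)
Lemma sigma_ocrect_setM (A B : set (measurableTypeR R)) :
  measurable A -> measurable B -> <<s ocrect >> (A `*` B).
Proof.
pose I n : set R := `]- n%:R, n%:R]%classic.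
have IT : \bigcup_n I n = setT.
  apply/seteqP; split => // t _; exists (Num.truncn `|t|).+1 => //.
  have := truncnS_gt `|t|; rewrite ltr_norml => /andP[t1 /ltW t2].
  by rewrite /I/= in_itv/= t1.
have [S0 SC SU] := smallest_sigma_algebra setT ocrect.
have SI (X Y : set (R * R)) : <<s ocrect >> X -> <<s ocrect >> Y -> <<s ocrect >> (X `&` Y).
  move=> SX SY; rewrite -(setCK (X `&` Y)) setCI; apply: sigma_algebraC.
  rewrite -bigcup2E; apply: SU => -[|[|n]] /=; last exact: S0.
    exact: sigma_algebraC.
  exact: sigma_algebraC.
have H1 (C : set (measurableTypeR R)) : measurable C -> <<s ocrect >> (C `*` setT).
  apply: (@smallest_sub _ _ _ [set C | <<s ocrect >> (C `*` setT)]).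
    split => /=.
    - by rewrite set0X.
    - move=> X SX; rewrite (_ : _ `*` _ = setT `\` (X `*` setT)); first exact: SC.
      by apply/seteqP; split => x /=; tauto.
    - move=> F SF; rewrite (_ : _ `*` _ = \bigcup_n (F n `*` setT)); first exact: SU.
      by apply/seteqP; split => [x [[n _ Fn] _]|x [n _ [Fn _]]]; [exists n|split => //; exists n].
  move=> X oX /=; rewrite (_ : _ `*` _ = \bigcup_n (X `*` I n)).
    by apply: SU => n; apply: sub_sigma_algebra; exists X => //; exists (I n) => //; exact: is_ocitv.
  rewrite -IT; apply/seteqP; split => [x [Xx [n _ In]]|x [n _ [Xx In]]]; first by exists n.
  by split => //; exists n.
have H2 (C : set (measurableTypeR R)) : measurable C -> <<s ocrect >> (setT `*` C).
  apply: (@smallest_sub _ _ _ [set C | <<s ocrect >> (setT `*` C)]).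
    split => /=.
    - by rewrite setX0.
    - move=> X SX; rewrite (_ : _ `*` _ = setT `\` (setT `*` X)); first exact: SC.
      by apply/seteqP; split => x /=; tauto.
    - move=> F SF; rewrite (_ : _ `*` _ = \bigcup_n (setT `*` F n)); first exact: SU.
      by apply/seteqP; split => [x [_ [n _ Fn]]|x [n _ [_ Fn]]]; [exists n|split => //; exists n].
  move=> X oX /=; rewrite (_ : _ `*` _ = \bigcup_n (I n `*` X)).
    by apply: SU => n; apply: sub_sigma_algebra; exists (I n); [exact: is_ocitv|exists X].
  rewrite -IT; apply/seteqP; split => [x [[n _ In] Xx]|x [n _ [In Xx]]]; first by exists n.
  by split => //; exists n.
move=> mA mB; rewrite (_ : _ `*` _ = (A `*` setT) `&` (setT `*` B)).
  by apply: SI; [exact: H1|exact: H2].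
by apply/seteqP; split => x /=; tauto.
Qed.

Lemma measurable_ocrect :
  (measurable : set (set (measurableTypeR R * measurableTypeR R)%type)) = <<s ocrect >>.
Proof.
rewrite measurable_prod_measurableType; apply/seteqP; split.
  apply: smallest_sub; first exact: smallest_sigma_algebra.
  by move=> _ [A mA [B mB <-]]; exact: sigma_ocrect_setM.
apply: smallest_sub; first exact: smallest_sigma_algebra.
move=> _ [A oA [B oB <-]]; apply: sub_sigma_algebra.
by exists A; [exact: sub_sigma_algebra|exists B => //; exact: sub_sigma_algebra].
Qed.

Lemma ocrect_setI : setI_closed ocrect.
Proof.
move=> _ _ [A oA [B oB <-]] [A' oA' [B' oB' <-]].
exists (A `&` A'); first exact: ocitvI.
by exists (B `&` B'); [exact: ocitvI|rewrite setXI].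
Qed.

(** To stay with positive measures, the densities [|u| + u] and [|u|] are compared. They have equal
    finite integrals over rectangles, hence over all measurable sets, hence agree almost
    everywhere. *)
Lemma rint_rect_eq0_ae (u : R * R -> R) : intble m u ->
  (forall al be : R * R, al.1 < be.1 -> al.2 < be.2 ->
     \int[m]_x (u x * rect al be x) = 0) ->
  \forall x \ae m, u x = 0.
Proof.
move=> u1 H.
have un1 := intble_norm u1; have v1 := intbleD un1 u1.
have mun : measurable_fun setT (fun x => (`|u x|)%:E).
  by apply/measurable_EFinP; exact: intble_mfun un1.
have mv : measurable_fun setT (fun x => (`|u x| + u x)%:E).
  by apply/measurable_EFinP; exact: intble_mfun v1.
have un0 x : (0 <= (`|u x|)%:E)%E by rewrite lee_fin.
have v0 x : (0 <= (`|u x| + u x)%:E)%E.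
  by rewrite lee_fin; have := ler_norm (- u x); rewrite normrN; lra.
have fin (w : R * R -> R) (C : set (measurableTypeR R * measurableTypeR R)%type) : intble m w -> measurable C ->
    (\int[m]_(x in C) (w x)%:E < +oo)%E.
  move=> w1 mC; have : m.-integrable C (EFin \o w) by exact: integrableS w1.
  by move=> iw; have := integrable_fin_num mC iw; rewrite fin_numE ltey => /andP[].
have E (C : set (measurableTypeR R * measurableTypeR R)%type) : measurable C ->
    (\int[m]_(x in C) (`|u x| + u x)%:E = \int[m]_(x in C) (`|u x|)%:E)%E.
  pose box n : set (R * R) := `]- n%:R, n%:R] `*` `]- n%:R, n%:R].
  move=> mC.
  refine (@measure_unique _ R
    (measurableTypeR R * measurableTypeR R)%type ocrect box measurable_ocrect ocrect_setI _ _
    (density_measure m mv v0) (density_measure m mun un0) _ _ C mC).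
  - move=> n; exists `]- n%:R, n%:R]%classic; first exact: is_ocitv.
    by exists `]- n%:R, n%:R]%classic => //; exact: is_ocitv.
  - apply/seteqP; split => // x _.
    exists (Num.truncn (`|x.1| + `|x.2|)).+1 => //.
    have := truncnS_gt (`|x.1| + `|x.2|); set n := _.+1 => xn.
    have x1 : `|x.1| < n%:R by apply: le_lt_trans xn; rewrite lerDl.
    have x2 : `|x.2| < n%:R by apply: le_lt_trans xn; rewrite lerDr.
    split; rewrite /= in_itv/=.
      by move: x1; rewrite ltr_norml => /andP[-> /ltW ->].
    by move: x2; rewrite ltr_norml => /andP[-> /ltW ->].
  - move=> _ [A /ocitvP[->|[[a b] /= ab ->]] [B oB <-]]; first by rewrite set0X !measure0.
    case/ocitvP : oB => [->|[[a' b'] /= ab' ->]]; first by rewrite setX0 !measure0.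
    rewrite /density_measure.
    have rE (w : R * R -> R) : intble m w ->
      (\int[m]_(x in `]a, b] `*` `]a', b']) (w x)%:E =
       (\int[m]_x (w x * rect (a, a') (b, b') x))%:E)%E.
      move=> w1; rewrite integral_mkcond -rint_EFin; last first.
        apply: (intbleM_bounded w1 (measurable_rect _ _)) => x; exact: norm_rect.
      apply: eq_integral => x _; rewrite patchE /rect !indicE /=.
      rewrite in_setX; case: (_ \in _); case: (_ \in _) => /=;
        by rewrite ?mulr1 ?mulr0 ?mul0r ?mulr1.
    rewrite rE// rE//; congr EFin.
    rewrite -[RHS]addr0 -[X in _ = _ + X](H (a, a') (b, b') ab ab').
    rewrite -rintD; first by apply: eq_rint => x; rewrite mulrDl.
      by apply: (intbleM_bounded un1 (measurable_rect _ _)) => x; exact: norm_rect.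
    by apply: (intbleM_bounded u1 (measurable_rect _ _)) => x; exact: norm_rect.
  - move=> n; apply: fin => //.
    by apply: measurableX.
have := integral_ae_eq measurableT v1 mun (fun C _ mC => E C mC).
apply: filterS => x /(_ I) /= [] /eqP; rewrite -subr_eq0 addrAC subrr add0r.
by move/eqP.
Qed.

End Rectangles.

(** * The Hartley transform on L^2 *)

Section HartleyL2.
Variable R : realType.
Local Notation m := (mu2 R).
Implicit Types (u v h k : R * R -> R) (x y z f c : R * R) (e : R).

Lemma rect_empty al be x : ~ (al.1 < be.1 /\ al.2 < be.2) -> rect al be x = 0 :> R.
Proof.
have E (a b : R) : ~ a < b -> `]a, b]%classic = set0.
  by move=> /negP; rewrite -leNgt => ba; rewrite set_itv_ge// bnd_simp -leNgt.
by move=> /not_andP[] /E ab; rewrite /rect ab indic0 ?mul0r ?mulr0.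
Qed.

Lemma rectM al be al' be' x : rect al be x * rect al' be' x =
  rect (Num.max al.1 al'.1, Num.max al.2 al'.2) (Num.min be.1 be'.1, Num.min be.2 be'.2) x :> R.
Proof.
have ind (a b a' b' t : R) : (\1_`]a, b] t : R) * \1_`]a', b'] t =
    \1_`]Num.max a a', Num.min b b'] t.
  rewrite !indicE -natrM mulnb; congr (_%:R); congr nat_of_bool.
  by rewrite !mem_setE !in_itv/= gt_max le_min andbACA.
by rewrite /rect -ind -ind /=; ring.
Qed.

(** The local form handles L^2 functions, and differences of an L^1 and an L^2 function. Restricted
    to a large box, [u] is integrable, and a rectangle cut by the box is a rectangle or empty. *)
Lemma rint_rect_loc_eq0_ae u : measurable_fun setT u ->
  (forall al be, intble m (fun x => u x * rect al be x)) ->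
  (forall al be, al.1 < be.1 -> al.2 < be.2 -> \int[m]_x (u x * rect al be x) = 0) ->
  \forall x \ae m, u x = 0.
Proof.
move=> mu ul H.
pose lo n : R * R := (- n%:R, - n%:R); pose hi n : R * R := (n%:R, n%:R).
have H0 : \forall x \ae m, forall n, u x * rect (lo n) (hi n) x = 0.
  apply/ae_foralln => n; apply: rint_rect_eq0_ae; first exact: ul.
  move=> al be _ _; under eq_rint do rewrite -mulrA rectM.
  pose al' := (Num.max (lo n).1 al.1, Num.max (lo n).2 al.2).
  pose be' := (Num.min (hi n).1 be.1, Num.min (hi n).2 be.2).
  have [[ab1 ab2]|nab] := pselect (al'.1 < be'.1 /\ al'.2 < be'.2);
    first exact: (H al' be').
  by under eq_rint do rewrite (@rect_empty al' be')// mulr0; rewrite rint0.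
apply: aeS H0 => x ux.
have := truncnS_gt (`|x.1| + `|x.2|); set n := _.+1 => xn.
have x1 : `|x.1| < n%:R by apply: le_lt_trans xn; rewrite lerDl.
have x2 : `|x.2| < n%:R by apply: le_lt_trans xn; rewrite lerDr.
have := ux n; rewrite /rect !indicE !mem_set ?mulr1//= in_itv/=.
  by move: x2; rewrite ltr_norml => /andP[-> /ltW ->].
by move: x1; rewrite ltr_norml => /andP[-> /ltW ->].
Qed.

Let eps n : R := n.+1%:R^-1.
Let eps_gt0 n : 0 < eps n. Proof. by rewrite invr_gt0. Qed.

Lemma eps_cvg0 : eps n @[n --> \oo] --> (0 : R).
Proof. exact: cvg_harmonic. Qed.

Lemma wexp_cvg1 x : wexp (eps n) x @[n --> \oo] --> (1 : R).
Proof.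
have E t : expabs (eps n) t @[n --> \oo] --> (1 : R).
  rewrite -expR0; apply: continuous_cvg; first exact: continuous_expR.
  rewrite -oppr0 -(mul0r `|t|); apply: cvgN; apply: cvgMl; exact: eps_cvg0.
by rewrite -[X in _ --> X]mulr1; apply: cvgM; exact: E.
Qed.

Lemma measurable_poisson2 e : 0 < e -> measurable_fun setT
  (fun z : (R * R) * (R * R) => poisson2 e (z.1.1 - z.2.1, z.1.2 - z.2.2)).
Proof.
move=> e0.
have mp : measurable_fun setT (@poisson R e).
  have := measurable_poisson_sub 0 e0; apply: eq_measurable_fun => s _.
  by rewrite sub0r /poisson mulrN sqrrN.
apply: measurable_funM; apply: (measurableT_comp mp); apply: measurable_funB.
- exact: (measurableT_comp measurable_fst measurable_fst).
- exact: (measurableT_comp measurable_fst measurable_snd).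
- exact: (measurableT_comp measurable_snd measurable_fst).
- exact: (measurableT_comp measurable_snd measurable_snd).
Qed.

Lemma poisson2_ge0 e x : 0 < e -> 0 <= poisson2 e x.
Proof. by move=> e0; rewrite mulr_ge0 ?poisson_ge0. Qed.

Lemma integral_poisson2 e y : 0 < e ->
  (\int[m]_z (poisson2 e (y.1 - z.1, y.2 - z.2))%:E = 1)%E.
Proof.
move=> e0.
have i1 t : intble (@lebesgue_measure R) (fun s => poisson e (t - s)).
  apply: ge0_intbleP; first exact: measurable_poisson_sub.
    by move=> s; exact: poisson_ge0.
  by rewrite integral_poisson// ltry.
have E t : \int[@lebesgue_measure R]_s poisson e (t - s) = 1.
  by rewrite /Rintegral integral_poisson.
have := rint_prod (i1 y.1) (i1 y.2); rewrite !E mulr1 => P.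
rewrite rint_EFin; last exact: (intble_prod (i1 y.1) (i1 y.2)).
by congr EFin.
Qed.

Lemma poissonN e t : poisson e (- t) = poisson e t :> R.
Proof. by rewrite /poisson mulrN sqrrN. Qed.

(* The regularised energy [\int wexp e * (hartley u)^2] is a Poisson average
   of [u], hence at most [sqnorm u] by the Schur test. *)
Lemma hartley_bessel u : intble m u -> sqintble m u ->
  sqintble m (hartley u) /\ sqnorm m (hartley u) <= sqnorm m u.
Proof.
move=> u1 su.
have mh := measurable_hartley u1.
have mh2 : measurable_fun setT (fun x => hartley u x ^+ 2) by exact: measurable_funX.
have Bw n : (\int[m]_x (wexp (eps n) x * hartley u x ^+ 2)%:E <= (sqnorm m u)%:E)%E.
  rewrite rint_EFin; last first.
    apply: (intbleM_bounded (intble_wexp (eps_gt0 n)) mh2 (M := (2 * \int[m]_f `|u f|) ^+ 2)).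
    move=> x; rewrite normrX lerXn2r ?nnegrE//; last exact: norm_hartley.
    by rewrite mulr_ge0// rint_ge0.
  rewrite lee_fin; under eq_rint do rewrite expr2.
  rewrite hartley_wexp//.
  apply: (schur_test (m := @smu2 R) (K := fun y z => poisson2 (eps n) (y.1 - z.1, y.2 - z.2))
    (M := (2 / eps n) * (2 / eps n))) => //.
  - exact: measurable_poisson2.
  - by move=> x y; exact: poisson2_ge0.
  - move=> x y; rewrite ger0_norm ?poisson2_ge0//.
    by apply: ler_pM; rewrite ?poisson_ge0 ?poisson_le.
  - by move=> y; exact: integral_poisson2.
  - move=> z; rewrite -(integral_poisson2 z (eps_gt0 n)).
    apply: eq_integral => y _; rewrite /poisson2/=.
    by rewrite -poissonN opprB -(poissonN _ (y.2 - z.2)) opprB.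
(* The bound does not depend on the weight, which Fatou therefore removes. *)
have B : (\int[m]_x (hartley u x ^+ 2)%:E <= (sqnorm m u)%:E)%E.
  apply: (@fatou_le_ae _ _ _ m (fun n x => wexp (eps n) x * hartley u x ^+ 2)
    (fun x => hartley u x ^+ 2)) => //.
  - by move=> n; apply: measurable_funM => //; exact: measurable_wexp.
  - by move=> n x; rewrite mulr_ge0 ?wexp_ge0 ?sqr_ge0.
  - apply: aeW => x; rewrite -[X in _ --> X]mul1r; apply: cvgMl; exact: wexp_cvg1.
  - exact: nearW.
have sh : sqintble m (hartley u).
  split => //; apply: ge0_intbleP => //; first by move=> x; exact: sqr_ge0.
  exact: le_lt_trans B (ltry _).
by split => //; rewrite -lee_fin -sqintble_EFin.
Qed.

Lemma sqintble_rect al be : sqintble m (@rect R al be).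
Proof. by apply: (bounded_sqintble (intble_rect al be)) => x; exact: norm_rect. Qed.

(** Both sides are limits of the same weighted integrals: the right one by Poisson averaging, the
    left one by dominated convergence, as the product of two square-integrable transforms is
    integrable. *)
Lemma hartley_rect_sq u al be : intble m u -> sqintble m (hartley u) ->
  al.1 < be.1 -> al.2 < be.2 ->
  \int[m]_x (hartley u x * hartley (rect al be) x) = \int[m]_x (u x * rect al be x).
Proof.
move=> u1 sh ab1 ab2.
have sr := (hartley_bessel (intble_rect al be) (sqintble_rect al be)).1.
have hr1 := sqintbleM sh sr.
apply: (cvg_unique _ _ (hartley_wexp_rect_cvg u1 ab1 ab2)) => //.
pose F n x := wexp (eps n) x * (hartley u x * hartley (rect al be) x).
have mhr := intble_mfun hr1.
apply: (@rint_dominated_cvg _ _ _ m F _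
  (fun x => `|hartley u x * hartley (rect al be) x|)) => //.
- by move=> n; apply: measurable_funM; [exact: measurable_wexp|exact: mhr].
- apply: aeW => x; rewrite -[X in _ --> X]mul1r; apply: cvgMl; exact: wexp_cvg1.
- exact: intble_norm.
- by move=> n x; rewrite normrM ler_piMl// norm_wexp_le1.
Qed.

(** The zero transform is square-integrable, so [hartley_rect_sq] makes every integral of [u] over a
    rectangle vanish. *)
Lemma hartley_eq0_ae u : intble m u -> (forall x, hartley u x = 0) ->
  \forall x \ae m, u x = 0.
Proof.
move=> u1 u0; apply: rint_rect_eq0_ae => // al be ab1 ab2.
have E : hartley u = (fun=> 0) by apply/funext.
rewrite -hartley_rect_sq//; last by rewrite E; split => //; apply: eq_intble (intble0 _) => x; rewrite expr0n.
by under eq_rint do rewrite u0 mul0r; rewrite rint0.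
Qed.

Lemma hartleyB u v x : intble m u -> intble m v ->
  hartley (fun y => u y - v y) x = hartley u x - hartley v x.
Proof.
move=> u1 v1; rewrite /hartley -rintB; [|exact: intble_hkern..].
by apply: eq_rint => y; rewrite mulrBl.
Qed.

Definition L12 u := intble m u /\ sqintble m u.

(** The closure of the graph of [hartley] on the intersection of L^1 and L^2. A relation tolerates
    changes of [u] and [h] on null sets. *)
Definition hartley2 u h := [/\ sqintble m u, sqintble m h &
  exists un : nat -> R * R -> R, [/\ forall n, L12 (un n), cvg2 m un u &
    cvg2 m (fun n => hartley (un n)) h]].

Lemma L12_rect al be : L12 (rect al be).
Proof. by split; [exact: intble_rect|exact: sqintble_rect]. Qed.

Lemma sqintble_hartley u : L12 u -> sqintble m (hartley u).
Proof. by move=> [u1 su]; exact: (hartley_bessel u1 su).1. Qed.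

Lemma hartley_distance u v : L12 u -> L12 v ->
  sqnorm m (fun x => hartley u x - hartley v x) <= sqnorm m (fun x => u x - v x).
Proof.
move=> [u1 su] [v1 sv].
have := (hartley_bessel (intbleB u1 v1) (sqintbleB su sv)).2; apply: le_trans.
rewrite le_eqVlt; apply/orP; left; apply/eqP; apply: eq_rint => x.
by rewrite hartleyB.
Qed.

Lemma hartley2_L12 u : L12 u -> hartley2 u (hartley u).
Proof.
move=> u12; split; [exact: u12.2|exact: sqintble_hartley|exists (fun=> u)].
by split => //; exact: cvg2_cst.
Qed.

Lemma hartley_cvg2_ex (un : nat -> R * R -> R) u : (forall n, L12 (un n)) ->
  sqintble m u -> cvg2 m un u ->
  exists h, sqintble m h /\ cvg2 m (fun n => hartley (un n)) h.
Proof.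
move=> un12 su unu; apply: (@cvg2_complete _ _ _ m (fun n => hartley (un n))).
  by move=> n; exact: sqintble_hartley.
(* Two distances to [u] enter, each with the factor 2 of [sqnormD_le]. *)
move=> e e0; have e4 : 0 < e / 4 by rewrite divr_gt0.
have /cvgrPdist_le /(_ _ e4) [N _ HN] := unu; exists N => a b Na Nb.
apply: le_trans (hartley_distance (un12 a) (un12 b)) _.
have HN' n : (N <= n)%N -> sqnorm m (fun x => un n x - u x) <= e / 4.
  by move=> Nn; have := HN n Nn; rewrite sub0r normrN ger0_norm// sqnorm_ge0.
apply: (@le_trans _ _ (2 * sqnorm m (fun x => un a x - u x) +
    2 * sqnorm m (fun x => u x - un b x))).
  rewrite [leLHS](_ : _ = sqnorm m (fun x => (un a x - u x) + (u x - un b x))).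
    by apply: sqnormD_le; apply: sqintbleB => //; exact: (un12 _).2.
  by apply: eq_rint => x; rewrite addrA subrK.
by rewrite (sqnormB_sym m u); have := HN' a Na; have := HN' b Nb; lra.
Qed.

Lemma hartley_cvg2_unique (un vn : nat -> R * R -> R) u h k :
  (forall n, L12 (un n)) -> (forall n, L12 (vn n)) -> sqintble m u ->
  sqintble m h -> sqintble m k -> cvg2 m un u -> cvg2 m vn u ->
  cvg2 m (fun n => hartley (un n)) h -> cvg2 m (fun n => hartley (vn n)) k ->
  \forall x \ae m, h x = k x.
Proof.
move=> un12 vn12 su sh sk unu vnu unh vnk; apply: sqnorm_eq0_ae => //.
have sHu n := sqintble_hartley (un12 n); have sHv n := sqintble_hartley (vn12 n).
have d1 := cvg2_dist sHu sh sHv sk unh vnk.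
have d0 := cvg2_dist (fun n => (un12 n).2) su (fun n => (vn12 n).2) su unu vnu.
apply/eqP; rewrite eq_le sqnorm_ge0 andbT.
have -> : 0 = sqnorm m (fun x => u x - u x).
  by rewrite /sqnorm; under eq_rint do rewrite subrr expr0n/=; rewrite rint0.
apply: (ler_cvg_to d1 d0); apply: nearW => n.
exact: hartley_distance.
Qed.

Lemma hartley2_unique u h k : hartley2 u h -> hartley2 u k ->
  \forall x \ae m, h x = k x.
Proof.
move=> [su sh [un [un12 unu unh]]] [_ sk [vn [vn12 vnu vnk]]].
exact: (hartley_cvg2_unique un12 vn12 su sh sk unu vnu unh vnk).
Qed.

Lemma hartley2_ae u u' h h' : hartley2 u h ->
  measurable_fun setT u' -> measurable_fun setT h' ->
  (\forall x \ae m, u x = u' x) -> (\forall x \ae m, h x = h' x) -> hartley2 u' h'.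
Proof.
move=> [su sh [un [un12 unu unh]]] mu' mh' uu' hh'.
split; [exact: sqintble_ae su|exact: sqintble_ae sh|exists un; split => //].
  by apply: cvg2_ae unu => //; [move=> n; exact: (un12 n).2.1|exact: su.1].
apply: cvg2_ae unh => //; last exact: sh.1.
by move=> n; exact: (sqintble_hartley (un12 n)).1.
Qed.

Lemma hartley2_adj u h v k : hartley2 u h -> hartley2 v k ->
  \int[m]_x (h x * v x) = \int[m]_x (u x * k x).
Proof.
move=> [su sh [un [un12 unu unh]]] [sv sk [vn [vn12 vnv vnk]]].
have c1 := cvg2_rintM (fun n => sqintble_hartley (un12 n)) sh
  (fun n => (vn12 n).2) sv unh vnv.
have c2 := cvg2_rintM (fun n => (un12 n).2) su
  (fun n => sqintble_hartley (vn12 n)) sk unu vnk.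
apply: (cvg_unique _ c1) => //.
rewrite (_ : (fun n => _) = (fun n => \int[m]_x (un n x * hartley (vn n) x)))//.
apply/funext => n; rewrite hartley_adj; [|exact: (un12 n).1|exact: (vn12 n).1].
by apply: eq_rint => x; rewrite mulrC.
Qed.

End HartleyL2.

(** * Inversion, Parseval and dilations for the L^2 Hartley transform *)

Section HartleyInversion.
Variable R : realType.
Local Notation m := (mu2 R).
Implicit Types (u v h k : R * R -> R) (x y z f c : R * R) (a e : R).

Lemma measurable_enorm : measurable_fun setT (@enorm R).
Proof.
apply: (@measurableT_comp _ _ _ _ _ _ (@Num.sqrt R)).
  by apply: continuous_measurable_fun; exact: sqrt_continuous.
by apply: measurable_funD; apply: measurable_funX.
Qed.

Definition disc n : set (R * R) := [set x | enorm x <= n%:R].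

Lemma measurable_disc n : measurable (disc n).
Proof.
rewrite (_ : disc n = setT `&` @enorm R @^-1` `]-oo, n%:R]%classic).
  by apply: measurable_enorm => //; exact: measurable_itv.
by rewrite setTI; apply/seteqP; split => x; rewrite /disc /= in_itv.
Qed.

(** Truncation to the discs over which [fourierL2] takes its Fourier integrals. *)
Definition trunc n u x := u x * \1_(disc n) x.

Lemma disc_abs n x : disc n x -> `|x.1| <= n%:R /\ `|x.2| <= n%:R.
Proof.
rewrite /disc /= /enorm => xn; split; apply: le_trans xn; rewrite -sqrtr_sqr ler_wsqrtr//.
  by rewrite lerDl sqr_ge0.
by rewrite lerDr sqr_ge0.
Qed.

Lemma disc_eventually x : \forall n \near \oo, disc n x.
Proof.
exists (Num.truncn (enorm x)).+1 => // n /= xn.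
by rewrite /disc/= ltW// (lt_le_trans (truncnS_gt _))// ler_nat.
Qed.

Lemma intble_disc n : intble m (\1_(disc n)).
Proof.
(* On the disc both coordinates are at most [n] in absolute value, so [wexp 1] is at least
   [expR (- (2 * n))] there. *)
apply: (intble_le _ (intbleZ (expR (2 * n%:R)) (intble_wexp (ltr01 : 0 < 1 :> R)))).
  exact: (measurable_indic (measurable_disc n)).
move=> x; rewrite indicE; case: (boolP (x \in disc n)) => [|_]; last first.
  by rewrite normr0 mulr_ge0 ?expR_ge0 ?wexp_ge0.
rewrite inE => /disc_abs[x1 x2]; rewrite normr1 /wexp /expabs -!expRD -[leLHS]expR0.
by rewrite ler_expR !mul1r; lra.
Qed.

Lemma indic_norm_le1 (A : set (R * R)) x : `|\1_A x : R| <= 1.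
Proof. by rewrite indicE; case: (_ \in _); rewrite ?normr1 ?normr0. Qed.

Lemma L12_trunc n u : sqintble m u -> L12 (trunc n u).
Proof.
move=> su; have md := measurable_indic (measurable_disc n).
have st : sqintble m (trunc n u).
  by apply: (sqintbleM_bounded su (M := 1)) => [|x]; [exact: md|exact: indic_norm_le1].
have sd : sqintble m (\1_(disc n) : R * R -> R).
  by apply: (bounded_sqintble (intble_disc n) (M := 1)) => x; exact: indic_norm_le1.
by split => //; exact: sqintbleM.
Qed.

Lemma trunc_cvg2 u : sqintble m u -> cvg2 m (fun n => trunc n u) u.
Proof.
move=> su; rewrite /cvg2 /sqnorm -(rint0 m).
pose F n x := (trunc n u x - u x) ^+ 2.
have mt n : measurable_fun setT (fun x => trunc n u x - u x).
  by apply: measurable_funB; [exact: (L12_trunc n su).2.1|exact: su.1].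
apply: (@rint_dominated_cvg _ _ _ m F (fun=> 0) (fun x => u x ^+ 2)) => //.
- by move=> n; apply: measurable_funX; exact: mt.
- apply: aeW => x; apply: cvg_near_cst.
  apply: filterS (disc_eventually x) => n xn.
  by rewrite /F /trunc indicE mem_set// mulr1 subrr expr0n.
- exact: su.2.
- move=> n x; rewrite /F ger0_norm ?sqr_ge0// /trunc indicE.
  by case: (_ \in _); rewrite ?mulr1 ?mulr0 ?subrr ?expr0n ?sqr_ge0// sub0r sqrrN.
Qed.

Lemma hartley2_trunc u : sqintble m u -> exists h, hartley2 u h /\
  cvg2 m (fun n => hartley (trunc n u)) h.
Proof.
move=> su.
have [h [sh th]] := hartley_cvg2_ex (fun n => L12_trunc n su) su (trunc_cvg2 su).
exists h; split => //; split => //; exists (fun n => trunc n u); split => //.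
- by move=> n; exact: L12_trunc.
- exact: trunc_cvg2.
Qed.

Lemma intbleM_rect u al be : sqintble m u -> intble m (fun x => u x * rect al be x).
Proof. by move=> su; apply: sqintbleM => //; exact: sqintble_rect. Qed.

Lemma hartley2_rect u h al be : hartley2 u h -> al.1 < be.1 -> al.2 < be.2 ->
  \int[m]_x (h x * hartley (rect al be) x) = \int[m]_x (u x * rect al be x).
Proof.
move=> [su sh [un [un12 unu unh]]] ab1 ab2.
have sr := sqintble_hartley (L12_rect al be).
have c1 := cvg2_rintMr (fun n => sqintble_hartley (un12 n)) sh sr unh.
have c2 := cvg2_rintMr (fun n => (un12 n).2) su (sqintble_rect al be) unu.
apply: (cvg_unique _ c1) => //.
rewrite (_ : (fun n => _) = (fun n => \int[m]_x (un n x * rect al be x)))//.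
apply/funext => n; rewrite hartley_rect_sq//; first exact: (un12 n).1.
exact: sqintble_hartley.
Qed.

(** Let [u'] be a transform of [h]. Adjointness moves the transform onto a rectangle, and
    [hartley2_rect] evaluates the result, so [u'] and [u] have the same integral over every
    rectangle. *)
Lemma hartley2_inv u h : hartley2 u h -> hartley2 h u.
Proof.
move=> uh; have [su sh _] := uh.
have [u' [hu' _]] := hartley2_trunc sh; have [_ su' _] := hu'.
apply: (hartley2_ae hu'); [exact: sh.1|exact: su.1|exact: aeW|].
have sd := sqintbleB su' su.
apply: (@aeS _ _ _ m (fun x => u' x - u x = 0) (fun x => u' x = u x)) => [x /eqP|]; first by rewrite subr_eq0 => /eqP.
apply: rint_rect_loc_eq0_ae; first exact: sd.1.
  by move=> al be; exact: intbleM_rect.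
move=> al be ab1 ab2; under eq_rint do rewrite mulrBl.
rewrite rintB; [|exact: intbleM_rect..].
rewrite (hartley2_adj hu' (hartley2_L12 (L12_rect al be))).
by rewrite (hartley2_rect uh)// subrr.
Qed.

Lemma hartley2_parseval u h v k : hartley2 u h -> hartley2 v k ->
  \int[m]_x (h x * k x) = \int[m]_x (u x * v x).
Proof. by move=> uh vk; rewrite (hartley2_adj uh (hartley2_inv vk)). Qed.

(** The bridge between the two notions of transform: if the Hartley integral of an integrable [h] is
    square-integrable, its L^2 inverse is [h] itself. Integrals over rectangles identify the two. *)
Lemma hartley2_of_hartley h k : intble m h -> hartley2 (hartley h) k ->
  \forall x \ae m, h x = k x.
Proof.
move=> h1 hk; have [su sk _] := hk.
apply: (@aeS _ _ _ m (fun x => h x - k x = 0) (fun x => h x = k x)) => [x /eqP|]; first by rewrite subr_eq0 => /eqP.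
have hr al be : intble m (fun x => h x * rect al be x).
  by apply: (intbleM_bounded h1 (measurable_rect al be)) => x; exact: norm_rect.
apply: rint_rect_loc_eq0_ae.
- by apply: measurable_funB; [exact: intble_mfun h1|exact: sk.1].
- move=> al be; apply: eq_intble (intbleB (hr al be) (intbleM_rect al be sk)) => x.
  by rewrite mulrBl.
- move=> al be ab1 ab2; under eq_rint do rewrite mulrBl.
  rewrite rintB; [|exact: hr|exact: intbleM_rect].
  rewrite (hartley2_adj hk (hartley2_L12 (L12_rect al be))).
  by rewrite hartley_rect_sq// subrr.
Qed.

Lemma neg2K : involutive (@neg2 R).
Proof. by move=> [x y]; rewrite /neg2/= !opprK. Qed.

Lemma hkern_neg x f : hkern x (neg2 f) = hkern (neg2 x) f.
Proof. by rewrite /hkern /dot2 /=; congr (cas (_ * _)); ring. Qed.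

Lemma rint_neg2 u : intble m u -> \int[m]_x u (neg2 x) = \int[m]_x u x.
Proof. by move=> u1; rewrite (rint_scales (scales_neg2 R) u1) mul1r. Qed.

Lemma intble_neg2 u : intble m u -> intble m (u \o @neg2 R).
Proof. exact: (intble_scales (scales_neg2 R)). Qed.

Lemma sqintble_neg2 u : sqintble m u -> sqintble m (u \o @neg2 R).
Proof. exact: (sqintble_scales (scales_neg2 R)). Qed.

Lemma sqnorm_neg2 u : sqintble m u -> sqnorm m (u \o @neg2 R) = sqnorm m u.
Proof. by move=> su; rewrite (sqnorm_scales (scales_neg2 R) su) mul1r. Qed.

Lemma hartley_neg2 u x : intble m u -> hartley (u \o @neg2 R) x = hartley u (neg2 x).
Proof.
move=> u1; rewrite /hartley -rint_neg2; last first.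
  by apply: intble_hkern; exact: intble_neg2.
by apply: eq_rint => f; rewrite /= neg2K hkern_neg.
Qed.

Definition scale2 a x : R * R := (a * x.1, a * x.2).

Lemma scales_scale2 a : a != 0 -> scales_measure m (scale2 a) (`|a|^-1 * `|a|^-1).
Proof.
move=> a0; have := scales_measure_prod (scales_measure_affine 0 a0) (scales_measure_affine 0 a0).
rewrite (_ : (fun x : R * R => _) = scale2 a)//.
by apply/funext => x; rewrite /scale2 !addr0.
Qed.

Definition dilation a c u x := a^-1 * u (dilate a c x).

(** A translation acts on Hartley transforms through [cas (A + B) = cos B * cas A + sin B * cas (-
    A)], which brings in the reflected value of [h]. *)
Definition dilation_dual a c h f :=
  a * (cos (2 * pi * dot2 f c) * h (scale2 a f) + sin (2 * pi * dot2 f c) * h (scale2 (- a) f)).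

Lemma sqintble_dilation a c u : 0 < a -> sqintble m u -> sqintble m (dilation a c u).
Proof.
by move=> a0 su; apply: sqintbleZ; exact: (sqintble_scales (scales_dilate c a0) su).
Qed.

Lemma intble_dilation a c u : 0 < a -> intble m u -> intble m (dilation a c u).
Proof.
by move=> a0 su; apply: intbleZ; exact: (intble_scales (scales_dilate c a0) su).
Qed.

Lemma hartley_dilation a c u f : 0 < a -> intble m u ->
  hartley (dilation a c u) f = dilation_dual a c (hartley u) f.
Proof.
move=> a0 u1; have an0 : a != 0 by rewrite gt_eqF.
rewrite /hartley /dilation_dual.
have uk y : intble m (fun x => u x * hkern y x) by exact: intble_hkern.
set C := cos _; set S := sin _.
rewrite mulrDr ![a * (_ * _)]mulrA -!rintZ//.
rewrite -rintD; [|exact: intbleZ..].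
pose g y := a^-1 * (C * (u y * hkern (scale2 a f) y) + S * (u y * hkern (scale2 (- a) f) y)).
have g1 : intble m g by apply: intbleZ; apply: intbleD; exact: intbleZ.
transitivity (\int[m]_x g (dilate a c x)).
  apply: eq_rint => x; rewrite /g /dilation -mulrA; congr (_ * _).
  rewrite !(mulrCA _ (u _)) -mulrDr; congr (_ * _).
  pose al := 2 * pi * dot2 (scale2 a f) (dilate a c x); pose be := 2 * pi * dot2 f c.
  have E1 : 2 * pi * dot2 x f = al + be.
    by rewrite /al /be /dot2 /scale2 /dilate/=; move: (pi : R) => p; field.
  have E2 : 2 * pi * dot2 (dilate a c x) (scale2 (- a) f) = - al.
    by rewrite /al /dot2 /scale2 /=; ring.
  have E3 : 2 * pi * dot2 (dilate a c x) (scale2 a f) = al.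
    by rewrite /al /dot2 /scale2 /=; ring.
  by rewrite /hkern E1 E2 E3 /cas cosN sinN cosD sinD -/be /C /S -/be; ring.
rewrite (rint_scales (scales_dilate c a0) g1) /g -rintZ//.
by apply: eq_rint => y; field.
Qed.

Lemma sqintble_dilation_dual a c h : a != 0 -> sqintble m h ->
  sqintble m (dilation_dual a c h).
Proof.
move=> a0 sh; have an0 : - a != 0 by rewrite oppr_eq0.
have md : measurable_fun setT (fun f : R * R => 2 * pi * dot2 f c).
  by apply: measurable_funM => //; apply: measurable_funD; apply: measurable_funM.
have mc : measurable_fun setT (fun f : R * R => cos (2 * pi * dot2 f c)).
  by apply: measurableT_comp md; apply: continuous_measurable_fun; exact: continuous_cos.
have ms : measurable_fun setT (fun f : R * R => sin (2 * pi * dot2 f c)).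
  by apply: measurableT_comp md; apply: continuous_measurable_fun; exact: continuous_sin.
apply: sqintbleZ; apply: sqintbleD.
  have := sqintbleM_bounded (sqintble_scales (scales_scale2 a0) sh) mc (M := 1).
  rewrite (_ : (fun x => _) = (fun f => cos (2 * pi * dot2 f c) * h (scale2 a f))).
    by apply => x; rewrite ler_norml cos_geN1 cos_le1.
  by apply/funext => x; rewrite mulrC.
have := sqintbleM_bounded (sqintble_scales (scales_scale2 an0) sh) ms (M := 1).
rewrite (_ : (fun x => _) = (fun f => sin (2 * pi * dot2 f c) * h (scale2 (- a) f))).
  by apply => x; rewrite ler_norml sin_geN1 sin_le1.
by apply/funext => x; rewrite mulrC.
Qed.

Lemma sqnorm_dilation_dual a c h : a != 0 -> sqintble m h ->
  sqnorm m (dilation_dual a c h) <= 4 * sqnorm m h.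
Proof.
move=> a0 sh; have an0 : - a != 0 by rewrite oppr_eq0.
have s1 := sqintble_scales (scales_scale2 a0) sh.
have s2 := sqintble_scales (scales_scale2 an0) sh.
have aa : `|a| * `|a| = a ^+ 2 by rewrite -normrM -expr2 ger0_norm ?sqr_ge0.
have -> : 4 * sqnorm m h = 2 * a ^+ 2 * sqnorm m (h \o scale2 a) +
   2 * a ^+ 2 * sqnorm m (h \o scale2 (- a)).
  rewrite (sqnorm_scales (scales_scale2 a0) sh) (sqnorm_scales (scales_scale2 an0) sh).
  by rewrite normrN -invfM aa; field.
rewrite /sqnorm -!rintZ; [|exact: s2.2|exact: s1.2].
rewrite -rintD; [|exact: intbleZ s1.2|exact: intbleZ s2.2].
apply: le_rint; [exact: (sqintble_dilation_dual c a0 sh).2| |].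
  by apply: intbleD; [exact: intbleZ s1.2|exact: intbleZ s2.2].
move=> x; rewrite /dilation_dual /= exprMn.
set p := h _; set q := h _; set C := cos _; set S := sin _.
have CS : C ^+ 2 + S ^+ 2 = 1 by exact: cos2Dsin2.
(* Lagrange's identity for the unit vector [(C, S)]. The rough constant is harmless, since the bound
   serves only to transport convergence. *)
have key : (C * p + S * q) ^+ 2 <= 2 * p ^+ 2 + 2 * q ^+ 2.
  have := sqr_ge0 (C * q - S * p); have := sqr_ge0 p; have := sqr_ge0 q.
  have -> : (C * q - S * p) ^+ 2 =
      (C ^+ 2 + S ^+ 2) * (p ^+ 2 + q ^+ 2) - (C * p + S * q) ^+ 2 by ring.
  by rewrite CS; lra.
apply: le_trans (ler_wpM2l (sqr_ge0 a) key) _.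
by rewrite le_eqVlt; apply/orP; left; apply/eqP; ring.
Qed.

(** On the approximating functions the formula is pointwise. It passes to the limit because
    [dilation] is an L^2 isometry, [a^-1] squared cancelling the scaling factor [a ^+ 2], and
    [dilation_dual] is bounded. *)
Lemma hartley2_dilation a c u h : 0 < a -> hartley2 u h ->
  hartley2 (dilation a c u) (dilation_dual a c h).
Proof.
move=> a0 [su sh [un [un12 unu unh]]]; have an0 : a != 0 by rewrite gt_eqF.
split; [exact: sqintble_dilation|exact: sqintble_dilation_dual|].
exists (fun n => dilation a c (un n)); split.
- move=> n; split; first by apply: intble_dilation => //; exact: (un12 n).1.
  by apply: sqintble_dilation => //; exact: (un12 n).2.
- rewrite /cvg2 (_ : (fun n => _) = (fun n => sqnorm m (fun x => un n x - u x))); first exact: unu.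
  apply/funext => n; have sd := sqintbleB (un12 n).2 su.
  transitivity (sqnorm m (dilation a c (fun x => un n x - u x))).
    by apply: eq_rint => x; rewrite /dilation mulrBr.
  rewrite sqnormZ; last exact: (sqintble_scales (scales_dilate c a0) sd).
  rewrite (sqnorm_scales (scales_dilate c a0) sd).
  by rewrite mulrA -exprMn mulVf// expr1n mul1r.
- apply: (@squeeze_cvgr _ _ _ _ (fun=> 0)
    (fun n => 4 * sqnorm m (fun x => hartley (un n) x - h x))).
  + apply: nearW => n; rewrite sqnorm_ge0/=.
    have sd := sqintbleB (sqintble_hartley (un12 n)) sh.
    apply: le_trans (sqnorm_dilation_dual c an0 sd).
    rewrite le_eqVlt; apply/orP; left; apply/eqP; apply: eq_rint => f.
    by rewrite hartley_dilation//; [rewrite /dilation_dual; congr (_ ^+ 2); ring|exact: (un12 n).1].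
  + exact: cvg_cst.
  + by rewrite -[X in _ --> X](mulr0 4); apply: cvgMr; exact: unh.
Qed.

End HartleyInversion.

(** * Fourier transforms of real functions *)

Section RealFourier.
Variable R : realType.
Local Notation m := (mu2 R).
Implicit Types (u v h k p q : R * R -> R) (x y f c : R * R) (U V : R * R -> quat R).

Lemma quat_mulE (p q : quat R) : p * q = quat_mul p q. Proof. by []. Qed.

Lemma quat_addE (p q : quat R) : p + q = quat_add p q. Proof. by []. Qed.

Lemma quat_subE (p q : quat R) : p - q =
  Quat (qre p - qre q) (qim1 p - qim1 q) (qim2 p - qim2 q) (qim3 p - qim3 q).
Proof. by []. Qed.

Lemma quat_oppE (p : quat R) : - p = quat_opp p. Proof. by []. Qed.

Definition evenp h f := (h f + h (neg2 f)) / 2.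
Definition oddp h f := (h f - h (neg2 f)) / 2.

(* The Fourier transform of a real function with Hartley transform [h]. *)
Definition qhartley h f : quat R := Quat (evenp h f) 0 (- oddp h f) 0.

Lemma qhartley_inj h k f : qhartley h f = qhartley k f -> h f = k f.
Proof.
move=> [E O]; have -> : h f = evenp h f + oddp h f by rewrite /evenp /oddp; field.
have -> : k f = evenp k f + oddp k f by rewrite /evenp /oddp; field.
by rewrite E; congr (_ + _); apply: oppr_inj.
Qed.

Lemma intble_cos h x : intble m h -> intble m (fun f => h f * cos (2 * pi * dot2 f x)).
Proof.
move=> h1; apply: (intbleM_bounded h1 (M := 1)); last first.
  by move=> f; rewrite ler_norml cos_geN1 cos_le1.
apply: (measurableT_comp (f := @cos R)).
  by apply: continuous_measurable_fun; exact: continuous_cos.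
by apply: measurable_funM => //; apply: measurable_funD; apply: measurable_funM.
Qed.

Lemma intble_sin h x : intble m h -> intble m (fun f => h f * sin (2 * pi * dot2 f x)).
Proof.
move=> h1; apply: (intbleM_bounded h1 (M := 1)); last first.
  by move=> f; rewrite ler_norml sin_geN1 sin_le1.
apply: (measurableT_comp (f := @sin R)).
  by apply: continuous_measurable_fun; exact: continuous_sin.
by apply: measurable_funM => //; apply: measurable_funD; apply: measurable_funM.
Qed.

Lemma hartley_cos_sin h x : intble m h -> hartley h x =
  \int[m]_f (h f * cos (2 * pi * dot2 f x)) + \int[m]_f (h f * sin (2 * pi * dot2 f x)).
Proof.
move=> h1; rewrite -rintD; [|exact: intble_cos|exact: intble_sin].
by apply: eq_rint => f; rewrite /hkern /cas mulrDr.
Qed.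

Lemma dot2_neg x f : dot2 f (neg2 x) = - dot2 f x.
Proof. by rewrite /dot2 /=; ring. Qed.

Lemma dot2C x f : dot2 f x = dot2 x f.
Proof. by rewrite /dot2; ring. Qed.

Lemma hartley_neg_cos_sin h x : intble m h -> hartley h (neg2 x) =
  \int[m]_f (h f * cos (2 * pi * dot2 f x)) - \int[m]_f (h f * sin (2 * pi * dot2 f x)).
Proof.
move=> h1; rewrite hartley_cos_sin// -rintN; last exact: intble_sin.
by congr (_ + _); apply: eq_rint => f; rewrite dot2_neg mulrN ?cosN ?sinN ?mulrN.
Qed.

Lemma rint_odd h : intble m h -> (forall f, h (neg2 f) = - h f) -> \int[m]_f h f = 0.
Proof.
move=> h1 hN; have := rint_neg2 h1; under eq_rint do rewrite hN.
by rewrite rintN// => /eqP; rewrite eqNr => /eqP.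
Qed.

Lemma intble_evenp h : intble m h -> intble m (evenp h).
Proof.
move=> h1; apply: eq_intble (intbleZ 2^-1 (intbleD h1 (intble_neg2 h1))) => f.
by rewrite /evenp mulrC.
Qed.

Lemma intble_oddp h : intble m h -> intble m (oddp h).
Proof.
move=> h1; apply: eq_intble (intbleZ 2^-1 (intbleB h1 (intble_neg2 h1))) => f.
by rewrite /oddp mulrC.
Qed.

Lemma sqintble_evenp h : sqintble m h -> sqintble m (evenp h).
Proof.
move=> sh; have := sqintbleZ 2^-1 (sqintbleD sh (sqintble_neg2 sh)).
by rewrite (_ : (fun _ => _) = evenp h)//; apply/funext => f; rewrite /evenp mulrC.
Qed.

Lemma sqintble_oddp h : sqintble m h -> sqintble m (oddp h).
Proof.
move=> sh; have := sqintbleZ 2^-1 (sqintbleB sh (sqintble_neg2 sh)).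
by rewrite (_ : (fun _ => _) = oddp h)//; apply/funext => f; rewrite /oddp mulrC.
Qed.

Lemma evenp_neg h f : evenp h (neg2 f) = evenp h f.
Proof. by rewrite /evenp neg2K addrC. Qed.

Lemma oddp_neg h f : oddp h (neg2 f) = - oddp h f.
Proof. by rewrite /oddp neg2K -mulNr opprB. Qed.

(** The cosine only sees the even part of [h] and the sine only the odd part of [k], so one function
    tested against [cas] carries both integrals. The difference of the two integrands is odd. *)
Lemma rint_even_cos h k x : intble m h -> intble m k ->
  \int[m]_f (h f * cos (2 * pi * dot2 f x) + k f * sin (2 * pi * dot2 f x)) =
  hartley (fun f => evenp h f + oddp k f) x.
Proof.
move=> h1 k1; have e1 := intble_evenp h1; have o1 := intble_oddp k1.
pose C f := cos (2 * pi * dot2 f x); pose S f := sin (2 * pi * dot2 f x).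
have CN f : C (neg2 f) = C f by rewrite /C dot2C dot2_neg mulrN cosN dot2C.
have SN f : S (neg2 f) = - S f by rewrite /S dot2C dot2_neg mulrN sinN dot2C.
have i1 := intbleD (intble_cos x h1) (intble_sin x k1).
have i2 := intble_hkern x (intbleD e1 o1).
apply/eqP; rewrite -subr_eq0 -rintB//; apply/eqP; apply: rint_odd.
  exact: intbleB.
move=> f; rewrite /hkern /cas -/(C (neg2 f)) -/(S (neg2 f)) -/(C f) -/(S f).
rewrite CN SN evenp_neg oddp_neg /evenp /oddp; move: (C f) (S f) => cf sf.
by field.
Qed.

Lemma fourier_on_disc n u f : sqintble m u ->
  fourier_on (disc n) (qreal \o u) f = qhartley (hartley (trunc n u)) f.
Proof.
move=> su; have [t1 _] := L12_trunc n su.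
rewrite /fourier_on /qintegral /qhartley; congr Quat.
- rewrite Rintegral_mkcond /evenp hartley_cos_sin// hartley_neg_cos_sin//.
  set A := (\int[m]_f _ in RHS); transitivity A; last by field.
  apply: eq_rint => x; rewrite patchE /trunc indicE quat_mulE /= dot2C.
  by case: (_ \in _); rewrite ?mulr1 ?mulr0 ?mul0r// cosN; ring.
- rewrite Rintegral_mkcond -[RHS](rint0 m); apply: eq_rint => x.
  by rewrite patchE quat_mulE /=; case: ifP => _ //; ring.
- rewrite Rintegral_mkcond /oddp hartley_cos_sin// hartley_neg_cos_sin//.
  set B := \int[m]_f (_ * sin _); transitivity (- B); last by field.
  rewrite -rintN; last exact: intble_sin.
  apply: eq_rint => x; rewrite patchE /trunc indicE quat_mulE /= dot2C.
  by case: (_ \in _); rewrite ?mulr1 ?mulr0 ?mul0r ?oppr0// sinN; ring.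
- rewrite Rintegral_mkcond -[RHS](rint0 m); apply: eq_rint => x.
  by rewrite patchE quat_mulE /=; case: ifP => _ //; ring.
Qed.

Lemma qnormsq_qhartley h k f : qnormsq (qhartley h f - qhartley k f) =
  2^-1 * ((h f - k f) ^+ 2 + (h (neg2 f) - k (neg2 f)) ^+ 2).
Proof. by rewrite quat_subE /qnormsq /= /evenp /oddp; field. Qed.

(** Even and odd parts give the average of a square and its reflection, which have the same
    integral; hence L^2 distances of Fourier transforms are those of Hartley transforms. *)
Lemma integral_qnormsq_qhartley h k : sqintble m h -> sqintble m k ->
  (\int[m]_f (qnormsq (qhartley h f - qhartley k f))%:E =
   (sqnorm m (fun x => h x - k x))%:E)%E.
Proof.
move=> sh sk; have sd := sqintbleB sh sk; have sd' := sqintble_neg2 sd.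
under eq_integral do rewrite qnormsq_qhartley.
rewrite rint_EFin; last exact: (intbleZ 2^-1 (intbleD sd.2 sd'.2)).
rewrite rintZ; last exact: (intbleD sd.2 sd'.2).
rewrite rintD; [|exact: sd.2|exact: sd'.2].
have := sqnorm_neg2 sd; rewrite /sqnorm/= => ->.
by congr EFin; field.
Qed.

Definition qmeasurable U := [/\ measurable_fun setT (fun x => qre (U x)),
  measurable_fun setT (fun x => qim1 (U x)), measurable_fun setT (fun x => qim2 (U x)) &
  measurable_fun setT (fun x => qim3 (U x))].

Lemma qnormsq_ge0 (p : quat R) : 0 <= qnormsq p.
Proof. by rewrite /qnormsq !addr_ge0// sqr_ge0. Qed.

Lemma qnormsq_eq0 (p : quat R) : qnormsq p = 0 -> p = 0.
Proof.
case: p => a b c d; rewrite /qnormsq /= => /eqP.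
rewrite !paddr_eq0 ?addr_ge0 ?sqr_ge0// !sqrf_eq0.
by move=> /andP[/andP[/andP[/eqP -> /eqP ->] /eqP ->] /eqP ->].
Qed.

Lemma measurable_qnormsqB U V : qmeasurable U -> qmeasurable V ->
  measurable_fun setT (fun f => (qnormsq (U f - V f))%:E).
Proof.
move=> [U0 U1 U2 U3] [V0 V1 V2 V3]; apply/measurable_EFinP; rewrite /qnormsq /=.
do 3 (apply: measurable_funD; last by apply: measurable_funX; exact: measurable_funB).
by apply: measurable_funX; exact: measurable_funB.
Qed.

Lemma qnormsq_triangle (p q r : quat R) :
  qnormsq (p - r) <= 2 * qnormsq (p - q) + 2 * qnormsq (q - r).
Proof.
have H (a b c : R) : (a - c) ^+ 2 <= 2 * (a - b) ^+ 2 + 2 * (b - c) ^+ 2.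
  by have := sqr_ge0 ((a - b) - (b - c)); nra.
case: p q r => [a b c d] [a' b' c' d'] [a'' b'' c'' d'']; rewrite /qnormsq /=.
have := H a a' a''; have := H b b' b''; have := H c c' c''; have := H d d' d''.
by lra.
Qed.

Lemma L2q_qmeasurable U : L2q U -> qmeasurable U.
Proof. by move=> [/L2P[? _] /L2P[? _] /L2P[? _] /L2P[? _]]. Qed.

Lemma sqintble0 : sqintble m (fun=> 0).
Proof.
by split => //; apply: eq_intble (intble0 m) => x; rewrite expr0n.
Qed.

Lemma L2q_qreal u : sqintble m u -> L2q (qreal \o u).
Proof. by move=> su; split; apply/L2P => //; exact: sqintble0. Qed.

Lemma L2q_qhartley h : sqintble m h -> L2q (qhartley h).
Proof.
move=> sh; split; apply/L2P; try exact: sqintble0.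
  exact: sqintble_evenp.
by apply: sqintbleN; exact: sqintble_oddp.
Qed.

Lemma hartley2_cvg_trunc u h : hartley2 u h -> cvg2 m (fun n => hartley (trunc n u)) h.
Proof.
move=> uh; have [su sh _] := uh; have [k [uk tk]] := hartley2_trunc su.
have [_ sk _] := uk.
apply: cvg2_ae tk; [|exact: sk.1|exact: sh.1|exact: hartley2_unique uk uh].
by move=> n; exact: (sqintble_hartley (L12_trunc n su)).1.
Qed.

Lemma fourierL2_qhartley u h : hartley2 u h -> fourierL2 (qreal \o u) (qhartley h).
Proof.
move=> uh; have [su sh _] := uh; split; [exact: L2q_qreal|exact: L2q_qhartley|].
have c := hartley2_cvg_trunc uh.
rewrite (_ : (fun n => _) = (fun n => (sqnorm m (fun x => hartley (trunc n u) x - h x))%:E)).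
  by apply/cvg_EFin; [exact: nearW|exact: c].
apply/funext => n; rewrite sqnormB_sym -integral_qnormsq_qhartley//.
  by apply: eq_integral => f _; rewrite -fourier_on_disc.
exact: sqintble_hartley (L12_trunc n su).
Qed.

(** Uniqueness of the L^2 limit: [U] and [qhartley h] are both limits of the same truncated Fourier
    integrals. *)
Lemma fourierL2_real u U : fourierL2 (qreal \o u) U ->
  exists h, hartley2 u h /\ \forall f \ae m, U f = qhartley h f.
Proof.
move=> uU; have [[/L2P su _ _ _] LU cU] := uU.
have [h [uh _]] := hartley2_trunc su; exists h; split => //.
have [_ LH cH] := fourierL2_qhartley uh.
have mU := L2q_qmeasurable LU; have mH := L2q_qmeasurable LH.
pose F n := qhartley (hartley (trunc n u)).
have FE n : fourier_on [set x | enorm x <= n%:R] (qreal \o u) = F n.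
  by apply/funext => f; exact: fourier_on_disc.
have mF n : qmeasurable (F n).
  by apply: L2q_qmeasurable; apply: L2q_qhartley; exact: sqintble_hartley (L12_trunc n su).
have ge0 V W f : (0 <= (qnormsq (V f - W f))%:E)%E by rewrite lee_fin qnormsq_ge0.
have E0 : (\int[m]_f (qnormsq (U f - qhartley h f))%:E = 0)%E.
  apply/eqP; rewrite eq_le integral_ge0 ?andbT//.
  pose A n := (\int[m]_f (qnormsq (U f - F n f))%:E)%E.
  pose B n := (\int[m]_f (qnormsq (qhartley h f - F n f))%:E)%E.
  have cA : A n @[n --> \oo] --> 0%E.
    by move: cU; under eq_fun do under eq_integral do rewrite FE.
  have cB : B n @[n --> \oo] --> 0%E.
    by move: cH; under eq_fun do under eq_integral do rewrite FE.
  (* By the triangle inequality this bounds a distance that does not depend on [n], which is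
     therefore 0. *)
  have cAB : (2%:E * A n + 2%:E * B n)%E @[n --> \oo] --> 0%E.
    rewrite -[X in _ --> X](_ : (2%:E * 0 + 2%:E * 0 = 0)%E); last by rewrite !mule0 adde0.
    apply: cvgeD; [by rewrite !mule0| |].
      by apply: cvgeZl => //; exact: cA.
    by apply: cvgeZl => //; exact: cB.
  apply: (cvge_ge _ cAB); apply: nearW => n.
  have mUF := measurable_qnormsqB mU (mF n); have mHF := measurable_qnormsqB mH (mF n).
  rewrite /A /B -!ge0_integralZl//; try by move=> f _; exact: ge0.
  rewrite -ge0_integralD//; last 4 first.
  - by move=> f _; rewrite mule_ge0// ge0.
  - exact: measurable_funeM.
  - by move=> f _; rewrite mule_ge0// ge0.
  - exact: measurable_funeM.
  apply: ge0_le_integral => //.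
  - exact: measurable_qnormsqB.
  - by apply: emeasurable_funD; exact: measurable_funeM.
  - move=> f _; rewrite -!EFinM -EFinD lee_fin.
    apply: le_trans (qnormsq_triangle _ (F n f) _) _.
    rewrite lerD2l (_ : qnormsq (F n f - _) = qnormsq (qhartley h f - F n f))//.
    by rewrite -opprB quat_oppE /qnormsq /= !sqrrN.
have mD := measurable_qnormsqB mU mH.
have : (\int[m]_f `|(qnormsq (U f - qhartley h f))%:E| = 0)%E.
  by rewrite -[RHS]E0; apply: eq_integral => f _; rewrite gee0_abs.
move/(ae_eq_integral_abs m measurableT mD).
apply: (@aeS _ _ _ m _ (fun f => U f = qhartley h f)) => f /(_ I) [] /qnormsq_eq0.
by move/eqP; rewrite subr_eq0 => /eqP.
Qed.

End RealFourier.

(** * Riesz transforms *)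

Section RieszTransform.
Variable R : realType.
Local Notation m := (mu2 R).
Implicit Types (u v h k p q : R * R -> R) (x y f c : R * R) (U V : R * R -> quat R).

Lemma inv_fourier_re U x : L1q U -> qre (inv_fourier U x) =
  \int[m]_f (qre (U f) * cos (2 * pi * dot2 f x)) -
  \int[m]_f (qim2 (U f) * sin (2 * pi * dot2 f x)).
Proof.
move=> [/L1P U0 _ /L1P U2 _].
rewrite -rintB; [|exact: intble_cos U0|exact: intble_sin U2].
by apply: eq_rint => f; rewrite quat_mulE; case: (U f) => a b c d /=; ring.
Qed.

Lemma inv_fourier_im2 U x : L1q U -> qim2 (inv_fourier U x) =
  \int[m]_f (qre (U f) * sin (2 * pi * dot2 f x)) +
  \int[m]_f (qim2 (U f) * cos (2 * pi * dot2 f x)).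
Proof.
move=> [/L1P U0 _ /L1P U2 _].
rewrite -rintD; [|exact: intble_sin U0|exact: intble_cos U2].
by apply: eq_rint => f; rewrite quat_mulE; case: (U f) => a b c d /=; ring.
Qed.

Lemma inv_fourier_im1 U x : L1q U -> qim1 (inv_fourier U x) =
  \int[m]_f (qim1 (U f) * cos (2 * pi * dot2 f x)) -
  \int[m]_f (qim3 (U f) * sin (2 * pi * dot2 f x)).
Proof.
move=> [_ /L1P U1 _ /L1P U3].
rewrite -rintB; [|exact: intble_cos U1|exact: intble_sin U3].
by apply: eq_rint => f; rewrite quat_mulE; case: (U f) => a b c d /=; ring.
Qed.

Lemma inv_fourier_im3 U x : L1q U -> qim3 (inv_fourier U x) =
  \int[m]_f (qim1 (U f) * sin (2 * pi * dot2 f x)) +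
  \int[m]_f (qim3 (U f) * cos (2 * pi * dot2 f x)).
Proof.
move=> [_ /L1P U1 _ /L1P U3].
rewrite -rintD; [|exact: intble_sin U1|exact: intble_cos U3].
by apply: eq_rint => f; rewrite quat_mulE; case: (U f) => a b c d /=; ring.
Qed.

Lemma L1q_qhartley h : intble m h -> L1q (qhartley h).
Proof.
move=> h1; split; apply/L1P; try exact: intble0.
  exact: intble_evenp.
by apply: intbleN; exact: intble_oddp.
Qed.

Lemma rint_evenp_sin h x : intble m h ->
  \int[m]_f (evenp h f * sin (2 * pi * dot2 f x)) = 0.
Proof.
move=> h1; apply: rint_odd; first by apply: intble_sin; exact: intble_evenp.
by move=> f; rewrite evenp_neg dot2C dot2_neg mulrN sinN mulrN dot2C.
Qed.

Lemma rint_oddp_cos h x : intble m h ->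
  \int[m]_f (oddp h f * cos (2 * pi * dot2 f x)) = 0.
Proof.
move=> h1; apply: rint_odd; first by apply: intble_cos; exact: intble_oddp.
by move=> f; rewrite oddp_neg dot2C dot2_neg mulrN cosN mulNr dot2C.
Qed.

Lemma inv_fourier_qhartley h x : intble m h ->
  inv_fourier (qhartley h) x = qreal (hartley h x).
Proof.
move=> h1; have Q1 := L1q_qhartley h1.
have e1 := intble_evenp h1; have o1 := intble_oddp h1.
have := inv_fourier_re x Q1; have := inv_fourier_im1 x Q1.
have := inv_fourier_im2 x Q1; have := inv_fourier_im3 x Q1.
case: (inv_fourier _ x) => A B C D /= -> -> -> ->; rewrite /qreal; congr Quat.
- transitivity (\int[m]_f (evenp h f * cos (2 * pi * dot2 f x)) +
    \int[m]_f (oddp h f * sin (2 * pi * dot2 f x))).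
    congr (_ + _); rewrite -rintN; last by apply: intble_sin; exact: intbleN.
    by apply: eq_rint => f; ring.
  transitivity (hartley (evenp h) x + hartley (oddp h) x).
    by rewrite !hartley_cos_sin// rint_evenp_sin// rint_oddp_cos// addr0 add0r.
  rewrite /hartley -rintD; [|exact: intble_hkern..].
  by apply: eq_rint => f; rewrite /evenp /oddp; field.
- by under eq_rint do rewrite mul0r; under [X in _ - X]eq_rint do rewrite mul0r; rewrite rint0 subrr.
- rewrite rint_evenp_sin// add0r.
  under eq_rint do rewrite mulNr.
  by rewrite rintN ?rint_oddp_cos ?oppr0//; exact: intble_cos.
- by under eq_rint do rewrite mul0r; under [X in _ + X]eq_rint do rewrite mul0r; rewrite rint0 addr0.
Qed.

Lemma fourierW_qhartley h : intble m h -> fourierW (qreal \o hartley h) (qhartley h).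
Proof.
by move=> h1; split => [|x]; [exact: L1q_qhartley|rewrite inv_fourier_qhartley].
Qed.

(* A pair [(p, q)] stands for the complex-valued function [p + j q]; a real
   inverse Fourier transform forces [p] to be even and [q] to be odd. *)
Lemma real_inverse_transform p q u : intble m p -> intble m q ->
  (forall x, u x = \int[m]_f (p f * cos (2 * pi * dot2 f x)) -
                   \int[m]_f (q f * sin (2 * pi * dot2 f x))) ->
  (forall x, 0 = \int[m]_f (p f * sin (2 * pi * dot2 f x)) +
                 \int[m]_f (q f * cos (2 * pi * dot2 f x))) ->
  exists h, [/\ intble m h, forall x, u x = hartley h x &
    \forall f \ae m, p f = evenp h f /\ q f = - oddp h f].
Proof.
move=> p1 q1 up u0.
have p1' := intble_neg2 p1; have q1' := intble_neg2 q1.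
(* Both candidates have Hartley transform [u], so injectivity on L^1 makes them equal almost
   everywhere. That equality, read at [f] and at [neg2 f], is the parity claim. *)
pose h f := p f + q (neg2 f); pose k f := p (neg2 f) - q f.
have h1 : intble m h := intbleD p1 q1'.
have k1 : intble m k := intbleB p1' q1.
have uh x : u x = hartley h x.
  have -> : hartley h x = hartley p x + hartley (q \o @neg2 R) x.
    rewrite /hartley -rintD; [|exact: intble_hkern..].
    by apply: eq_rint => f; rewrite mulrDl.
  rewrite hartley_neg2// hartley_cos_sin// hartley_neg_cos_sin// up.
  by have := u0 x; lra.
have uk x : u x = hartley k x.
  rewrite /k hartleyB// (hartley_neg2 x p1) hartley_neg_cos_sin// hartley_cos_sin// up.
  by have := u0 x; lra.
exists h; split => //.
have hk : \forall f \ae m, h f - k f = 0.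
  apply: hartley_eq0_ae; first exact: intbleB.
  by move=> x; rewrite hartleyB// -uh -uk subrr.
have hk' := ae_scales (scales_neg2 R) hk.
apply: (@aeS2 _ _ _ m _ _ (fun f => p f = evenp h f /\ q f = - oddp h f) _ hk hk') => f.
rewrite /h /k neg2K /evenp /oddp neg2K => e1 e2.
by split; lra.
Qed.

Lemma fourierW_real u U : fourierW (qreal \o u) U ->
  exists h, [/\ intble m h, forall x, u x = hartley h x &
    \forall f \ae m, U f = qhartley h f].
Proof.
move=> [U1 Uu]; have [/L1P I0 /L1P I1 /L1P I2 /L1P I3] := U1.
have [|x|h [h1 uh Uh]] := @real_inverse_transform _ _ u I0 I2.
- by move=> x; rewrite -inv_fourier_re// -Uu.
- by rewrite -inv_fourier_im2// -Uu.
(* The [qi] and [qk] components form a second such pair, whose inverse transform is the zero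
   function. *)
have [|x|h' [h1' uh' Uh']] := @real_inverse_transform _ _ (fun=> 0) I1 I3.
- by move=> x; rewrite -inv_fourier_im1// -Uu.
- by rewrite -inv_fourier_im3// -Uu.
have z : \forall f \ae m, h' f = 0 by apply: hartley_eq0_ae => // x; rewrite -uh'.
have z' := ae_scales (scales_neg2 R) z.
exists h; split => //.
have z2 : \forall f \ae m, qim1 (U f) = 0 /\ qim3 (U f) = 0.
  have zz := @aeS2 _ _ _ m _ _ (fun f => h' f = 0 /\ h' (neg2 f) = 0) (fun f a b => conj a b) z z'.
  apply: (@aeS2 _ _ _ m _ _ (fun f => qim1 (U f) = 0 /\ qim3 (U f) = 0) _ Uh' zz) => f.
  by move=> [/= -> ->] [a b]; rewrite /evenp /oddp a b subrr addr0 mul0r oppr0.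
apply: (@aeS2 _ _ _ m _ _ (fun f => U f = qhartley h f) _ Uh z2) => f.
by rewrite /qhartley /=; case: (U f) => a b c d /= [-> ->] [-> ->].
Qed.

Definition rsymb l f : R := fcoord l f / enorm f.

Definition rhartley l h f := rsymb l f * h (neg2 f).

Lemma rsymb_neg l f : rsymb l (neg2 f) = - rsymb l f.
Proof. by rewrite /rsymb /fcoord /enorm /= !sqrrN; case: ifP => _; rewrite mulNr. Qed.

Lemma norm_rsymb l f : `|rsymb l f| <= 1.
Proof.
have H : `|fcoord l f| <= enorm f.
  rewrite /enorm -sqrtr_sqr ler_wsqrtr// /fcoord; case: ifP => _.
    by rewrite lerDl sqr_ge0.
  by rewrite lerDr sqr_ge0.
have en0 : 0 <= enorm f by exact: sqrtr_ge0.
rewrite /rsymb normrM normfV (ger0_norm en0).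
have [->|n0] := eqVneq (enorm f) 0; first by rewrite invr0 mulr0.
by rewrite ler_pdivrMr ?mul1r// lt_def n0.
Qed.

Lemma rsymb_scale l a f : 0 < a -> rsymb l (scale2 a f) = rsymb l f.
Proof.
move=> a0; have an0 : a != 0 by rewrite gt_eqF.
have E : enorm (scale2 a f) = a * enorm f.
  rewrite /enorm /scale2 /= !exprMn -mulrDr sqrtrM ?sqr_ge0//.
  by rewrite sqrtr_sqr gtr0_norm.
have F : fcoord l (scale2 a f) = a * fcoord l f by rewrite /fcoord; case: ifP.
rewrite /rsymb E F; have [->|n0] := eqVneq (enorm f) 0; first by rewrite mulr0 invr0 !mulr0.
by field; rewrite n0 an0.
Qed.

Lemma measurable_rsymb l : measurable_fun setT (@rsymb l).
Proof.
apply: measurable_funM.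
  by rewrite /fcoord; case: (l == ord0); [exact: measurable_fst|exact: measurable_snd].
(* Inverse and power -1 agree at 0 as well, where both are 0. *)
rewrite (_ : (fun _ => _) = (fun f : R * R => enorm f `^ (-1))).
  by apply: (measurableT_comp (measurable_powR _)); exact: measurable_enorm.
by apply/funext => f; rewrite powR_inv1// sqrtr_ge0.
Qed.

Lemma sqintble_rhartley l h : sqintble m h -> sqintble m (rhartley l h).
Proof.
move=> sh; have := sqintbleM_bounded (sqintble_neg2 sh) (measurable_rsymb l) (@norm_rsymb l).
by rewrite (_ : (fun _ => _) = rhartley l h)//; apply/funext => f; rewrite mulrC.
Qed.

Lemma intble_rhartley l h : intble m h -> intble m (rhartley l h).
Proof.
move=> h1; have := intbleM_bounded (intble_neg2 h1) (measurable_rsymb l) (@norm_rsymb l).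
by apply: eq_intble => f; rewrite mulrC.
Qed.

(** The factor [- qj] exchanges the two components and the odd real factor exchanges parities, so
    the form of [qhartley] persists. The new function is the symbol times even part minus odd part,
    and that difference is the reflection of [h]. *)
Lemma qhartley_symbol l h f : qhartley h f * riesz_symbol l f = qhartley (rhartley l h) f.
Proof.
rewrite /riesz_symbol /qhartley quat_mulE quat_mulE quat_oppE /= -/(rsymb l f).
rewrite /evenp /oddp /rhartley rsymb_neg neg2K.
by congr Quat; field.
Qed.

Lemma ae_rhartley l h k : (\forall f \ae m, h f = k f) ->
  \forall f \ae m, rhartley l h f = rhartley l k f.
Proof.
move=> hk; apply: aeS (ae_scales (scales_neg2 R) hk) => f.
by rewrite /rhartley => ->.
Qed.

Lemma riesz_relL2 l u h k : hartley2 u h -> riesz_rel (@fourierL2 R) l u k ->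
  hartley2 k (rhartley l h).
Proof.
move=> uh [U [uU kU]]; have [su sh _] := uh.
have [h1 [uh1 Uh1]] := fourierL2_real uU; have [h2 [kh2 Uh2]] := fourierL2_real kU.
have [sk _ _] := kh2.
apply: (hartley2_ae kh2); [exact: sk.1|exact: (sqintble_rhartley l sh).1|exact: aeW|].
have E1 : \forall f \ae m, h2 f = rhartley l h1 f.
  apply: (@aeS2 _ _ _ m _ _ (fun f => h2 f = rhartley l h1 f) _ Uh1 Uh2) => f -> E.
  by apply: qhartley_inj; rewrite -qhartley_symbol -E.
have E2 := ae_rhartley l (hartley2_unique uh1 uh).
by apply: (@aeS2 _ _ _ m _ _ (fun f => h2 f = rhartley l h f) _ E1 E2) => f ->.
Qed.

Lemma riesz_relW l h k : intble m h -> riesz_rel (@fourierW R) l (hartley h) k ->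
  exists h', [/\ intble m h', k = hartley h' &
    \forall f \ae m, h' f = rhartley l h f].
Proof.
move=> h1 [U [uU kU]].
have [g1 [i1 ug1 Ug1]] := fourierW_real uU; have [g2 [i2 kg2 Ug2]] := fourierW_real kU.
exists g2; split => //; first exact/funext.
have E1 : \forall f \ae m, g2 f = rhartley l g1 f.
  apply: (@aeS2 _ _ _ m _ _ (fun f => g2 f = rhartley l g1 f) _ Ug1 Ug2) => f -> E.
  by apply: qhartley_inj; rewrite -qhartley_symbol -E.
have E0 : \forall f \ae m, g1 f - h f = 0.
  apply: hartley_eq0_ae; first exact: intbleB.
  by move=> x; rewrite hartleyB// -ug1 subrr.
have E2 : \forall f \ae m, rhartley l g1 f = rhartley l h f.
  apply: ae_rhartley; apply: (@aeS _ _ _ m _ (fun f => g1 f = h f) _ E0) => f /eqP.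
  by rewrite subr_eq0 => /eqP.
by apply: (@aeS2 _ _ _ m _ _ (fun f => g2 f = rhartley l h f) _ E1 E2) => f ->.
Qed.

(** An equality at every point: the spectrum behind the chosen value is fixed up to a null set,
    which a Hartley integral does not see. *)
Lemma riesz_hartley l h : intble m h -> riesz l (hartley h) = hartley (rhartley l h).
Proof.
move=> h1; have r1 := intble_rhartley l h1.
have ex : riesz_rel (@fourierW R) l (hartley h) (hartley (rhartley l h)).
  exists (qhartley h); split; first exact: fourierW_qhartley.
  rewrite (_ : (fun f => _) = qhartley (rhartley l h)); first exact: fourierW_qhartley.
  by apply/funext => f; exact: qhartley_symbol.
have := xgetPex (xget (fun=> 0) (riesz_rel (@fourierL2 R) l (hartley h))) (ex_intro _ _ ex).
rewrite -/(riesz l (hartley h)) => /(riesz_relW h1)[h' [h1' -> hh']].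
apply/funext => x; apply: rint_ae.
- exact: intble_mfun (intble_hkern x h1').
- exact: intble_mfun (intble_hkern x r1).
- by apply: aeS hh' => f ->.
Qed.

(** Holds for either branch of the choice in [riesz]. If [u] is the Hartley integral of an
    integrable [g], then [g] equals [h] almost everywhere by [hartley2_of_hartley], which makes the
    pointwise Riesz transform an L^2 one. *)
Lemma riesz_hartley2 l u h : hartley2 u h -> hartley2 (riesz l u) (rhartley l h).
Proof.
move=> uh; have [su sh _] := uh.
rewrite /riesz; have [[k Wk]|nW] := pselect (exists k, riesz_rel (@fourierW R) l u k).
  have := xgetPex (xget (fun=> 0) (riesz_rel (@fourierL2 R) l u)) (ex_intro _ _ Wk).
  move: (xget _ _) => {Wk}k [U [uU kU]].
  have [g [g1 ug _]] := fourierW_real uU.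
  have uE : u = hartley g by apply/funext.
  have : riesz_rel (@fourierW R) l (hartley g) k by exists U; rewrite -uE.
  move=> /(riesz_relW g1)[h' [h1' -> hh']].
  have gh : \forall f \ae m, g f = h f by apply: hartley2_of_hartley => //; rewrite -uE.
  have sr := sqintble_rhartley l sh.
  have E : \forall f \ae m, h' f = rhartley l h f.
    apply: (@aeS2 _ _ _ m _ _ (fun f => h' f = rhartley l h f) _ hh' (ae_rhartley l gh)) => f.
    by move=> ->.
  have s' : sqintble m h'.
    apply: sqintble_ae sr; first exact: intble_mfun h1'.
    by apply: (@aeS _ _ _ m _ (fun f => rhartley l h f = h' f) _ E) => f ->.
  have H := hartley2_inv (hartley2_L12 (conj h1' s')).
  have [sH _ _] := H.
  by apply: (hartley2_ae H); [exact: sH.1|exact: sr.1|exact: aeW|exact: E].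
rewrite xgetPN; last by move=> k Wk; apply: nW; exists k.
have sr := sqintble_rhartley l sh.
have [k [rk _]] := hartley2_trunc sr; have kr := hartley2_inv rk.
have ex : riesz_rel (@fourierL2 R) l u k.
  exists (qhartley h); split; first exact: fourierL2_qhartley.
  rewrite (_ : (fun f => _) = qhartley (rhartley l h)); first exact: fourierL2_qhartley.
  by apply/funext => f; exact: qhartley_symbol.
have := xgetPex (fun=> 0) (ex_intro _ _ ex).
exact: riesz_relL2.
Qed.

End RieszTransform.

(** * Correlations and the theorem *)

Section Correlation.
Variable R : realType.
Local Notation m := (mu2 R).
Implicit Types (u v h k g p psi : R * R -> R) (x y f b c : R * R) (a theta : R).

(** The two summands come from the cosine and the sine term of [dilation_dual], merged by
    [rint_even_cos]. *)
Definition corr_spectrum a h p f :=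
  evenp (fun y => a * (h y * p (scale2 a y))) f +
  oddp (fun y => a * (h y * p (scale2 (- a) y))) f.

Lemma intble_corr_part a (b : R) h p : b != 0 -> sqintble m h -> sqintble m p ->
  intble m (fun y => a * (h y * p (scale2 b y))).
Proof.
move=> b0 sh sp; apply: intbleZ.
exact: (sqintbleM sh (sqintble_scales (scales_scale2 b0) sp)).
Qed.

Lemma intble_corr_spectrum a h p : a != 0 -> sqintble m h -> sqintble m p ->
  intble m (corr_spectrum a h p).
Proof.
move=> a0 sh sp; have an0 : - a != 0 by rewrite oppr_eq0.
by apply: intbleD; [apply: intble_evenp|apply: intble_oddp]; exact: intble_corr_part.
Qed.

Lemma rint_dilation_corr a c g h psi p : 0 < a -> hartley2 g h -> hartley2 psi p ->
  \int[m]_x (g x * dilation a c psi x) = hartley (corr_spectrum a h p) c.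
Proof.
move=> a0 gh pp; have a0' : a != 0 by rewrite gt_eqF.
have an0 : - a != 0 by rewrite oppr_eq0.
have [_ sh _] := gh; have [_ sp _] := pp.
rewrite -(hartley2_parseval gh (hartley2_dilation c a0 pp)).
rewrite -rint_even_cos; [|exact: intble_corr_part..].
by apply: eq_rint => f; rewrite /dilation_dual; ring.
Qed.

Lemma scale2_neg a f : scale2 a (neg2 f) = scale2 (- a) f.
Proof. by rewrite /scale2 /neg2 /= !mulrN !mulNr. Qed.

Lemma scale2N a f : neg2 (scale2 a f) = scale2 (- a) f.
Proof. by rewrite /scale2 /neg2 /= !mulNr. Qed.

Lemma rhartley_corr_left l a h p f :
  corr_spectrum a (rhartley l h) p f = rhartley l (corr_spectrum a h p) f.
Proof.
rewrite /corr_spectrum /evenp /oddp /rhartley rsymb_neg !neg2K !scale2_neg opprK.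
by field.
Qed.

(** The symbol is read at [a y] in the even part and at [- a y] in the odd part. Homogeneity removes
    the positive [a]; the sign flip together with the exchange of parities yields minus the
    reflected spectrum. *)
Lemma rhartley_corr_right l a h p f : 0 < a ->
  corr_spectrum a h (rhartley l p) f = - rhartley l (corr_spectrum a h p) f.
Proof.
move=> a0; rewrite /corr_spectrum /evenp /oddp /rhartley !neg2K !scale2_neg opprK.
rewrite !scale2N opprK -!(scale2N a f) rsymb_neg rsymb_scale//.
by field.
Qed.

Definition correlation a g psi c := \int[m]_x (g x * dilation a c psi x).

Lemma riesz_correlation l a g h psi p : 0 < a -> hartley2 g h -> hartley2 psi p ->
  riesz l (correlation a g psi) = correlation a (riesz l g) psi /\
  forall c, riesz l (correlation a g psi) c = - correlation a g (riesz l psi) c.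
Proof.
move=> a0 gh pp; have a0' : a != 0 by rewrite gt_eqF.
have [_ sh _] := gh; have [_ sp _] := pp.
have h1 := intble_corr_spectrum a0' sh sp.
have E : correlation a g psi = hartley (corr_spectrum a h p).
  by apply/funext => c; exact: rint_dilation_corr.
have E1 : correlation a (riesz l g) psi = hartley (rhartley l (corr_spectrum a h p)).
  apply/funext => c; rewrite /correlation.
  rewrite (rint_dilation_corr c a0 (riesz_hartley2 l gh) pp).
  by congr (hartley _ c); apply/funext => f; exact: rhartley_corr_left.
split; first by rewrite E riesz_hartley.
move=> c; rewrite E riesz_hartley// /correlation.
rewrite (rint_dilation_corr c a0 gh (riesz_hartley2 l pp)).
have r1 := intble_rhartley l h1.
rewrite /hartley -rintN; last first.
  apply: intble_hkern; apply: (eq_intble _ (intbleN r1)) => f.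
  by rewrite rhartley_corr_right.
by apply: eq_rint => f; rewrite rhartley_corr_right//; ring.
Qed.

Lemma wavelet_arg_dilate a theta b x :
  wavelet_arg (Windex a theta b) x = dilate a (rotv (- theta) b) (rotv (- theta) x).
Proof. by rewrite /wavelet_arg /dilate /rotv /=; congr pair; ring. Qed.

(** Substituting the rotated variable turns the rotated wavelet at [b] into an unrotated one at
    [rotv (- theta) b], exactly where [rotate theta] evaluates the Riesz transforms. *)
Lemma rint_rotated_wavelet a theta b g psi : 0 <= theta -> theta < 2 * pi -> 0 < a ->
  sqintble m g -> sqintble m psi ->
  \int[m]_x (g (rotv (- theta) x) * (a^-1 * psi (wavelet_arg (Windex a theta b) x))) =
  correlation a g psi (rotv (- theta) b).
Proof.
move=> t0 t1 a0 sg sp; set c := rotv _ b.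
have tn : `|- theta| < 2 * pi by rewrite normrN ger0_norm.
have i1 := sqintbleM sg (sqintble_dilation c a0 sp).
rewrite /correlation -[RHS]mul1r -(rint_scales (scales_rotv tn) i1).
by apply: eq_rint => x; rewrite wavelet_arg_dilate.
Qed.

Lemma sum_qij (s t w : R) : qreal s + qi * qreal t + qj * qreal w = Quat s t w 0.
Proof. by rewrite !quat_mulE !quat_addE /quat_add /=; congr Quat; ring. Qed.

Lemma intble_rotated_wavelet a theta b g psi : 0 <= theta -> theta < 2 * pi -> 0 < a ->
  sqintble m g -> sqintble m psi ->
  intble m (fun x => g (rotv (- theta) x) * (a^-1 * psi (wavelet_arg (Windex a theta b) x))).
Proof.
move=> t0 t1 a0 sg sp.
have tn : `|- theta| < 2 * pi by rewrite normrN ger0_norm.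
have i1 := sqintbleM sg (sqintble_dilation (rotv (- theta) b) a0 sp).
apply: eq_intble (intble_scales (scales_rotv tn) i1) => x.
by rewrite wavelet_arg_dilate.
Qed.

End Correlation.

Theorem theorem7 (R : realType) (g psi : R * R -> R) (a theta : R) (b : R * R)
    (hg : L2 g) (hpsi : admissible psi)
    (ha : 0 < a) (htheta0 : 0 <= theta) (htheta1 : theta < 2 * pi) :
  wt_plus psi (Windex a theta b) (fun x => qreal (g x))
  = monogenic_theta theta
      (fun b' => wt_real psi (Windex a 0 b') (tilde theta g)) b
  /\
  monogenic_theta theta
      (fun b' => wt_real psi (Windex a 0 b') (tilde theta g)) b
  = qwt_real psi (Windex a theta b) (monogenic_theta theta (tilde theta g)).
Proof.
have [/L2P sp _ _] := hpsi; have sg0 : sqintble (mu2 R) g by exact/L2P.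
have tn : `|theta| < 2 * pi by rewrite ger0_norm.
set G := tilde theta g.
have sg : sqintble (mu2 R) G by exact: (sqintble_scales (scales_rotv tn) sg0).
have [h [gh _]] := hartley2_trunc sg; have [p [pp _]] := hartley2_trunc sp.
(* At angle 0 the wavelet coefficients are the correlations themselves. *)
have W : (fun b' => wt_real psi (Windex a 0 b') G) = correlation a G psi.
  apply/funext => c; apply: eq_rint => x; rewrite /wavelet_at wavelet_arg_dilate /dilation /=.
  by rewrite oppr0 /rotv cos0 sin0 !mul1r !mul0r !subr0 !add0r -!surjective_pairing.
have gE x : g x = G (rotv (- theta) x) by rewrite /G /tilde rotvNK.
rewrite W /monogenic_theta /rotate; set c := rotv (- theta) b.
have R0 := riesz_correlation 0 ha gh pp; have R1 := riesz_correlation 1 ha gh pp.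
have sr l : sqintble (mu2 R) (riesz l psi) by have [] := riesz_hartley2 l pp.
have sG l : sqintble (mu2 R) (riesz l G) by have [] := riesz_hartley2 l gh.
rewrite !sum_qij; split.
  (* The Riesz transforms move to the wavelet, and the resulting minus signs are those of
     [qconj]. *)
  rewrite R0.2 R1.2 /wt_plus /qintegral.
  have E x : qreal (g x) * qconj (qwavelet_at (monogenic_wavelet psi) (Windex a theta b) x) =
      Quat (g x * (a^-1 * psi (wavelet_arg (Windex a theta b) x)))
           (- (g x * (a^-1 * riesz 0 psi (wavelet_arg (Windex a theta b) x))))
           (- (g x * (a^-1 * riesz 1 psi (wavelet_arg (Windex a theta b) x)))) 0.
    rewrite /qwavelet_at /monogenic_wavelet sum_qij !quat_mulE /=.
    by congr Quat; ring.
  congr Quat.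
  - rewrite -(rint_rotated_wavelet b htheta0 htheta1 ha sg sp).
    by apply: eq_rint => x; rewrite E gE.
  - rewrite -(rint_rotated_wavelet b htheta0 htheta1 ha sg (sr 0)) -rintN; last first.
      exact: intble_rotated_wavelet.
    by apply: eq_rint => x; rewrite E gE.
  - rewrite -(rint_rotated_wavelet b htheta0 htheta1 ha sg (sr 1)) -rintN; last first.
      exact: intble_rotated_wavelet.
    by apply: eq_rint => x; rewrite E gE.
  - by rewrite -[RHS](rint0 (mu2 R)); apply: eq_rint => x; rewrite E.
(* For the second equality they move to the signal, without a sign. *)
rewrite R0.1 R1.1 /qwt_real /qintegral.
have E x : (qreal (G (rotv (- theta) x)) + qi * qreal (riesz 0 G (rotv (- theta) x)) +
      qj * qreal (riesz 1 G (rotv (- theta) x))) *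
    qreal (wavelet_at psi (Windex a theta b) x) =
    Quat (G (rotv (- theta) x) * (a^-1 * psi (wavelet_arg (Windex a theta b) x)))
      (riesz 0 G (rotv (- theta) x) * (a^-1 * psi (wavelet_arg (Windex a theta b) x)))
      (riesz 1 G (rotv (- theta) x) * (a^-1 * psi (wavelet_arg (Windex a theta b) x))) 0.
  by rewrite sum_qij quat_mulE /wavelet_at /=; congr Quat; ring.
congr Quat.
- rewrite -(rint_rotated_wavelet b htheta0 htheta1 ha sg sp).
  by apply: eq_rint => x; rewrite E.
- rewrite -(rint_rotated_wavelet b htheta0 htheta1 ha (sG 0) sp).
  by apply: eq_rint => x; rewrite E.
- rewrite -(rint_rotated_wavelet b htheta0 htheta1 ha (sG 1) sp).
  by apply: eq_rint => x; rewrite E.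
- by rewrite -[LHS](rint0 (mu2 R)); apply: eq_rint => x; rewrite E.
Qed.
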